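(* Let $\varphi:\mathbb{R}\to\mathbb{R}$ be continuous and nondecreasing, let $\mu\ge0$ be an even Radon measure on $\mathbb{R}^N\setminus\{0\}$ with $\int_{|z|\le1}|z|^2\mu(\mathrm{d}z)+\int_{|z|>1}\mu(\mathrm{d}z)<\infty$, and let $u_0\in L^1(\mathbb{R}^N)\cap L^\infty(\mathbb{R}^N)$. Consider the Cauchy problem $$\partial_tu-\mathcal{L}^\mu[\varphi(u)]=0\ \text{ in }Q_T,\qquad u(\cdot,0)=u_0\ \text{ on }\mathbb{R}^N. \quad ( * )$$ (a) There is at most one distributional solution $u$ of $( * )$ in $\mathscr{UC}:=\{u\in L^1(Q_T)\cap L^\infty(Q_T):\varphi(u)\in X\}$. (b) There is at most one distributional solution $u$ of $( * )$ such that $u\in\mathscr{EC}:=\{u\in L^1(Q_T)\cap L^\infty(Q_T):\varphi(u)\in L^2(0,T;E_\mu(\mathbb{R}^N))\}$ and $\varphi(u)\in L^2(Q_T)$. (c) If in addition $\sup_{|s|<R}\frac{|\varphi(s)-\varphi(0)|}{|s|^\beta}<\infty$ for all $R>0$, for some $\beta\in[\tfrac12,1]$, then there is at most one distributional solution $u$ of $( * )$ such that $u\in\mathscr{EC}$.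
   Context: $T>0$, $Q_T:=\mathbb{R}^N\times(0,T)$; $\mu$ even means $\mu(B)=\mu(-B)$ for all Borel $B$. The operator is $\mathcal{L}^\mu[\phi](x)=\int_{\mathbb{R}^N\setminus\{0\}}\big(\phi(x+z)-\phi(x)-z\cdot D\phi(x)\mathbf{1}_{|z|\le1}\big)\mu(\mathrm{d}z)$. Uniqueness is up to a.e. equality. Set $|f|_{E_\mu}^2:=\frac12\int_{\mathbb{R}^N}\int_{|z|>0}|f(x+z)-f(x)|^2\,\mu(\mathrm{d}z)\mathrm{d}x$, $|f|_{T,E_\mu}^2:=\int_0^T|f(\cdot,t)|_{E_\mu}^2\mathrm{d}t$, and $L^2(0,T;E_\mu(\mathbb{R}^N)):=\{f:Q_T\to\mathbb{R}\text{ measurable}:|f|_{T,E_\mu}<\infty\}$. Distributional solution: $u\in L^1_{\mathrm{loc}}(Q_T)$ such that, for all $\psi\in C_c^\infty(\mathbb{R}^N\times[0,T))$, $\iint_{Q_T}\big(u\,\partial_t\psi+\varphi(u)\mathcal{L}^\mu[\psi]\big)\mathrm{d}x\mathrm{d}t+\int_{\mathbb{R}^N}u_0(x)\psi(x,0)\,\mathrm{d}x=0$. The space $X$ is the set of all $f\in L^\infty(Q_T)\cap L^2(0,T;E_\mu(\mathbb{R}^N))$ for which there is a sequence $\{\psi_n\}\subset C_c^\infty(\mathbb{R}^N\times[0,T))$ with $|\psi_n-f|_{T,E_\mu}\to0$ and $\iint_{Q_T}\psi_n\phi\,\mathrm{d}x\mathrm{d}t\to\iint_{Q_T}f\phi\,\mathrm{d}x\mathrm{d}t$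 for all $\phi\in L^1(Q_T)$ as $n\to\infty$. *)

(* Defs.v *)
From HB Require Import structures.
From mathcomp Require Import all_boot all_order all_algebra.
From mathcomp Require Import all_classical all_reals all_analysis.
From mathcomp Require Import measurable_realfun.

Set Implicit Arguments.
Unset Strict Implicit.
Unset Printing Implicit Defensive.

Import Order.TTheory GRing.Theory Num.Theory.
Import numFieldNormedType.Exports.

Local Open Scope classical_set_scope.
Local Open Scope ring_scope.

Definition rV_display : measure_display.
Proof. exact: default_measure_display. Qed.

Section borel_rV.
Variables (R : realType) (n : nat).

Definition measurable_rV : set (set 'rV[R]_n) := <<s open >>.

Let rV0 : measurable_rV set0.
Proof. exact: sigma_algebra0. Qed.

Let rVC A : measurable_rV A -> measurable_rV (~` A).
Proof. exact: sigma_algebraC. Qed.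

Let rV_bigcup (F : (set 'rV[R]_n)^nat) : (forall i, measurable_rV (F i)) ->
  measurable_rV (\bigcup_i (F i)).
Proof. exact: sigma_algebra_bigcup. Qed.

HB.instance Definition _ := @isMeasurable.Build rV_display 'rV[R]_n
  measurable_rV rV0 rVC rV_bigcup.

Lemma measurable_coord (i : 'I_n) :
  measurable_fun [set: 'rV[R]_n] (fun v => v ord0 i).
Proof.
apply: (measurability _ (RGenOpens.measurableE R)) => _ [_ [a [b ->]] <-].
rewrite setTI; apply: sub_sigma_algebra.
have /continuousP := @coord_continuous R 1 n ord0 i; apply.
exact: interval_open.
Qed.

Let box (c : 'rV[rat]_n * rat) : set 'rV[R]_n :=
  [set v | forall i, `|v ord0 i - ratr (c.1 ord0 i)| < ratr c.2].

Let open_rV_bigcup (U : set 'rV[R]_n) : open U ->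
  U = \bigcup_c (if `[< box c `<=` U >] then box c else set0).
Proof.
move=> oU; rewrite eqEsubset; split => [x Ux|x [c _]]; last first.
  by case: asboolP => // cU; exact: cU.
have /nbhs_ballP[e /= e0 eU] : nbhs x U by exact: open_nbhs_nbhs.
have e20 : 0 < e / 2 :> R by rewrite divr_gt0.
have [r] := rat_in_itvoo e20; rewrite in_itv /= => /andP[r0 re].
have /choice[q qP] (i : 'I_n) : exists q : rat, `|x ord0 i - ratr q| < ratr r.
  have /rat_in_itvoo[q] : x ord0 i < x ord0 i + ratr r by rewrite ltrDl.
  rewrite in_itv/= => /andP[xq qx]; exists q.
  by rewrite ltr0_norm ?subr_lt0// opprB ltrBlDl.
exists (\row_i q i, r) => //=; case: asboolP => [_ i|[]]; first by rewrite mxE.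
move=> y yq; apply: eU; split; first by [].
move=> i j; rewrite ord1 /ball /= (splitr e).
rewrite -(subrK (ratr (q j)) (x ord0 j)) -addrA (le_lt_trans (ler_normD _ _))//.
rewrite ltrD// (lt_trans _ re)// ?qP// distrC.
by have := yq j; rewrite /= mxE.
Qed.

Lemma measurable_fun_rV d (T : measurableType d) (f : T -> 'rV[R]_n) :
  (forall i, measurable_fun [set: T] (fun t => f t ord0 i)) ->
  measurable_fun [set: T] f.
Proof.
move=> mf; apply: (@measurability _ _ _ 'rV[R]_n setT f open) => // _ [U oU <-].
rewrite setTI (open_rV_bigcup oU) preimage_bigcup.
apply: countable_bigcupT_measurable => // c; case: ifP => _; last by rewrite preimage_set0.
rewrite (_ : _ @^-1` _ = \bigcap_(i in [set: 'I_n])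
    [set t | `|f t ord0 i - ratr (c.1 ord0 i)| < ratr c.2]); last first.
  by apply/seteqP; split => [t ft i _|t ft i]; exact: ft.
apply: fin_bigcap_measurable => // i _; rewrite -[X in measurable X]setTI.
apply: measurable_fun_ltr => //=.
by apply: measurableT_comp => //; exact: measurable_funB.
Qed.

End borel_rV.

Section lebesgue_rV.
Variable R : realType.

Definition rV_rcons n (p : 'rV[R]_n * measurableTypeR R) : 'rV[R]_n.+1 :=
  \row_i oapp (p.1 ord0) p.2 (unlift ord_max i).

Lemma measurable_rV_rcons n : measurable_fun setT (@rV_rcons n).
Proof.
apply: measurable_fun_rV => i.
rewrite (_ : (fun _ => _) = fun p : 'rV[R]_n * measurableTypeR R =>
    oapp (p.1 ord0) p.2 (unlift ord_max i)).
  case: (unlift ord_max i) => [j|] /=; last exact: measurable_snd.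
  exact: measurableT_comp (measurable_coord j) measurable_fst.
by apply/funext => p; rewrite mxE.
Qed.

Definition rV_prod n (m : {measure set 'rV[R]_n -> \bar R}) :
    set 'rV[R]_n.+1 -> \bar R :=
  pushforward (m \x lebesgue_measure)%E (@rV_rcons n).

Section rV_prod_measure.
Variables (n : nat) (m : {measure set 'rV[R]_n -> \bar R}).

Let preimage_rV_rcons A : measurable A -> measurable (@rV_rcons n @^-1` A).
Proof. by move=> mA; rewrite -[_ @^-1` _]setTI; exact: measurable_rV_rcons. Qed.

Let rV_prod0 : rV_prod m set0 = 0%E.
Proof. by rewrite /rV_prod /pushforward preimage_set0 measure0. Qed.

Let rV_prod_ge0 A : (0 <= rV_prod m A)%E.
Proof. by rewrite /rV_prod /pushforward measure_ge0. Qed.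

Let rV_prod_sigma_additive : semi_sigma_additive (rV_prod m).
Proof.
move=> F mF tF mUF; rewrite /rV_prod /pushforward preimage_bigcup.
apply: measure_semi_sigma_additive.
- by move=> i; exact: preimage_rV_rcons.
- apply/trivIsetP => /= i j _ _ ij; rewrite -preimage_setI.
  by move/trivIsetP : tF => /(_ _ _ _ _ ij) ->//; rewrite preimage_set0.
- by rewrite -preimage_bigcup; exact: preimage_rV_rcons.
Qed.

HB.instance Definition _ := isMeasure.Build _ _ _ (rV_prod m)
  rV_prod0 rV_prod_ge0 rV_prod_sigma_additive.

Lemma rV_prodE A B : measurable A -> measurable B ->
  rV_prod m [set v | A (\row_i v ord0 (lift ord_max i)) /\ B (v ord0 ord_max)] =
  (m A * lebesgue_measure B)%E.
Proof.
move=> mA mB; rewrite -product_measure1E// /rV_prod /pushforward.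
congr (product_measure1 _ _ _); apply/funext => -[v x] /=.
rewrite /rV_rcons mxE unlift_none /=; congr (A _ /\ _).
by apply/rowP => i; rewrite !mxE liftK.
Qed.

End rV_prod_measure.

Fixpoint lebesgue_rV n : {measure set 'rV[R]_n -> \bar R} :=
  match n with
  | 0 => \d_ (0 : 'rV[R]_0)
  | m.+1 => rV_prod (lebesgue_rV m)
  end.

Lemma lebesgue_rV_box n (a b : 'rV[R]_n) : (forall i, a ord0 i <= b ord0 i) ->
  lebesgue_rV n [set v | forall i, v ord0 i \in `]a ord0 i, b ord0 i]] =
  (\prod_i (b ord0 i - a ord0 i))%:E.
Proof.
elim: n => [|n IH] in a b * => ab.
  by rewrite big_ord0 /= diracE mem_set// => -[].
have lift_widen (i : 'I_n) : lift ord_max i = widen_ord (leqnSn n) i.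
  by apply/val_inj; rewrite /= /bump leqNgt ltn_ord.
pose a' : 'rV[R]_n := \row_i a ord0 (lift ord_max i).
pose b' : 'rV[R]_n := \row_i b ord0 (lift ord_max i).
pose A := [set v : 'rV[R]_n | forall i, v ord0 i \in `]a' ord0 i, b' ord0 i]].
pose B : set (measurableTypeR R) := `]a ord0 ord_max, b ord0 ord_max]%classic.
rewrite (_ : mkset _ =
    [set v | A (\row_i v ord0 (lift ord_max i)) /\ B (v ord0 ord_max)]).
  rewrite /= rV_prodE.
  - rewrite IH => [|i]; last by rewrite !mxE.
    rewrite lebesgue_measure_itv /= lte_fin big_ord_recr/= EFinM; congr (_ * _)%E.
      by congr EFin; apply: eq_bigr => i _; rewrite !mxE lift_widen.
    case: ifPn => //; rewrite -leNgt => ba; congr EFin.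
    by apply/esym/eqP; rewrite subr_eq0 eq_le ba ab.
  - rewrite (_ : A = \bigcap_(i in [set: 'I_n])
        ((fun v : 'rV[R]_n => v ord0 i) @^-1` `]a' ord0 i, b' ord0 i])).
      apply: fin_bigcap_measurable => // i _; rewrite -[X in measurable X]setTI.
      exact: measurable_coord.
    by apply/seteqP; split => [v Av i _|v Av i]; exact: Av.
  - exact: measurable_itv.
apply/seteqP; split => [v vab|v [vA vB] i]; last first.
  by have [j ->|->//] := unliftP ord_max i; have := vA j; rewrite !mxE.
by split => [i|]; [rewrite !mxE; exact: vab | exact: vab].
Qed.

End lebesgue_rV.

Section smooth_functions.
Variables (R : realType) (V : normedModType R).

Fixpoint Ck (k : nat) (f : V -> R) : Prop :=
  match k with
  | 0 => continuous f
  | k'.+1 => [/\ continuous f, forall v x, derivable f x v &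
                 forall v, Ck k' ('D_v f)]
  end.

Definition smooth (f : V -> R) := forall k, Ck k f.

Definition compact_support_in (A : set V) (f : V -> R) :=
  compact (closure [set x | f x != 0]) /\ closure [set x | f x != 0] `<=` A.

End smooth_functions.

Section nonlocal_operator.
Variables (R : realType) (N : nat).
Local Notation RN := 'rV[R]_N.

(* The library's norm on 'rV[R]_N is the sup norm. *)
Definition enorm (z : RN) : R := Num.sqrt (\sum_i z ord0 i ^+ 2).

Definition grad (f : RN -> R) (x : RN) : RN := \row_i 'D_(delta_mx ord0 i) f x.

Definition dotp (y z : RN) : R := \sum_i y ord0 i * z ord0 i.

(* A measure on R^N \ {0} is encoded as its extension by zero to R^N. *)
Definition radon_punctured (mu : {measure set RN -> \bar R}) :=
  [/\ mu [set 0] = 0%E,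
      forall K : set RN, compact K -> ~ K 0 -> (mu K < +oo)%E &
      forall B : set RN, measurable B -> ~ B 0 ->
        mu B = ereal_sup [set mu K | K in [set K | compact K /\ K `<=` B]]].

Definition even_measure (mu : {measure set RN -> \bar R}) :=
  forall B : set RN, measurable B -> mu B = mu [set - z | z in B].

Definition levy_condition (mu : {measure set RN -> \bar R}) :=
  (\int[mu]_(z in [set z | (enorm z <= 1)%R]) (enorm z ^+ 2)%:E +
   \int[mu]_(z in [set z | (1 < enorm z)%R]) 1 < +oo)%E.

Definition levy_op (mu : {measure set RN -> \bar R}) (f : RN -> R) (x : RN) :=
  \int[mu]_(z in [set z | z != 0])
    (f (x + z) - f x - dotp z (grad f x) * \1_[set z | enorm z <= 1] z).

End nonlocal_operator.

Section spacetime.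
Variables (R : realType) (N : nat).
Local Notation RN := 'rV[R]_N.

Definition QT (T : R) : set (RN * R) := [set p | 0 < p.2 < T].

Lemma measurable_QT T : measurable (QT T : set (RN * measurableTypeR R)).
Proof.
rewrite (_ : QT T = setT `*` `]0, T[%classic).
  by apply: measurableX => //; exact: measurable_itv.
by apply/seteqP; split => [p|p [_]]; rewrite /QT /= in_itv.
Qed.

Definition lebesgue_QT (T : R) :=
  mrestr (lebesgue_rV R N \x lebesgue_measure)%E (measurable_QT T).

HB.instance Definition _ T := Measure.on (lebesgue_QT T).

(* Elements of C_c^oo(R^N x [0, T)) are represented by smooth extensions to
   R^N x R; only their values for t >= 0 matter. *)
Definition test_function (T : R) (psi : RN * R -> R) :=
  smooth psi /\ compact_support_in [set p | p.2 < T] psi.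

Definition L1loc (T : R) (f : RN * R -> R) :=
  measurable_fun (QT T) f /\
  forall K : set (RN * R), compact K -> K `<=` QT T ->
    (lebesgue_QT T).-integrable K (EFin \o f).

Variable mu : {measure set RN -> \bar R}.

Definition seminormE_sqr (f : RN -> R) : \bar R :=
  ((2^-1)%:E * \int[lebesgue_rV R N]_x \int[mu]_(z in [set z | (0 < enorm z)%R])
    (`|f (x + z) - f x| ^+ 2)%:E)%E.

Definition seminormTE (T : R) (f : RN * R -> R) : \bar R :=
  sqrte (\int[lebesgue_measure]_(t in `]0%R, T[)
    seminormE_sqr (fun x => f (x, t)))%E.

Definition L2E (T : R) (f : RN * R -> R) :=
  measurable_fun (QT T) f /\ (seminormTE T f < +oo)%E.

Definition spaceX (T : R) (f : RN * R -> R) :=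
  [/\ f \in Lfun (lebesgue_QT T) +oo%E, L2E T f &
   exists psi : (RN * R -> R)^nat, [/\ forall n, test_function T (psi n),
     seminormTE T (psi n \- f) @[n --> \oo] --> 0%E &
     forall phi, phi \in Lfun (lebesgue_QT T) 1%E ->
       \int[lebesgue_QT T]_p (psi n p * phi p) @[n --> \oo] -->
       \int[lebesgue_QT T]_p (f p * phi p)]].

(* The integrability clause says that the first integral is meaningful; it is
   automatic for bounded u. *)
Definition distributional_solution (T : R) (varphi : R -> R) (u0 : RN -> R)
    (u : RN * R -> R) :=
  L1loc T u /\ forall psi, test_function T psi ->
    let g p := u p * 'D_(0, 1) psi p +
               varphi (u p) * levy_op mu (fun x => psi (x, p.2)) p.1 in
    (lebesgue_QT T).-integrable setT (EFin \o g) /\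
    \int[lebesgue_QT T]_p g p + \int[lebesgue_rV R N]_x (u0 x * psi (x, 0)) = 0.

Definition class_UC (T : R) (varphi : R -> R) (u : RN * R -> R) :=
  [/\ u \in Lfun (lebesgue_QT T) 1%E, u \in Lfun (lebesgue_QT T) +oo%E &
      spaceX T (varphi \o u)].

Definition class_EC (T : R) (varphi : R -> R) (u : RN * R -> R) :=
  [/\ u \in Lfun (lebesgue_QT T) 1%E, u \in Lfun (lebesgue_QT T) +oo%E &
      L2E T (varphi \o u)].

Definition at_most_one_ae (T : R) (P : (RN * R -> R) -> Prop) :=
  forall u v, P u -> P v -> {ae lebesgue_QT T, forall p, u p = v p}.

End spacetime.

(* Main.v *)
(** Let u, v be two solutions, U = u - v and Phi = phi(u) - phi(v) on Q_T. Testing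
    both equations with the backward primitive psi(x,t) = int_0^T rho(x,t+s) ds and
    symmetrising the nonlocal term (mu is even) gives, for every test function rho,
      int U rho = -1/2 int W(t,x,z) (rho(x+z,t) - rho(x,t)) mu(dz) dx dt,
    where W is the primitive from time 0 of H = Phi(x+z,t) - Phi(x,t). If rho may be
    replaced by Phi itself, the right-hand side is -1/4 times the integral of the square
    of int_0^T H dt, so int U Phi <= 0; monotonicity gives U Phi >= 0, hence Phi = 0 a.e.,
    the right-hand side vanishes, and U = 0. In the class X the replacement is the
    definition of X; when Phi is in L^2 it is done by Lipschitz cutoffs in x and by
    mollification. The mollifiers are supported in small positive increments, so that
    functions carried by (0,T) are turned into test functions supported in t < T, and so
    that the indicators of half-open boxes converge pointwise. *)

Require Import Defs.
From HB Require Import structures.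
From mathcomp Require Import all_boot all_order all_algebra.
From mathcomp Require Import all_classical all_reals all_analysis.
From mathcomp Require Import measurable_realfun ring lra.
Set Implicit Arguments.
Unset Strict Implicit.
Unset Printing Implicit Defensive.
Import Order.TTheory GRing.Theory Num.Theory.
Import numFieldNormedType.Exports.
Local Open Scope classical_set_scope.
Local Open Scope ring_scope.

(** * Smooth functions *)

(** The horizon being finite, integration in time is bounded on square-integrable functions of
    (t,x,z), so W is one of them and the weak identity is continuous in the differences rho(x+z,t) -
    rho(x,t): convergence of approximations tested against one fixed W is enough. For mollifications
    such limits are proved on indicators and extended by density, by one argument that serves
    functions of (x,t) and of (t,x,z), where z is never shifted. The energy contains differences in
    x only, so extending Phi by zero outside (0,T) costs nothing and no regularity in time enters.
    Since mu may have infinite mass near 0, a first difference of a test function need not be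
    mu-integrable; evenness first produces a second difference, bounded by a multiple of min(|z|^2,
    1), and only then are the integrals exchanged. Cutting Phi off in x creates an error of size
    min(|z|, 1) |Phi(x,t)|, which is where Phi in L^2 is used. For (c), beta >= 1/2 gives |phi(s) -
    phi(0)|^2 <= C |s| on bounded sets, and phi(0) cancels in Phi, so that Phi is in L^2 again. *)

Section directional.
Variables (R : realType) (V : normedModType R).
Implicit Types (f g : V -> R) (x v w : V).

Lemma smooth_continuous f : smooth f -> continuous f.
Proof. by move=> /(_ 0%N). Qed.

Lemma smooth_derivable f x v : smooth f -> derivable f x v.
Proof. by move=> /(_ 1%N)[]. Qed.

Lemma smooth_derive f v : smooth f -> smooth ('D_v f).
Proof. by move=> fs k; have [_ _] := fs k.+1; apply. Qed.

Lemma is_derive_line f x v (t : R) : derivable f (x + t *: v) v ->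
  is_derive t 1 (fun s => f (x + s *: v)) ('D_v f (x + t *: v)).
Proof.
move=> df.
have E : (fun h : R => h^-1 *: (((fun s => f (x + s *: v)) \o shift t) (h *: (1 : R)) -
    f (x + t *: v))) = (fun h => h^-1 *: ((f \o shift (x + t *: v)) (h *: v) - f (x + t *: v))).
  apply/funext => h /=; congr (_ *: (f _ - _)).
  by rewrite [_ *: (1 : R)]mulr1 scalerDl addrCA.
by split; rewrite /derivable /derive E.
Qed.

Lemma derive_MVT f x v : (forall y, derivable f y v) ->
  exists2 t : R, 0 <= t <= 1 & f (x + v) - f x = 'D_v f (x + t *: v).
Proof.
move=> df.
have dl (t : R) := is_derive_line (df (x + t *: v)).
have [|c /andP[c0 c1]] := @MVT_segment R (fun s => f (x + s *: v))
    (fun s => 'D_v f (x + s *: v)) 0 1 ler01 (fun t _ => dl t).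
  apply: derivable_within_continuous => t _; by have [] := dl t.
rewrite scale1r scale0r addr0 subr0 mulr1 => ->.
by exists c => //; apply/andP; split; move: c0 c1; rewrite !bnd_simp.
Qed.

Lemma derive_lineE f x v : 'D_v f x = 'D_1 (fun s : R => f (x + s *: v)) 0.
Proof.
rewrite /derive; set F := (X in lim (X @ _)); set G := (X in _ = lim (X @ _)).
suff -> : F = G by [].
by apply/funext => h; rewrite /F /G /= addr0 [_ *: (1 : R)]mulr1 scale0r addr0 (addrC x).
Qed.

Lemma deriveZdir f x v (h : R) : derivable f x v -> 'D_(h *: v) f x = h * 'D_v f x.
Proof.
move=> df; have := @is_derive_line f x v 0; rewrite scale0r addr0 => /(_ df) H.
rewrite derive_lineE.
have -> : (fun s => f (x + s *: (h *: v))) = (fun s => f (x + s *: v)) \o (h \*: id).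
  by apply/funext => s /=; rewrite scalerA mulrC.
have Hi : is_derive (0:R) 1 (h \*: id : R -> R) (h *: 1) by exact: is_deriveZ.
have H' : is_derive ((h \*: id : R -> R) 0) 1 (fun s : R => f (x + s *: v)) ('D_v f x).
  by rewrite /= scaler0.
have := @is_derive1_comp R (fun s => f (x + s *: v)) (h \*: id) 0 _ _ H' Hi.
by move=> [_ ->]; rewrite [h *: 1]mulr1 mulrC.
Qed.

(** [Ck] speaks of one direction at a time, so additivity in the direction has to be proved. The
    increment along [v + w] is split at [x + h *: v]; by the mean value theorem its second half is
    [h] times the derivative along [w] at a point that tends to [x], where continuity of ['D_w f]
    applies. *)
Lemma deriveDdir f x v w : (forall y, derivable f y v) -> (forall y, derivable f y w) ->
  {for x, continuous ('D_w f)} -> 'D_(v + w) f x = 'D_v f x + 'D_w f x.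
Proof.
move=> dv dw cw; apply/cvg_lim => //.
have -> : (fun h : R => h^-1 *: ((f \o shift x) (h *: (v + w)) - f x)) =
    (fun h => h^-1 *: ((f \o shift x) (h *: v) - f x)) \+
    (fun h => h^-1 *: (f (x + h *: v + h *: w) - f (x + h *: v))).
  apply/funext => h /=; rewrite -scalerDr; congr (_ *: _).
  have -> : h *: (v + w) + x = x + h *: v + h *: w by rewrite scalerDr addrC addrA.
  by rewrite (addrC (h *: v) x); ring.
apply: cvgD; first exact: dv.
apply/cvgrPdist_lt => e e0.
move/cvgrPdist_lt : cw => /(_ _ e0) /nbhs_ballP[d /= d0 dw'].
near=> h.
have h0 : h != 0 by near: h; exact: nbhs_dnbhs_neq.
have dhw y : derivable f y (h *: w).
  have := @is_derive_line f y w 0; rewrite scale0r addr0 => /(_ (dw _)) H.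
  rewrite derivable1P.
  have -> : (fun s => f (s *: (h *: w) + y)) = (fun s => f (y + s *: w)) \o (h \*: id).
    by apply/funext => s /=; rewrite scalerA mulrC addrC.
  have Hi : is_derive (0:R) 1 (h \*: id : R -> R) (h *: 1) by exact: is_deriveZ.
  have H' : is_derive ((h \*: id : R -> R) 0) 1 (fun s : R => f (y + s *: w)) ('D_w f y).
    by rewrite /= scaler0.
  by have [] := @is_derive1_comp R (fun s => f (y + s *: w)) (h \*: id) 0 _ _ H' Hi.
have [t /andP[t0 t1] ->] := derive_MVT (x + h *: v) dhw.
rewrite deriveZdir; last exact: dw.
rewrite [_ *: _]mulrA mulVf // mul1r; apply: dw'.
rewrite -ball_normE /= -addrA opprD addNKr normrN.
apply: (@le_lt_trans _ _ (`|h| * (`|v| + `|w|))).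
  rewrite mulrDr; apply: (le_trans (ler_normD _ _)).
  rewrite lerD ?normrZ// (ger0_norm t0) ler_piMl// mulr_ge0//.
(* Adding 1 keeps the divisor positive even when [v] and [w] vanish. *)
have vw : 0 < `|v| + `|w| + 1 by rewrite ltr_wpDl// addr_ge0.
apply: (@le_lt_trans _ _ (`|h| * (`|v| + `|w| + 1))); first by rewrite ler_wpM2l// lerDl.
rewrite -ltr_pdivlMr//; near: h; apply: dnbhs0_lt; exact: divr_gt0.
Unshelve. all: by end_near. Qed.

End directional.

Section Ck_closure.
Variables (R : realType) (V : normedModType R).
Implicit Types (f g : V -> R) (k : nat).

Lemma CkS k f : Ck k.+1 f -> Ck k f.
Proof.
elim: k f => [|k IH] f [cf df Df]//; split=> // v.
exact: IH (Df v).
Qed.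

Lemma Ck_cst k (c : R) : Ck k (cst c : V -> R).
Proof.
elim: k c => [|k IH] c /=; first by move=> x; exact: cst_continuous.
split=> [x||v]; [exact: cst_continuous | by move=> *; exact: derivable_cst |].
rewrite (_ : 'D_v _ = cst 0); first exact: IH.
by apply/funext => x; rewrite derive_cst.
Qed.

Lemma CkD k f g : Ck k f -> Ck k g -> Ck k (f \+ g).
Proof.
elim: k f g => [|k IH] f g /=.
  by move=> cf cg x; apply: continuousD; [exact: cf|exact: cg].
move=> [cf df Df] [cg dg Dg]; split=> [x|v x|v].
- by apply: continuousD; [exact: cf|exact: cg].
- exact: derivableD.
- rewrite (_ : 'D_v _ = 'D_v f \+ 'D_v g); first exact: IH.
  by apply/funext => x; rewrite deriveD.
Qed.

Lemma CkM k f g : Ck k f -> Ck k g -> Ck k (f \* g).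
Proof.
elim: k f g => [|k IH] f g /=.
  by move=> cf cg x; apply: continuousM; [exact: cf|exact: cg].
move=> /[dup] /CkS Cf [cf df Df] /[dup] /CkS Cg [cg dg Dg]; split=> [x|v x|v].
- by apply: continuousM; [exact: cf|exact: cg].
- exact: derivableM.
- rewrite (_ : 'D_v _ = (f \* 'D_v g) \+ (g \* 'D_v f)); last first.
    by apply/funext => x; rewrite deriveM.
  by apply: CkD; exact: IH.
Qed.

Lemma smoothM f g : smooth f -> smooth g -> smooth (f \* g).
Proof. by move=> sf sg k; exact: CkM. Qed.

Lemma smooth_cst (c : R) : smooth (cst c : V -> R).
Proof. by move=> k; exact: Ck_cst. Qed.

Lemma smooth_prod (I : Type) (s : seq I) (F : I -> V -> R) :
  (forall i, smooth (F i)) -> smooth (fun x => \prod_(i <- s) F i x).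
Proof.
move=> sF; elim: s => [|i s IH].
  rewrite (_ : (fun _ => _) = cst 1); first exact: smooth_cst.
  by apply/funext => x; rewrite big_nil.
rewrite (_ : (fun _ => _) = F i \* (fun x => \prod_(i <- s) F i x)); first exact: smoothM.
by apply/funext => x; rewrite big_cons.
Qed.

(** [A] is affine with linear part [L]: the difference quotients of [f \o A] along [v] are literally
    those of [f] along [L v], so [Ck] passes to the composite by induction, without a chain rule. *)
Lemma smooth_affine (V' : normedModType R) (A : V' -> V) (L : V' -> V) f :
  continuous A -> (forall p v (h : R), A (h *: v + p) = h *: L v + A p) ->
  smooth f -> smooth (f \o A).
Proof.
move=> cA AL sf k; elim: k f {sf}(sf k) => [|k IH] f /=.
  by move=> cf x; apply: continuous_comp; [exact: cA|exact: cf].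
move=> [cf df Df].
have E v p : (fun h : R => h^-1 *: (((f \o A) \o shift p) (h *: v) - (f \o A) p)) =
    (fun h => h^-1 *: ((f \o shift (A p)) (h *: L v) - f (A p))).
  by apply/funext => h /=; rewrite AL.
split=> [x|v x|v].
- by apply: continuous_comp; [exact: cA|exact: cf].
- by rewrite /derivable E; exact: df.
- rewrite (_ : 'D_v _ = 'D_(L v) f \o A); first exact: IH.
  by apply/funext => x; rewrite /derive E.
Qed.

Lemma deriveSum (I : Type) (s : seq I) (c : I -> R) (v : I -> V) f x : smooth f ->
  'D_(\sum_(i <- s) c i *: v i) f x = \sum_(i <- s) c i * 'D_(v i) f x.
Proof.
move=> sf; elim: s => [|i s IH]; first by rewrite !big_nil derive0.
rewrite !big_cons deriveDdir ?IH ?deriveZdir//.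
- exact: smooth_derivable.
- by move=> y; exact: smooth_derivable.
- by move=> y; exact: smooth_derivable.
- by apply: smooth_continuous; exact: smooth_derive.
Qed.

Definition smooth_cc f := smooth f /\ compact (closure [set x | f x != 0]).

Lemma derive_supp f v : [set x | 'D_v f x != 0] `<=` closure [set x | f x != 0].
Proof.
move=> x; apply: contraPP => xf; apply/negP; rewrite negbK; apply/eqP.
have nx : \forall y \near x, f y = 0.
  have : nbhs x (~` closure [set x | f x != 0]).
    by apply: open_nbhs_nbhs; split => //; exact/closed_openC/closed_closure.
  apply: filterS => y fy; apply/eqP; apply: contraPT fy => fy; apply.
  exact: subset_closure.
have [->|v0] := eqVneq v 0; first by rewrite derive0.
have -> : 'D_v f x = 'D_v (cst (0 : R) : V -> R) x by apply: near_eq_derive.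
by rewrite derive_cst.
Qed.

Lemma smooth_cc_derive f v : smooth_cc f -> smooth_cc ('D_v f).
Proof.
move=> [sf kf]; split; first exact: smooth_derive.
apply: subclosed_compact kf _; first exact: closed_closure.
have -> : closure [set x | f x != 0] = closure (closure [set x | f x != 0]).
  by apply/closure_id; exact: closed_closure.
by apply: closureS; exact: derive_supp.
Qed.

Lemma smooth_cc_bounded f : smooth_cc f -> exists2 C : R, 0 <= C & forall x, `|f x| <= C.
Proof.
move=> [sf kf].
have /compact_bounded[M [_ /(_ (`|M| + 1))]] :
    compact (f @` closure [set x | f x != 0]).
  apply: continuous_compact => //; apply: continuous_subspaceT; exact: smooth_continuous.
rewrite (le_lt_trans (ler_norm _))// ?ltrDl// => /(_ isT) HM.
exists (`|M| + 1); first by rewrite addr_ge0.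
move=> x; have [->|fx0] := eqVneq (f x) 0; first by rewrite normr0 addr_ge0.
by apply: HM; exists x => //; exact: subset_closure.
Qed.
End Ck_closure.

Section spacetime_calculus.
Variables (R : realType) (N : nat).
Local Notation RN := 'rV[R]_N.
Local Notation V := (RN * R)%type.
Implicit Types (f : V -> R) (p q : V).

Definition sdir (z : RN) : V := (z, 0).
Definition ei (i : 'I_N) : RN := delta_mx ord0 i.
Definition tdir : V := (0, 1).

Lemma rV_coord_le (z : RN) i : `|z ord0 i| <= `|z|.
Proof.
rewrite [leRHS]/Num.Def.normr /= mx_normrE.
exact: (le_bigmax _ (fun ij : 'I_1 * 'I_N => `|z ij.1 ij.2|) (ord0, i)).
Qed.

Lemma sdir_decomp z : sdir z = \sum_i z ord0 i *: sdir (ei i).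
Proof.
rewrite /sdir {1}(row_sum_delta z).
have H (s : seq 'I_N) : \sum_(i <- s) z ord0 i *: ((delta_mx ord0 i : RN), 0 : R) =
    (\sum_(i <- s) z ord0 i *: (delta_mx ord0 i : RN), 0).
  elim: s => [|i s IH]; first by rewrite !big_nil.
  by rewrite !big_cons IH; congr pair; rewrite /= scaler0 addr0.
by rewrite H.
Qed.

Lemma sdirZ (h : R) z : sdir (h *: z) = h *: sdir z.
Proof. by congr pair; rewrite scaler0. Qed.

Lemma derive_sdir f z p : smooth f ->
  'D_(sdir z) f p = \sum_i z ord0 i * 'D_(sdir (ei i)) f p.
Proof. by move=> sf; rewrite sdir_decomp deriveSum. Qed.

(** The direction is expanded in the [N] spatial basis directions and [tdir]; each of these finitely
    many derivatives is again smooth with compact support, hence bounded. *)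
Lemma smooth_cc_derive_bound f : smooth_cc f ->
  exists2 C : R, 0 <= C & forall p q, `|'D_q f p| <= C * `|q|.
Proof.
move=> cf; have [sf _] := cf.
have /choice[B HB] i : exists C : R, 0 <= C /\ forall p, `|'D_(sdir (ei i)) f p| <= C.
  by have [C C0 HC] := smooth_cc_bounded (smooth_cc_derive (sdir (ei i)) cf); exists C.
have [Ct Ct0 HCt] := smooth_cc_bounded (smooth_cc_derive tdir cf).
have S0 : 0 <= \sum_i B i by apply: sumr_ge0 => i _; have [] := HB i.
exists (\sum_i B i + Ct) => [|p q]; first by rewrite addr_ge0.
have -> : q = sdir q.1 + q.2 *: tdir.
  by case: q => z t; rewrite /sdir /tdir; congr pair; rewrite /= ?scaler0 ?addr0// add0r [_ *: _]mulr1.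
have nq : sdir q.1 + q.2 *: tdir = q.
  by case: q => z t; rewrite /sdir /tdir; congr pair; rewrite /= ?scaler0 ?addr0// add0r [_ *: _]mulr1.
rewrite {2}nq deriveDdir//; first last.
- by apply: smooth_continuous; exact: smooth_derive.
- by move=> y; exact: smooth_derivable.
- by move=> y; exact: smooth_derivable.
have q1 : `|q.1| <= `|q| by rewrite [leRHS]prod_normE le_max lexx.
have q2 : `|q.2| <= `|q| by rewrite [leRHS]prod_normE le_max lexx orbT.
rewrite (le_trans (ler_normD _ _))// mulrDl lerD//.
  rewrite derive_sdir// (le_trans (ler_norm_sum _ _ _))// mulr_suml ler_sum// => i _.
  rewrite normrM mulrC ler_pM//; first by have [_ ->] := HB i.
  by rewrite (le_trans _ q1)// rV_coord_le.
rewrite deriveZdir; last exact: smooth_derivable.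
by rewrite normrM mulrC ler_pM.
Qed.

Lemma smooth_cc_lipschitz f : smooth_cc f ->
  exists2 C : R, 0 <= C & forall p q, `|f (p + q) - f p| <= C * `|q|.
Proof.
move=> cf; have [C C0 HC] := smooth_cc_derive_bound cf; exists C => // p q.
have [|t _ ->] := @derive_MVT _ _ f p q; last exact: HC.
by move=> y; apply: smooth_derivable; case: cf.
Qed.

End spacetime_calculus.

(** * Averages of a smooth function over a family of shifts *)

Section averaging.
Variables (R : realType) (N : nat).
Local Notation V := ('rV[R]_N * R)%type.
Variables (d : measure_display) (Om : measurableType d).
Variables (nu : {measure set Om -> \bar R}) (th : Om -> V) (g : Om -> R).
Hypothesis ig : nu.-integrable setT (EFin \o g).
Hypothesis mth : forall f : V -> R, continuous f ->
  forall p, measurable_fun setT (fun w => f (p + th w)).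
Implicit Types (f : V -> R) (p q : V).

(** Two constructions are instances: the backward primitive in time (shifts along [tdir], weighted
    by the indicator of (0,T)) and convolution ([f] the kernel, [th] minus the identity, [g] the
    function to be smoothed). In both, smoothness comes from [f] and only integrability is asked of
    [g]. *)
Definition average f p := \int[nu]_w (f (p + th w) * g w).

Lemma integrable_mulg (h : Om -> R) (C : R) : measurable_fun setT h ->
  (forall w, `|h w| <= C) -> nu.-integrable setT (fun w => (h w * g w)%:E).
Proof.
move=> mh hC; have mg : measurable_fun setT g by exact/measurable_EFinP/(measurable_int _ ig).
have := integrableZl measurableT C (integrable_abse ig).
apply: le_integrable => //; first by apply/measurable_EFinP; exact: measurable_funM.
move=> w _; rewrite /= !lee_fin !normrM normr_id ler_wpM2r//.
by rewrite (le_trans (hC w))// ler_norm.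
Qed.

Lemma Rintegral_mulg_le (h : Om -> R) (C : R) : measurable_fun setT h ->
  (forall w, `|h w| <= C) -> `|\int[nu]_w (h w * g w)| <= C * \int[nu]_w `|g w|.
Proof.
move=> mh hC; have ihg := integrable_mulg mh hC.
rewrite (le_trans (le_normr_Rintegral _ ihg))//.
have ia : nu.-integrable setT (EFin \o (fun w => `|g w|)) := integrable_abse ig.
rewrite -RintegralZl//; apply: le_Rintegral => //.
- exact: (integrable_abse ihg).
- exact: (integrableZl measurableT C ia).
- by move=> w _; rewrite normrM ler_wpM2r.
Qed.

Lemma measurable_shifted f p : smooth_cc f -> measurable_fun setT (fun w => f (p + th w)).
Proof. by move=> cf; apply: mth; exact: smooth_continuous cf.1. Qed.

Lemma average_integrable f p : smooth_cc f ->
  nu.-integrable setT (fun w => (f (p + th w) * g w)%:E).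
Proof.
move=> cf; have [C _ HC] := smooth_cc_bounded cf.
apply: (@integrable_mulg _ C) => //; apply: mth; exact: smooth_continuous cf.1.
Qed.

Lemma average_continuous f : smooth_cc f -> continuous (average f).
Proof.
move=> cf p; have [C C0 HC] := smooth_cc_lipschitz cf.
pose I := \int[nu]_w `|g w|.
have I0 : 0 <= I by apply: Rintegral_ge0 => w _.
apply/cvgrPdist_le => e e0.
have CI : 0 < C * I + 1 by rewrite ltr_wpDl// mulr_ge0.
near=> q.
have -> : average f p - average f q = \int[nu]_w ((f (p + th w) - f (q + th w)) * g w).
  by rewrite /average -RintegralB//; first (by apply: eq_Rintegral => w _; rewrite mulrBl);
    exact: average_integrable.
apply: (@le_trans _ _ (C * `|p - q| * I)).
  apply: Rintegral_mulg_le.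
    by apply: measurable_funB; exact: measurable_shifted.
  by move=> w; rewrite (_ : p + th w = (q + th w) + (p - q)) ?HC// addrAC addrCA subrr addr0.
apply: (@le_trans _ _ ((C * I + 1) * `|p - q|)); first by rewrite mulrAC ler_wpM2r// lerDl.
rewrite mulrC -ler_pdivlMr//; near: q; apply: cvgr_dist_le => //; exact: divr_gt0.
Unshelve. all: by end_near. Qed.

(** ['D_v f] is Lipschitz, so the difference quotients of [f] converge to it uniformly, with an
    error of order [|h| |v|]; integrability of [g] then carries the limit through the integral. *)
Lemma average_derive_cvg f v p : smooth_cc f ->
  h^-1 *: ((average f \o shift p) (h *: v) - average f p) @[h --> (0:R)^'] -->
  average ('D_v f) p.
Proof.
move=> cf; have cDf := smooth_cc_derive v cf; have [C C0 HC] := smooth_cc_lipschitz cDf.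
pose I := \int[nu]_w `|g w|.
have I0 : 0 <= I by apply: Rintegral_ge0 => w _.
apply/cvgrPdist_le => e e0.
have CI : 0 < C * `|v| * I + 1 by rewrite ltr_wpDl// !mulr_ge0.
near=> h.
have h0 : h != 0 by near: h; exact: nbhs_dnbhs_neq.
have mD : measurable_fun setT (fun w => 'D_v f (p + th w) - h^-1 * (f (h *: v + p + th w) - f (p + th w))).
  apply: (measurable_funB (measurable_shifted p cDf)).
  by apply: measurable_funM => //; apply: measurable_funB; exact: measurable_shifted.
have -> : average ('D_v f) p - h^-1 *: ((average f \o shift p) (h *: v) - average f p) =
    \int[nu]_w (('D_v f (p + th w) - h^-1 * (f (h *: v + p + th w) - f (p + th w))) * g w).
  rewrite /average /= -RintegralB//; [|exact: average_integrable..].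
  rewrite [_ *: _]mulrC -RintegralZr//; last first.
    rewrite (_ : _ \o _ = (fun w => (f (h *: v + p + th w) * g w)%:E - (f (p + th w) * g w)%:E)%E)//.
    by apply: integrableB => //; exact: average_integrable.
  rewrite -RintegralB//; first by apply: eq_Rintegral => w _; ring.
    exact: (average_integrable p cDf).
  rewrite (_ : _ \o _ = (fun w => ((f (h *: v + p + th w) * g w)%:E - (f (p + th w) * g w)%:E) * h^-1%:E)%E)//.
  by apply: integrableZr => //; apply: integrableB => //; exact: average_integrable.
apply: (@le_trans _ _ (C * (`|h| * `|v|) * I)).
  apply: Rintegral_mulg_le => // w.
  have [|t /andP[t0 t1] E] := @derive_MVT _ _ f (p + th w) (h *: v).
    by move=> y; apply: smooth_derivable; case: cf.
  rewrite (_ : h *: v + p + th w = p + th w + h *: v); last by rewrite -addrA addrC.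
  rewrite E deriveZdir; last by apply: smooth_derivable; case: cf.
  rewrite mulrA mulVf// mul1r distrC (le_trans (HC _ _))// ler_wpM2l//.
  by rewrite normrZ (ger0_norm t0) normrZ ler_piMl// mulr_ge0.
apply: (@le_trans _ _ ((C * `|v| * I + 1) * `|h|)).
  by rewrite (_ : C * (`|h| * `|v|) * I = C * `|v| * I * `|h|); [rewrite ler_wpM2r// lerDl|ring].
rewrite mulrC -ler_pdivlMr//; near: h; apply: dnbhs0_le; exact: divr_gt0.
Unshelve. all: by end_near. Qed.

Lemma average_derive f v : smooth_cc f -> 'D_v (average f) = average ('D_v f).
Proof. by move=> cf; apply/funext => p; apply/cvg_lim => //; exact: average_derive_cvg. Qed.

Lemma smooth_average f : smooth_cc f -> smooth (average f).
Proof.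
move=> cf k; elim: k f cf => [|k IH] f cf /=; first exact: average_continuous.
split=> [|v p|v]; first exact: average_continuous.
- by apply/cvg_ex; exists (average ('D_v f) p); exact: average_derive_cvg.
- by rewrite average_derive//; apply: IH; exact: smooth_cc_derive.
Qed.

End averaging.

(** * A smooth bump function *)

Section bump.
Variable R : realType.
Implicit Types (x y : R) (k : nat).

(* The span of these functions is stable under differentiation, see [is_derive_flat]. *)
Definition flat k x : R := if 0 < x then x^-1 ^+ k * expR (- x^-1) else 0.

(** Raise [y / k <= expR (y / k)] to the power [k], for [k] positive. *)
Lemma expr_le_expR k : exists2 C : R, 0 <= C & forall y, 0 <= y -> y ^+ k <= C * expR y.
Proof.
case: k => [|k].
  by exists 1 => // y y0; rewrite expr0 mul1r -expR0 ler_expR.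
exists (k.+1%:R ^+ k.+1); first exact: exprn_ge0.
move=> y y0; have E : expR y = expR (y / k.+1%:R) ^+ k.+1.
  by rewrite -expRM_natl -mulr_natl mulrC divfK.
have k0 : 0 < k.+1%:R :> R by [].
rewrite E -exprMn; apply: lerXn2r; rewrite ?nnegrE ?mulr_ge0 ?expR_ge0//.
rewrite -ler_pdivrMl// mulrC (le_trans _ (expR_ge1Dx _))// lerDr//.
Qed.

(** The growth bound at [x^-1] is used with exponent [k + 2]: the two spare powers give the factor
    [x ^+ 2], which makes the derivative at 0 exist and vanish. *)
Lemma flat_le_sqr k : exists2 C : R, 0 <= C & forall x, `|flat k x| <= C * x ^+ 2.
Proof.
have [C C0 HC] := expr_le_expR k.+2; exists C => // x.
rewrite /flat; case: ifPn => [x0|_]; last by rewrite normr0 mulr_ge0// sqr_ge0.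
rewrite ger0_norm; last by rewrite mulr_ge0 ?expR_ge0// exprn_ge0// invr_ge0 ltW.
have := HC x^-1; rewrite invr_ge0 (ltW x0) => /(_ isT) H.
rewrite expRN ler_pdivrMr ?expR_gt0//.
have x2 : 0 < x ^+ 2 by rewrite exprn_gt0.
rewrite mulrAC -ler_pdivrMr//; apply: le_trans H.
by rewrite -exprVn -exprD addn2.
Qed.

Lemma is_derive_flat k x :
  is_derive x 1 (flat k) (flat k.+2 x - k%:R * flat k.+1 x).
Proof.
have [x0|x0|->] := ltgtP x 0.
- rewrite {2 3}/flat ltNge (ltW x0) /= mulr0 subr0.
  apply: (@near_eq_is_derive _ _ _ (cst 0)).
    near=> y; rewrite /flat ltNge ltW//=; near: y; exact: lt_nbhsl.
- rewrite {2 3}/flat x0.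
  apply: (@near_eq_is_derive _ _ _ (fun y => y^-1 ^+ k * expR (- y^-1))).
    near=> y; rewrite /flat ifT//; near: y; exact: lt_nbhsr.
  have xn0 : x != 0 by rewrite gt_eqF.
  have iV : is_derive x 1 (fun y : R => y^-1) (- x ^- 2 *: 1) by exact: is_deriveV.
  have iX := is_deriveX k iV.
  have iE : is_derive x 1 (fun y : R => expR (- y^-1)) (expR (- x^-1) * - (- x ^- 2 *: 1)).
    by apply: (@is_derive1_comp _ expR (fun y => - y^-1)); exact: is_deriveN.
  have -> : (fun y : R => y^-1 ^+ k * expR (- y^-1)) =
      ((fun y : R => y^-1) ^+ k) * (fun y : R => expR (- y^-1)).
    by apply/funext => y /=; rewrite mulrfctE exprfctE.
  apply: (is_derive_eq (is_deriveM iX iE)).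
  have sc (a b : R) : a *: b = a * b by [].
  rewrite exprfctE !sc mulr1 -exprVn; move: (expR (- x^-1)) (x^-1) => e y.
  by case: (k) => [|j] /=; rewrite ?mul0r !exprS; ring.
- have [C C0 HC] := flat_le_sqr k.
  rewrite {2 3}/flat ltxx mulr0 subr0.
  suff H : h^-1 *: ((flat k \o shift 0) (h *: (1:R)) - flat k 0) @[h --> (0:R)^'] --> (0 : R).
    by split; [apply/cvg_ex; exists 0|apply/cvg_lim].
  apply/cvgrPdist_le => e e0.
  have C1 : 0 < C + 1 by rewrite ltr_wpDl.
  near=> h; have h0 : h != 0 by near: h; exact: nbhs_dnbhs_neq.
  rewrite /= {2}/flat ltxx subr0 addr0 [h *: 1]mulr1 sub0r normrN normrM normfV.
  rewrite ler_pdivrMl ?normr_gt0// (le_trans (HC h))//.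
  rewrite -real_normK ?num_real// expr2 mulrCA ler_wpM2l//.
  apply: (@le_trans _ _ ((C + 1) * `|h|)); first by rewrite ler_wpM2r// lerDl.
  rewrite mulrC -ler_pdivlMr//; near: h; apply: dnbhs0_le; exact: divr_gt0.
Unshelve. all: by end_near. Qed.

Lemma Ck_flat n k : Ck n (flat k).
Proof.
have cf j : continuous (flat j).
  move=> x; apply: differentiable_continuous; apply/derivable1_diffP.
  by have [] := is_derive_flat j x.
elim: n k => [|n IH] k //=; split=> [|v x|v] //.
  apply: diff_derivable; apply/derivable1_diffP; by have [] := is_derive_flat k x.
rewrite (_ : 'D_v _ = cst v \* (flat k.+2 \+ (cst (- k%:R) \* flat k.+1))).
  by apply: CkM; [exact: Ck_cst|apply: CkD => //; apply: CkM => //; exact: Ck_cst].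
apply/funext => x /=; rewrite -[v in LHS]mulr1 -[v * 1]/(v *: 1) deriveZdir; last first.
  by have [] := is_derive_flat k x.
by have [_ ->] := is_derive_flat k x; rewrite mulNr.
Qed.

Lemma flat_gt0 k x : 0 < x -> 0 < flat k x.
Proof. by move=> x0; rewrite /flat x0 mulr_gt0 ?expR_gt0// exprn_gt0// invr_gt0. Qed.

Lemma flat_ge0 k x : 0 <= flat k x.
Proof. by rewrite /flat; case: ifPn => // x0; rewrite mulr_ge0 ?expR_ge0// exprn_ge0// invr_ge0 ltW. Qed.

Definition bump1 (a b x : R) := flat 0 (x - a) * flat 0 (b - x).

Lemma bump1_ge0 a b x : 0 <= bump1 a b x.
Proof. by rewrite mulr_ge0// flat_ge0. Qed.

Lemma bump1_gt0 a b x : a < x < b -> 0 < bump1 a b x.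
Proof. by move=> /andP[ax xb]; rewrite mulr_gt0// flat_gt0// subr_gt0. Qed.

Lemma bump1_neq0 a b x : bump1 a b x != 0 -> a < x < b.
Proof.
rewrite /bump1 mulf_eq0 negb_or /flat subr_gt0 subr_gt0.
by case: (a < x); case: (x < b); rewrite ?eqxx ?andbF.
Qed.

Lemma smooth_bump1 a b : smooth (bump1 a b).
Proof.
have s0 : smooth (flat 0) by move=> n; exact: Ck_flat.
apply: smoothM.
- apply: (@smooth_affine _ _ _ (fun x : R => x - a) id _ _ _ s0) => [x|p v h].
    by apply: continuousB => //; exact: cst_continuous.
  by rewrite addrA.
- apply: (@smooth_affine _ _ _ (fun x : R => b - x) -%R _ _ _ s0) => [x|p v h].
    by apply: continuousB => //; exact: cst_continuous.
  by rewrite scalerN opprD addrCA addrA addrC addrA.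
Qed.
End bump.

Section averaging_support.
Variables (R : realType) (N : nat).
Local Notation RN := 'rV[R]_N.
Local Notation V := (RN * R)%type.
Variables (d : measure_display) (Om : measurableType d).
Variables (nu : {measure set Om -> \bar R}) (th : Om -> V) (g : Om -> R).
Implicit Types f : V -> R.

(** If the average is nonzero at [p], some [w] has [g w != 0] and [f (p + th w) != 0], so [p] is a
    point of the support of [f] minus a point of [K]. That set of differences is a continuous image
    of a compact set, hence closed, and absorbs the closure. *)
Lemma average_support f (K : set V) : compact (closure [set x | f x != 0]) ->
  compact K -> (forall w, g w != 0 -> K (th w)) ->
  let S := closure [set p | average nu th g f p != 0] in
  compact S /\ S `<=` [set a - b | a in closure [set x | f x != 0] & b in K].
Proof.
move=> kf kK gK S.
set D := [set a - b | a in _ & b in K].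
have kD : compact D.
  have -> : D = (fun ab : V * V => ab.1 - ab.2) @` (closure [set x | f x != 0] `*` K).
    apply/seteqP; split => [_ [a fa] [b Kb] <-|_ [[a b] [/= fa Kb]] <-]; first by exists (a, b).
    by exists a => //; exists b.
  apply: continuous_compact; last exact: compact_setX.
  apply: continuous_subspaceT => x; apply: continuousB; [exact: cvg_fst|exact: cvg_snd].
have cD : closed D by apply: compact_closed => //; exact: norm_hausdorff.
have SD : S `<=` D.
  rewrite /S [X in _ `<=` X](_ : D = closure D); last exact/closure_id.
  apply: closureS => p /=; apply: contraNP => nD.
  rewrite /average (_ : (fun w => _) = cst 0); first by rewrite Rintegral_cst// mul0r.
  apply/funext => w /=; have [->|gw] := eqVneq (g w) 0; first by rewrite mulr0.
  have [->|fw] := eqVneq (f (p + th w)) 0; first by rewrite mul0r.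
  exfalso; apply: nD; exists (p + th w); first exact: subset_closure.
  by exists (th w); [exact: gK|rewrite addrK].
by split=> //; apply: subclosed_compact kD SD; exact: closed_closure.
Qed.

End averaging_support.

Section bump_rV.
Variables (R : realType) (N : nat).
Local Notation RN := 'rV[R]_N.
Local Notation V := (RN * R)%type.

(** The lower end is [e / 2] and not 0: this margin in time later keeps the closed support of a
    mollified function strictly below the final time. *)
Definition bump (e : R) (p : V) : R :=
  bump1 (e / 2) e p.2 * \prod_i bump1 (e / 2) e (p.1 ord0 i).

Lemma bump_ge0 (e : R) (p : V) : 0 <= bump e p.
Proof. by rewrite mulr_ge0 ?bump1_ge0// prodr_ge0// => i _; exact: bump1_ge0. Qed.

Lemma bump_gt0 (e : R) (p : V) : e / 2 < p.2 < e -> (forall i, e / 2 < p.1 ord0 i < e) -> 0 < bump e p.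
Proof. by move=> p2 p1; rewrite mulr_gt0 ?bump1_gt0// prodr_gt0// => i _; exact: bump1_gt0. Qed.

Lemma bump_neq0 (e : R) (p : V) : bump e p != 0 -> e / 2 < p.2 < e /\ forall i, e / 2 < p.1 ord0 i < e.
Proof.
rewrite mulf_eq0 negb_or => /andP[/bump1_neq0 p2 /prodf_neq0 p1]; split => // i.
exact: bump1_neq0 (p1 i isT).
Qed.

Lemma smooth_bump e : smooth (bump e).
Proof.
apply: smoothM.
  apply: (@smooth_affine _ _ _ (fun p : V => p.2) snd _ _ _ (smooth_bump1 (e / 2) e)) => [x|p v h //].
  exact: cvg_snd.
apply: smooth_prod => i.
apply: (@smooth_affine _ _ _ (fun p : V => p.1 ord0 i) (fun p : V => p.1 ord0 i) _ _ _
  (smooth_bump1 (e / 2) e)) => [x|p v h]; last by rewrite /= !mxE.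
apply: (@continuous_comp _ _ _ (fst : V -> RN) (fun z : RN => z ord0 i)); first exact: cvg_fst.
exact: coord_continuous.
Qed.

Lemma compact_rV_itv (a b : R) : compact [set z : RN | forall i, `[a, b]%classic (z ord0 i)].
Proof. by apply: (@rV_compact _ _ (fun=> `[a, b]%classic)) => i; exact: segment_compact. Qed.

Lemma bump_support e : closure [set p | bump e p != 0] `<=`
  [set z : RN | forall i, `[e / 2, e]%classic (z ord0 i)] `*` `[e / 2, e]%classic.
Proof.
set K := _ `*` _.
have kK : compact K by apply: compact_setX; [exact: compact_rV_itv|exact: segment_compact].
rewrite [X in _ `<=` X](_ : K = closure K); last first.
  by apply/closure_id; apply: compact_closed => //; exact: norm_hausdorff.
apply: closureS => p /bump_neq0[/andP[a b] p1]; split => /=; last by rewrite in_itv/= !ltW.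
by move=> i; rewrite in_itv/=; have /andP[c c'] := p1 i; rewrite !ltW.
Qed.

Lemma smooth_cc_bump e : smooth_cc (bump e).
Proof.
split; first exact: smooth_bump.
apply: subclosed_compact (@bump_support e); first exact: closed_closure.
by apply: compact_setX; [exact: compact_rV_itv|exact: segment_compact].
Qed.

End bump_rV.

(** * Measures and square-integrable functions *)

Section measure_transport.
Context d d' (T : measurableType d) (T' : measurableType d') (R : realType).
Variables (m : {measure set T -> \bar R}) (m' : {measure set T' -> \bar R}).

(** The measure [m'] is the image of [m] under [h]. Translations, the reflection of [z] and
    reorderings of product variables are all handled through this one notion. *)
Definition transports (h : T -> T') :=
  measurable_fun setT h /\ forall A, measurable A -> m (h @^-1` A) = m' A.

Lemma ge0_integral_transports h (f : T' -> \bar R) : transports h ->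
  measurable_fun setT f -> (forall x, (0 <= f x)%E) ->
  (\int[m]_x f (h x) = \int[m']_x f x)%E.
Proof.
move=> [mh hm] mf f0.
rewrite -[LHS](@ge0_integral_pushforward _ _ _ _ _ h mh m setT f)//.
by apply: eq_measure_integral => A mA _; exact: hm.
Qed.

Lemma integrable_transports h (f : T' -> \bar R) : transports h ->
  m'.-integrable setT f -> m.-integrable setT (f \o h).
Proof.
move=> hp fi; have mf := measurable_int _ fi; have [mh _] := hp.
apply/integrableP; split; first exact: measurableT_comp.
have /integrableP[_] := fi.
by have /= -> := @ge0_integral_transports h (abse \o f) hp (measurableT_comp _ mf) (fun=> abse_ge0 _).
Qed.

Lemma transports_integrable h (f : T' -> \bar R) : transports h -> measurable_fun setT f ->
  m.-integrable setT (f \o h) -> m'.-integrable setT f.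
Proof.
move=> hp mf /integrableP[_ fi]; apply/integrableP; split => //.
by have /= <- := @ge0_integral_transports h (abse \o f) hp (measurableT_comp _ mf) (fun=> abse_ge0 _).
Qed.

Lemma integral_transports h (f : T' -> \bar R) : transports h ->
  m'.-integrable setT f -> (\int[m]_x f (h x) = \int[m']_x f x)%E.
Proof.
move=> hp fi; have mf := measurable_int _ fi; have [mh _] := hp.
rewrite integralE [RHS]integralE; congr (_ - _)%E.
- have := @ge0_integral_transports h (f^\+)%E hp (measurable_funepos mf) (@funepos_ge0 _ _ f).
  by move=> <-; apply: eq_integral => x _; rewrite !funeposE.
- have := @ge0_integral_transports h (f^\-)%E hp (measurable_funeneg mf) (@funeneg_ge0 _ _ f).
  by move=> <-; apply: eq_integral => x _; rewrite !funenegE.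
Qed.

Lemma Rintegral_transports h (f : T' -> R) : transports h ->
  m'.-integrable setT (EFin \o f) -> \int[m]_x f (h x) = \int[m']_x f x.
Proof. by move=> hp fi; rewrite /Rintegral (integral_transports hp fi). Qed.

End measure_transport.

Notation preserves m h := (transports m m h).

Lemma preserves_prod d1 d2 (T1 : measurableType d1) (T2 : measurableType d2) (R : realType)
  (m1 : {sigma_finite_measure set T1 -> \bar R}) (m2 : {sigma_finite_measure set T2 -> \bar R})
  (h1 : T1 -> T1) (h2 : T2 -> T2) : preserves m1 h1 -> preserves m2 h2 ->
  preserves (m1 \x m2)%E (fun p => (h1 p.1, h2 p.2)).
Proof.
move=> [mh1 hm1] [mh2 hm2].
have mh : measurable_fun setT (fun p : T1 * T2 => (h1 p.1, h2 p.2)).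
  by apply: measurable_fun_pair; exact: measurableT_comp.
split=> // A mA.
have := @product_measure_unique _ _ _ _ _ m1 m2
  (pushforward (m1 \x m2)%E (fun p : T1 * T2 => (h1 p.1, h2 p.2))) _ A mA.
move=> /(_ mh) H; apply: esym; apply: H.
move=> B C mB mC.
change ((m1 \x m2)%E ((h1 @^-1` B) `*` (h2 @^-1` C)) = (m1 B * m2 C)%E).
have mB' : measurable (h1 @^-1` B) by rewrite -[X in measurable X]setTI; exact: mh1.
have mC' : measurable (h2 @^-1` C) by rewrite -[X in measurable X]setTI; exact: mh2.
by rewrite [LHS]product_measure1E// hm1// hm2.
Qed.

(** The conclusion is an equality of measures, so that the bundled structure used by products and by
    Tonelli can be put, by rewriting, on a measure that is given without it. *)
Lemma sigma_finite_pack d (T : measurableType d) (R : realType)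
  (m : {measure set T -> \bar R}) : sigma_finite setT m ->
  exists m' : {sigma_finite_measure set T -> \bar R}, m' = m :> {measure set T -> \bar R}.
Proof.
case: m => m cm sf.
pose M : {measure set T -> \bar R} := Measure.Pack cm.
pose S := Measure_isSigmaFinite.Build _ _ _ M sf.
pose M' : {sigma_finite_measure set T -> \bar R} := HB.pack (M : set T -> \bar R) M S.
by exists M'.
Qed.

(** * Translation invariance of Lebesgue measure on R^N *)

Section lebesgue_translation.
Variable R : realType.
Local Notation mR := (measurableTypeR R).

Lemma preserves_lebesgue_shift (a : R) :
  preserves (@lebesgue_measure R) (fun x : mR => x + a : mR).
Proof.
have ms : measurable_fun setT (fun x : mR => x + a : mR) by exact: measurable_funD.
split=> // A mA; apply/esym.
apply: (@lebesgue_measure_unique R (pushforward (@lebesgue_measure R) (fun x : mR => x + a : mR))) => //.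
move=> X [[u v] /= uv <-]; rewrite /pushforward.
rewrite (_ : _ @^-1` _ = `]u - a, v - a]%classic); last first.
  by apply/seteqP; split => x /=; rewrite !in_itv /= ltrBlDr lerBrDr.
rewrite !lebesgue_measure_itv /= !lte_fin ltrD2r; case: ifPn => // _.
by congr (_%:E); rewrite opprB addrA subrK.
Qed.

Lemma measurable_box n (a b : 'rV[R]_n) : measurable [set v : 'rV[R]_n | forall i, v ord0 i \in `]a ord0 i, b ord0 i]].
Proof.
rewrite (_ : mkset _ = \bigcap_(i in [set: 'I_n])
        ((fun v : 'rV[R]_n => v ord0 i) @^-1` `]a ord0 i, b ord0 i])).
  apply: fin_bigcap_measurable => // i _; rewrite -[X in measurable X]setTI.
  exact: measurable_coord.
by apply/seteqP; split => [v Av i _|v Av i]; exact: Av.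
Qed.

Lemma measurable_open_box n (a b : R) : measurable [set v : 'rV[R]_n | forall i, a < v ord0 i < b].
Proof.
rewrite (_ : mkset _ = \bigcap_(i in [set: 'I_n]) ((fun v : 'rV[R]_n => v ord0 i) @^-1` `]a, b[)).
  apply: fin_bigcap_measurable => // i _; rewrite -[X in measurable X]setTI.
  exact: measurable_coord.
apply/seteqP; split => [v Av i _|v Av i]; first by have := Av i; rewrite /= in_itv.
by have := Av i I; rewrite /= in_itv.
Qed.

Definition cube n (k : nat) : set 'rV[R]_n := [set v | forall i, - k%:R < v ord0 i <= k%:R].

Lemma cubeE n k : cube k = [set v : 'rV[R]_n | forall i, v ord0 i \in
  `](const_mx (- k%:R) : 'rV[R]_n) ord0 i, (const_mx k%:R : 'rV[R]_n) ord0 i]].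
Proof. by apply/seteqP; split => v /= H i; have := H i; rewrite !mxE in_itv. Qed.

Lemma measurable_cube n k : measurable (@cube n k).
Proof. by rewrite cubeE; exact: measurable_box. Qed.

Lemma lebesgue_cube_fin n k : (lebesgue_rV R n (cube k) < +oo)%E.
Proof. by rewrite cubeE lebesgue_rV_box ?ltry// => i; rewrite !mxE (@le_trans _ _ 0)// oppr_le0. Qed.

Lemma cube_cover n : \bigcup_k (@cube n k) = setT.
Proof.
apply/seteqP; split => // v _.
have [k kv] : exists k : nat, `|v| < k%:R.
  by exists (Num.truncn `|v|).+1; rewrite truncnS_gt.
exists k => // i; have := le_lt_trans (rV_coord_le v i) kv.
by rewrite ltr_norml => /andP[-> /ltW ->].
Qed.

Lemma sigma_finite_lebesgue_rV n : sigma_finite setT (lebesgue_rV R n).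
Proof.
exists (@cube n); first by rewrite cube_cover.
by move=> k; split; [exact: measurable_cube|exact: lebesgue_cube_fin].
Qed.

(** By induction on the dimension: the measure in dimension [n.+1] is the image of a product under
    [rV_rcons], through which the translation splits into one of the first [n] coordinates and one
    of the last. *)
Lemma preserves_lebesgue_rV n (a : 'rV[R]_n) : preserves (lebesgue_rV R n) (fun x => x + a).
Proof.
have mshift k (b : 'rV[R]_k) : measurable_fun setT (fun x : 'rV[R]_k => x + b).
  apply: measurable_fun_rV => i.
  rewrite (_ : (fun _ => _) = (fun x : 'rV[R]_k => x ord0 i + b ord0 i)); last by apply/funext => x; rewrite mxE.
  by apply: measurable_funD => //; exact: measurable_coord.
split; first exact: mshift.
elim: n a => [|n IH] a A mA.
  by congr (lebesgue_rV R 0 _); apply/funext => x; rewrite /= (_ : x + a = x)//; apply/rowP => -[].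
rewrite /= /rV_prod /pushforward.
have [m mE] := sigma_finite_pack (sigma_finite_lebesgue_rV n).
rewrite -mE.
pose a' : 'rV[R]_n := \row_i a ord0 (lift ord_max i).
have P1 : preserves m (fun x => x + a').
  by split; [exact: mshift|move=> B mB; rewrite mE; exact: IH].
have [_ P] := preserves_prod P1 (preserves_lebesgue_shift (a ord0 ord_max)).
have mr : measurable (@rV_rcons R n @^-1` A).
  by rewrite -[X in measurable X]setTI; exact: measurable_rV_rcons.
rewrite -(P _ mr); congr (_ _); apply/seteqP; split => -[v t] /=.
all: rewrite (_ : rV_rcons (v, t) + a = rV_rcons (v + a', t + a ord0 ord_max))//.
all: by apply/rowP => i; rewrite /rV_rcons !mxE /=; case: unliftP => [j|] -> /=; rewrite ?mxE.
Qed.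

Lemma lebesgue_open_box_gt0 n (e : R) : 0 < e ->
  (0 < lebesgue_rV R n [set z | forall i, (e / 2 < z ord0 i < e)%R])%E.
Proof.
move=> e0.
(* The open box contains the half-open box with upper corner [3/4 e], whose volume is known exactly:
   [e/4] to the power [n]. *)
pose a : 'rV[R]_n := const_mx (e / 2); pose b : 'rV[R]_n := const_mx (e * (3 / 4)).
have ab : (lebesgue_rV R n [set v | forall i, v ord0 i \in `]a ord0 i, b ord0 i]] =
  (\prod_i (b ord0 i - a ord0 i))%:E)%E.
  by apply: lebesgue_rV_box => i; rewrite !mxE; lra.
apply: (@lt_le_trans _ _ (\prod_i (b ord0 i - a ord0 i))%:E).
  by rewrite lte_fin prodr_gt0// => i _; rewrite !mxE; lra.
rewrite -ab; apply: le_measure.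
- by rewrite inE; exact: measurable_box.
- by rewrite inE; exact: measurable_open_box.
- by move=> v /= vab i; have := vab i; rewrite in_itv /= !mxE => /andP[-> H]; lra.
Qed.

End lebesgue_translation.

Section continuous_measurable.
Variables (R : realType) (n : nat).

Lemma continuous_measurable_rV (h : 'rV[R]_n -> R) : continuous h -> measurable_fun setT h.
Proof.
move=> ch; apply: (measurability _ (RGenOpens.measurableE R)) => _ [_ [a [b ->]] <-].
rewrite setTI; apply: sub_sigma_algebra.
have /continuousP := ch; apply; exact: interval_open.
Qed.

Lemma measurable_addrV d (T : measurableType d) (f g : T -> 'rV[R]_n) :
  measurable_fun setT f -> measurable_fun setT g -> measurable_fun setT (fun x => f x + g x).
Proof.
move=> mf mg; apply: measurable_fun_rV => i.
rewrite (_ : (fun _ => _) = (fun x => f x ord0 i + g x ord0 i)); last by apply/funext => x; rewrite mxE.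
by apply: measurable_funD; apply: (measurableT_comp (measurable_coord i)).
Qed.

End continuous_measurable.

(** The domain carries a product of Borel sigma-algebras, whereas continuity speaks of open sets of
    the product. Factoring [f] through R^(n+1), where the sigma-algebra is generated by the open
    sets, reconciles the two. *)
Lemma continuous_measurable_spacetime (R : realType) (n : nat) (f : 'rV[R]_n * R -> R) :
  continuous f -> measurable_fun setT (f : 'rV[R]_n * measurableTypeR R -> R).
Proof.
move=> cf.
pose iv (v : 'rV[R]_n.+1) : 'rV[R]_n * R := (\row_i v ord0 (lift ord_max i), v ord0 ord_max).
have fE : f = (f \o iv) \o @rV_rcons R n.
  apply/funext => -[v t]; rewrite /= /iv /rV_rcons mxE unlift_none /=; congr (f (_, _)).
  by apply/rowP => i; rewrite !mxE liftK.
rewrite fE; apply: measurableT_comp; last exact: measurable_rV_rcons.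
apply: continuous_measurable_rV => v; apply: continuous_comp; last exact: cf.
have c2 : (fun v' : 'rV[R]_n.+1 => v' ord0 ord_max) @ v --> (v ord0 ord_max : R) by exact: coord_continuous.
suff c1 : (fun v' : 'rV[R]_n.+1 => \row_i v' ord0 (lift ord_max i) : 'rV[R]_n) @ v -->
  (\row_i v ord0 (lift ord_max i) : 'rV[R]_n) by exact: cvg_pair c1 c2.
move=> A /nbhs_ballP[e /= e0 eA]; apply/nbhs_ballP; exists e => //= w [_ vw].
apply: eA; split => // i j.
by rewrite !mxE; exact: vw.
Qed.

(** * Square-integrable functions *)

Section L2.
Context d (Y : measurableType d) (R : realType) (M : {measure set Y -> \bar R}).
Implicit Types (f g h : Y -> R).

Definition L2f f := measurable_fun setT f /\ (\int[M]_y (f y ^+ 2)%:E < +oo)%E.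
Definition sqn f : R := \int[M]_y (f y ^+ 2).

Lemma L2_sqr_integrable f : L2f f -> M.-integrable setT (fun y => (f y ^+ 2)%:E).
Proof.
move=> [mf foo]; apply/integrableP; split.
  by apply/measurable_EFinP; exact: measurable_funX.
by under eq_integral => y _ do rewrite gee0_abs ?lee_fin ?sqr_ge0//.
Qed.

Lemma integrable_L2 f : measurable_fun setT f -> M.-integrable setT (fun y => (f y ^+ 2)%:E) -> L2f f.
Proof.
move=> mf /integrableP[_]; split => //.
by under [ltLHS]eq_integral => y _ do rewrite -[(_ ^+ 2)%:E]gee0_abs ?lee_fin ?sqr_ge0//.
Qed.

Lemma sqn_ge0 f : 0 <= sqn f.
Proof. by apply: Rintegral_ge0 => y _; rewrite sqr_ge0. Qed.

Lemma L2_dom f g h : measurable_fun setT f -> L2f g -> L2f h ->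
  (forall y, f y ^+ 2 <= g y ^+ 2 + h y ^+ 2) -> L2f f.
Proof.
move=> mf /L2_sqr_integrable ig /L2_sqr_integrable ih fgh; apply: integrable_L2 => //.
have := integrableD measurableT ig ih; apply: le_integrable => //.
  by apply/measurable_EFinP; exact: measurable_funX.
move=> y _; rewrite /= !lee_fin !ger0_norm ?sqr_ge0// addr_ge0// sqr_ge0//.
Qed.

Lemma L2_0 : L2f (cst 0).
Proof.
split=> //; under eq_integral => y _ do rewrite /= expr0n /=.
by rewrite integral0.
Qed.

Lemma L2_le f g : measurable_fun setT f -> L2f g -> (forall y, `|f y| <= `|g y|) -> L2f f.
Proof.
move=> mf Lg fg; apply: (L2_dom mf Lg L2_0) => y; rewrite expr0n addr0.
by rewrite -(real_normK (num_real (f y))) -(real_normK (num_real (g y))) lerXn2r ?nnegrE.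
Qed.

Lemma L2Z (c : R) f : L2f f -> L2f (fun y => c * f y).
Proof.
move=> Lf; have mf := Lf.1; apply: integrable_L2; first exact: measurable_funM.
have := integrableZl measurableT (c ^+ 2) (L2_sqr_integrable Lf).
by apply: eq_integrable => // y _; rewrite exprMn.
Qed.

Lemma L2D f g : L2f f -> L2f g -> L2f (fun y => f y + g y).
Proof.
move=> Lf Lg; apply: (L2_dom _ (L2Z 2 Lf) (L2Z 2 Lg)).
  by apply: measurable_funD; [case: Lf|case: Lg].
by move=> y; nra.
Qed.

Lemma L2B f g : L2f f -> L2f g -> L2f (fun y => f y - g y).
Proof.
move=> Lf Lg; have := L2D Lf (L2Z (-1) Lg).
by under eq_fun do rewrite mulN1r.
Qed.

Lemma L2_mul_integrable f g : L2f f -> L2f g -> M.-integrable setT (fun y => (f y * g y)%:E).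
Proof.
move=> Lf Lg; have := integrableD measurableT (L2_sqr_integrable Lf) (L2_sqr_integrable Lg).
apply: le_integrable => //.
  by apply/measurable_EFinP; apply: measurable_funM; [case: Lf|case: Lg].
move=> y _; rewrite /= !lee_fin [leRHS]ger0_norm ?addr_ge0 ?sqr_ge0// ler_norml.
by apply/andP; split; nra.
Qed.

(** Young's inequality with a free weight; optimising over [e] would give Cauchy-Schwarz up to the
    factor 2, and the free [e] avoids square roots. *)
Lemma L2_mul_le f g (e : R) : 0 < e -> L2f f -> L2f g ->
  `|\int[M]_y (f y * g y)| <= e * sqn f + e^-1 * sqn g.
Proof.
move=> e0 Lf Lg.
rewrite (le_trans (le_normr_Rintegral _ (L2_mul_integrable Lf Lg)))//.
have i1 := integrableZl measurableT e (L2_sqr_integrable Lf).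
have i2 := integrableZl measurableT e^-1 (L2_sqr_integrable Lg).
rewrite /sqn -!RintegralZl//; [|exact: L2_sqr_integrable..].
rewrite -RintegralD//; apply: le_Rintegral => //.
- exact: integrable_abse (L2_mul_integrable Lf Lg).
- by have := integrableD measurableT i1 i2; apply: eq_integrable.
move=> y _; rewrite ler_norml.
(* Writing [g y] as [e * z] turns the inequality into the nonnegativity of [e * (f y - z) ^+ 2] and
   [e * (f y + z) ^+ 2], with no inverse left. *)
have [z ->] : exists z, g y = e * z.
  by exists (e^-1 * g y); rewrite mulrA divff ?gt_eqF// mul1r.
have -> : e^-1 * (e * z) ^+ 2 = e * z ^+ 2.
  by rewrite exprMn (expr2 e) !mulrA mulVf ?gt_eqF// mul1r.
have h1 : 0 <= e * (f y - z) ^+ 2 by rewrite mulr_ge0 ?sqr_ge0// ltW.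
have h2 : 0 <= e * (f y + z) ^+ 2 by rewrite mulr_ge0 ?sqr_ge0// ltW.
have h3 : 0 <= e * f y ^+ 2 by rewrite mulr_ge0 ?sqr_ge0// ltW.
have h4 : 0 <= e * z ^+ 2 by rewrite mulr_ge0 ?sqr_ge0// ltW.
by apply/andP; split; lra.
Qed.

Lemma L2_dominated (f_ : nat -> Y -> R) f g : (forall n, measurable_fun setT (f_ n)) ->
  measurable_fun setT f -> L2f g -> (forall n y, `|f_ n y| <= `|g y|) ->
  (forall y, f_ n y @[n --> \oo] --> f y) ->
  sqn (fun y => f y - f_ n y) @[n --> \oo] --> 0.
Proof.
move=> mf_ mf Lg fg f_f.
have fg' y : `|f y| <= `|g y|.
  have H : `|f_ n y| @[n --> \oo] --> `|f y| by apply: cvg_norm.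
  rewrite -(cvg_lim _ H)//; apply: limr_le; first by apply/cvg_ex; exists `|f y|.
  by near=> n; exact: fg.
have Lg2 := L2Z 2 Lg.
have := @dominated_convergence _ _ _ M setT measurableT
  (fun n y => ((f y - f_ n y) ^+ 2)%:E) (cst 0%E) (fun y => ((2 * g y) ^+ 2)%:E).
case.
- by move=> n; apply/measurable_EFinP; apply: measurable_funX; exact: measurable_funB.
- exact: measurable_cst.
- apply/nearW => y _; rewrite -[X in _ --> X]/(0%:E); apply/cvg_EFin; first by apply/nearW.
  rewrite (_ : _ \o _ = (fun n => (f y - f_ n y) ^+ 2))//.
  have H : f y - f_ n y @[n --> \oo] --> f y - f y by apply: cvgB => //; exact: cvg_cst.
  under eq_fun do rewrite expr2.
  by rewrite -[0](mul0r (0 : R)) -(subrr (f y)); exact: (cvgM H H).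
- exact: L2_sqr_integrable.
- apply/nearW => y n _; rewrite gee0_abs ?lee_fin ?sqr_ge0//.
  rewrite -(real_normK (num_real (f y - _))) -(real_normK (num_real (2 * _))).
  rewrite lerXn2r ?nnegrE// normrM (ger0_norm (_ : 0 <= 2))// mulr_natl mulr2n.
  by rewrite (le_trans (ler_normB _ _))// lerD.
move=> _ _; rewrite integral0 => H.
by rewrite -[X in _ --> X]/(fine 0%E); apply: fine_cvg.
Unshelve. all: by end_near. Qed.

Lemma L2_indic (A : set Y) : measurable A -> (M A < +oo)%E -> L2f \1_A.
Proof.
move=> mA MA; split=> //.
under eq_integral => y _.
  rewrite (_ : \1_A y ^+ 2 = \1_A y); first over.
  by rewrite indicE; case: (_ \in _); rewrite ?expr1n ?expr0n.
by rewrite integral_indic// setIT.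
Qed.

End L2.

Import HBSimple HBNNSimple.

(** * Weak limits on L2 from the indicators of a pi-system *)

Section L2_density.
Context d (Y : measurableType d) (R : realType) (M : {measure set Y -> \bar R}).
Local Notation L2 := (L2f M).
Variables (G : set (set Y)) (E : nat -> set Y).
Hypothesis GY : @measurable d Y = <<s G >>.
Hypothesis GI : setI_closed G.
Hypothesis Gfin : forall A, G A -> (M A < +oo)%E.
Hypothesis GE : forall j, G (E j).
Hypothesis E_cover : \bigcup_j E j = setT.
Variables (l : nat -> (Y -> R) -> R) (C : R).
Hypothesis lD : forall k f g, L2 f -> L2 g -> l k (fun y => f y + g y) = l k f + l k g.
Hypothesis lZ : forall k c f, L2 f -> l k (fun y => c * f y) = c * l k f.
Hypothesis l_le : forall k e f, 0 < e -> L2 f -> `|l k f| <= e * C + e^-1 * sqn M f.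
Hypothesis l_G : forall A, G A -> l k \1_A @[k --> \oo] --> (0 : R).

(** The class to be shown equal to all of L2. The hypothesis [l_le], with its free [e], amounts to a
    bound of [l k f] by [2 * sqrt C] times the L2 norm of [f], uniform in [k]; this is what makes
    the class closed. *)
Let vanish f := L2 f /\ l k f @[k --> \oo] --> (0 : R).

Let mG A : G A -> measurable A.
Proof. by move=> GA; rewrite GY; exact: sub_sigma_algebra. Qed.

Let C0 : 0 <= C.
Proof.
have := @l_le 0%N 1 (cst 0) ltr01 (L2_0 M).
rewrite mul1r invr1 mul1r /sqn.
have -> : \int[M]_y (cst 0 y ^+ 2) = 0 :> R.
  by under eq_Rintegral => y _ do rewrite /= expr0n /=; rewrite Rintegral_cst// mul0r.
by rewrite addr0; apply: le_trans.
Qed.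

Let lB k f g : L2 f -> L2 g -> l k (fun y => f y - g y) = l k f - l k g.
Proof.
move=> Lf Lg; rewrite -mulN1r -lZ// -lD//; last exact: L2Z.
by congr l; apply/funext => y; rewrite mulN1r.
Qed.

Let vanishD f g : vanish f -> vanish g -> vanish (fun y => f y + g y).
Proof.
move=> [Lf cf] [Lg cg]; split; first exact: L2D.
under eq_fun do rewrite lD//.
by rewrite -(addr0 (0 : R)); exact: (cvgD cf cg).
Qed.

Let vanishZ c f : vanish f -> vanish (fun y => c * f y).
Proof.
move=> [Lf cf]; split; first exact: L2Z.
under eq_fun do rewrite lZ//.
rewrite -(mulr0 c).
by apply: cvgM => //; exact: cvg_cst.
Qed.

Let vanishB f g : vanish f -> vanish g -> vanish (fun y => f y - g y).
Proof.
move=> vf vg; have := vanishD vf (vanishZ (-1) vg).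
by under eq_fun do rewrite mulN1r.
Qed.

Let vanish_closed f (f_ : nat -> Y -> R) : L2 f -> (forall n, vanish (f_ n)) ->
  sqn M (fun y => f y - f_ n y) @[n --> \oo] --> (0 : R) -> vanish f.
Proof.
move=> Lf vf_ f_f; split => //; apply/cvgrPdist_le => e e0.
(* Used as the weight in [l_le]: [r] makes its first half at most [e / 3], and [f_ n] is then taken
   so close to [f] that its second half is at most [e / 3] as well. *)
pose r := e / (3 * (C + 1)).
have C1 : 0 < C + 1 by rewrite ltr_wpDl.
have r0 : 0 < r by rewrite divr_gt0// mulr_gt0.
have re0 : 0 < r * (e / 3) by rewrite mulr_gt0// divr_gt0.
move/cvgrPdist_le : f_f => /(_ _ re0)[n _ /(_ n (leqnn n))].
rewrite sub0r normrN => fn.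
have [Lfn /cvgrPdist_le cfn] := vf_ n.
have e3 : 0 < e / 3 by rewrite divr_gt0.
near=> k; rewrite sub0r normrN.
have -> : l k f = l k (f_ n) + l k (fun y => f y - f_ n y) by rewrite lB// addrC subrK.
rewrite (le_trans (ler_normD _ _))//.
have h1 : `|l k (f_ n)| <= e / 3.
  by rewrite -normrN -sub0r; near: k; exact: cfn.
have h2 := l_le k r0 (L2B Lf Lfn).
have h3 : r * C <= e / 3.
  rewrite /r invfM mulrA mulrAC -mulrA ler_piMr//; first by rewrite ltW.
  by rewrite ler_pdivrMr// mul1r lerDl.
have h4 : r^-1 * sqn M (fun y => f y - f_ n y) <= e / 3.
  by rewrite mulrC ler_pdivrMr// mulrC (le_trans (ler_norm _)).
lra.
Unshelve. all: by end_near. Qed.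

Let vanish_dominated f (f_ : nat -> Y -> R) g : L2 f -> (forall n, vanish (f_ n)) ->
  L2 g -> (forall n y, `|f_ n y| <= `|g y|) ->
  (forall y, f_ n y @[n --> \oo] --> f y) -> vanish f.
Proof.
move=> Lf vf_ Lg fg ff; apply: (vanish_closed Lf vf_); apply: (L2_dominated _ _ Lg) => //.
  by move=> n; case: (vf_ n) => -[].
by case: Lf.
Qed.

Let indic_setI_le (A B : set Y) y : `|\1_(A `&` B) y| <= `|\1_B y| :> R.
Proof.
rewrite !indicE in_setI; case: (y \in A); case: (y \in B) => //=.
by rewrite normr0.
Qed.

(** Dynkin's lemma, localised to [E j] where every indicator is square-integrable: complements
    become differences from [\1_(E j)], and disjoint unions are limits of finite sums dominated by
    [\1_(E j)]. *)
Let vanish_indicE j A : measurable A -> vanish \1_(A `&` E j).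
Proof.
move=> mA; have mE : measurable (E j) by exact/mG/GE.
have LE : L2 \1_(E j) by apply: L2_indic => //; exact/Gfin/GE.
have LAE B : measurable B -> L2 \1_(B `&` E j).
  by move=> mB; apply: L2_le LE _ => [|y]; [exact/measurable_indic/measurableI|exact: indic_setI_le].
have vE : vanish \1_(E j) by split => //; exact/l_G/GE.
move: mA; rewrite GY; apply: (@dynkin_induction _ _ G (fun A => vanish \1_(A `&` E j))) => //.
- by rewrite setTI.
- by move=> B GB; split; [apply: LAE; exact: mG|apply: l_G; exact: GI].
- move=> B mB vB; have := vanishB vE vB; congr vanish.
  apply/funext => y; rewrite !indicE in_setI in_setI in_setC.
  by case: (y \in B); case: (y \in E j); rewrite /= ?subrr ?subr0.
- move=> F mF tF vF.
  pose f_ n y : R := \sum_(i < n) \1_(F i `&` E j) y.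
  have f_E n : f_ n = \1_((\big[setU/set0]_(i < n) F i) `&` E j).
    elim: n => [|n IH].
      by apply/funext => y; rewrite /f_ big_ord0 big_ord0 set0I indic0.
    have -> : f_ n.+1 = (fun y => f_ n y + \1_(F n `&` E j) y).
      by apply/funext => y; rewrite /f_ big_ord_recr.
    rewrite IH; apply/funext => y; rewrite big_ord_recr /= !indicE !in_setI in_setU.
    have [yE|] := boolP (y \in E j); last by rewrite !andbF addr0.
    rewrite !andbT; have [yn|] := boolP (y \in F n); last by rewrite orbF addr0.
    suff /negbTE -> : y \notin \big[setU/set0]_(i < n) F i by rewrite orbT add0r.
    apply/negP; move: yn; rewrite !inE -bigcup_mkord => Fn [i /= ni Fi].
    have iE := tF i n I I (ex_intro _ y (conj Fi Fn)).
    by move: ni; rewrite iE ltnn.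
  have vf n : vanish (f_ n).
    elim: n => [|n IH].
      have := vanishZ 0 vE; congr vanish; apply/funext => y.
      by rewrite /f_ big_ord0 mul0r.
    have -> : f_ n.+1 = (fun y => f_ n y + \1_(F n `&` E j) y).
      by apply/funext => y; rewrite /f_ big_ord_recr.
    exact: vanishD.
  apply: (vanish_dominated _ vf LE).
  + by apply: LAE; exact: bigcup_measurable.
  + by move=> n y; rewrite f_E; exact: indic_setI_le.
  + move=> y; apply: cvg_near_cst.
    have [[i _ Fi]|nF] := pselect ((\bigcup_k F k) y).
      near=> n; rewrite f_E !indicE !in_setI; congr (_ && _)%:R.
      rewrite !mem_set//; first by exists i.
      rewrite -bigcup_mkord; exists i => //=; near: n; exact: nbhs_infty_gt.
    near=> n; rewrite f_E !indicE !in_setI; congr (_ && _)%:R.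
    rewrite !memNset//; rewrite -bigcup_mkord => -[i _ Fi]; apply: nF; by exists i.
Unshelve. all: by end_near. Qed.

Let vanish_indic A : measurable A -> (M A < +oo)%E -> vanish \1_A.
Proof.
move=> mA MA; have LA := L2_indic mA MA.
have E_seq : exists e : nat -> set Y, [/\ (forall n, vanish \1_(A `&` e n)) &
    forall y, \forall n \near \oo, e n y].
  exists (fun n => \big[setU/set0]_(i < n) E i); split; last first.
    move=> y; have : (\bigcup_j E j) y by rewrite E_cover.
    move=> [j _ Ej]; near=> n; rewrite -bigcup_mkord; exists j => //=.
    by near: n; exact: nbhs_infty_gt.
  elim=> [|n IH].
    rewrite big_ord0 setI0; have := vanishZ 0 (vanish_indicE 0 measurable0).
    by congr vanish; apply/funext => y; rewrite mul0r indicE in_set0.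
  rewrite big_ord_recr /=; set B := \big[setU/set0]_(i < n) E i in IH *.
  have mB : measurable B by apply: bigsetU_measurable => i _; exact/mG/GE.
  (* The sets [E j] may overlap, so what [E n] adds is taken outside the union [B] of the earlier
     ones; the indicators then add up. *)
  have := vanishD IH (vanish_indicE n (measurableD mA mB)); congr vanish.
  apply/funext => y; rewrite !indicE setDE !in_setI in_setC in_setU.
  by case: (y \in A); case: (y \in B); case: (y \in E n); rewrite /= ?addr0 ?add0r.
have [e [ve ey]] := E_seq.
apply: (vanish_dominated LA ve LA) => [n y|y]; first by rewrite setIC indic_setI_le.
apply: cvg_near_cst; have := ey y; apply: filterS => n en.
by rewrite !indicE in_setI (mem_set en) andbT.
Unshelve. all: by end_near. Qed.

(** Chebyshev: on the level set of a value [r != 0] one has [r ^+ 2 <= f ^+ 2], so the level set has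
    finite measure, and [s] is a finite combination of such indicators. *)
Let vanish_nnsfun (s : {nnsfun Y >-> R}) (f : Y -> R) : L2 f ->
  (forall y, s y <= `|f y|) -> vanish s.
Proof.
move=> Lf sf; have L0 : vanish (cst 0).
  have := vanishZ 0 (vanish_indicE 0 measurable0); congr vanish.
  by apply/funext => y; rewrite mul0r.
have vr r : vanish (fun y => r * \1_(s @^-1` [set r]) y).
  have [->|r0] := eqVneq r 0.
    by move: L0; congr vanish; apply/funext => y; rewrite mul0r.
  apply/vanishZ/vanish_indic; first exact: measurable_funPTI.
  have mr : measurable (s @^-1` [set r]) by exact: measurable_funPTI.
  have r20 : 0 < r ^+ 2 by rewrite lt0r sqrf_eq0 r0 sqr_ge0.
  have : ((r ^+ 2)%:E * M (s @^-1` [set r]) < +oo)%E.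
    apply: le_lt_trans Lf.2; rewrite -[X in M X]setIT -integral_indic//.
    rewrite -ge0_integralZl//; [|exact/measurable_EFinP/measurable_indic|by rewrite lee_fin ltW].
    apply: ge0_le_integral => //.
    - by move=> y _; rewrite mule_ge0// lee_fin ltW.
    - by apply/measurable_EFinP; apply: measurable_funM => //; exact: measurable_indic.
    - by apply/measurable_EFinP; apply: measurable_funX; case: Lf.
    move=> y _; rewrite -EFinM lee_fin indicE.
    case: (boolP (y \in _)) => [|_]; last by rewrite mulr0 sqr_ge0.
    rewrite inE /= => sy; rewrite mulr1 -(real_normK (num_real (f y))) lerXn2r ?nnegrE//.
      by rewrite -sy.
    by rewrite -sy.
  rewrite !ltey; apply: contra => /eqP ->.
  by rewrite gt0_muley// lte_fin.
have [t tE] : exists t : seq R, forall y, s y = \sum_(r <- t) r * \1_(s @^-1` [set r]) y.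
  exists (finmap.enum_fset (fset_set (range s))) => y.
  by rewrite fimfunE fsbig_finite.
have -> : (s : Y -> R) = fun y => \sum_(r <- t) r * \1_(s @^-1` [set r]) y by apply/funext.
elim: t {tE} => [|r t IH].
  by move: L0; congr vanish; apply/funext => y; rewrite big_nil.
have := vanishD (vr r) IH; congr vanish; apply/funext => y; by rewrite big_cons.
Qed.

Let vanish_ge0 f : L2 f -> (forall y, 0 <= f y) -> vanish f.
Proof.
move=> Lf f0; have mf : measurable_fun setT (EFin \o f) by apply/measurable_EFinP; case: Lf.
pose s := nnsfun_approx measurableT mf.
have sf y : s n y @[n --> \oo] --> f y.
  have sfE : (s n y)%:E @[n --> \oo] --> (f y)%:E.
    apply: (@cvg_nnsfun_approx _ _ _ _ measurableT _ mf _ y I) => z _.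
    by rewrite lee_fin.
  exact: (fine_cvg sfE).
have sle n y : s n y <= f y.
  have snd : {homo (s ^~ y) : n m / (n <= m)%N >-> n <= m}.
    by move=> a b ab; have /lefP := nd_nnsfun_approx measurableT mf ab; apply.
  rewrite -(cvg_lim _ (sf y))//; apply: nondecreasing_cvgn_le => //.
  by apply/cvg_ex; exists (f y).
have vs n : vanish (s n) by apply: (vanish_nnsfun Lf) => y; rewrite ger0_norm.
apply: (vanish_dominated Lf vs Lf) => // n y.
by rewrite !ger0_norm.
Qed.

(** Uniform boundedness reduces a limit on all of L2 to the indicators of a generating pi-system. It
    is applied to the difference between pairing with a mollified function and pairing with the
    function itself, in place of the continuity of translations in L2. *)
Lemma L2_density f : L2 f -> l k f @[k --> \oo] --> (0 : R).
Proof.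
move=> Lf; have mf := Lf.1.
have Lp : L2 (fun y => Num.max (f y) 0).
  apply: L2_le Lf _ => [|y]; first exact: measurable_maxr.
  by rewrite maxEle; case: ifPn => _; rewrite ?normr0.
have Ln : L2 (fun y => Num.max (- f y) 0).
  apply: L2_le Lf _ => [|y]; first by apply: measurable_maxr => //; exact: measurableT_comp.
  by rewrite maxEle; case: ifPn => _; rewrite ?normr0 ?normrN.
have [] : vanish f; last by [].
have := vanishB (vanish_ge0 Lp _) (vanish_ge0 Ln _); move=> H.
have -> : f = (fun y => Num.max (f y) 0 - Num.max (- f y) 0).
  apply/funext => y; rewrite !maxEle; case: ifPn; case: ifPn; rewrite ?subr0 ?sub0r ?opprK//.
    by rewrite oppr_le0 => h1 h2; apply/eqP; rewrite eq_le h1 h2.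
  by rewrite -!ltNge oppr_gt0 => h1 h2; lra.
by apply: H => y; rewrite le_max lexx orbT.
Qed.

End L2_density.

Lemma Rdominated_cvg d (Y : measurableType d) (R : realType) (M : {measure set Y -> \bar R})
    (f_ : nat -> Y -> R) (f g : Y -> R) :
  (forall n, measurable_fun setT (f_ n)) -> measurable_fun setT f ->
  (forall y, f_ n y @[n --> \oo] --> f y) ->
  M.-integrable setT (EFin \o g) -> (forall n y, `|f_ n y| <= g y) ->
  \int[M]_y f_ n y @[n --> \oo] --> \int[M]_y f y.
Proof.
move=> mf_ mf ff ig fg.
have [] := @dominated_convergence _ _ _ M setT measurableT
  (fun n => EFin \o f_ n) (EFin \o f) (EFin \o g) _ _ _ ig _.
- by move=> n; exact/measurable_EFinP.
- exact/measurable_EFinP.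
- by apply/nearW => y _; apply/cvg_EFin; [by apply/nearW|exact: ff].
- by apply/nearW => y n _; rewrite /= lee_fin.
move=> fi _ H; apply: fine_cvg; rewrite fineK//; exact: integrable_fin_num.
Qed.

(** * Fubini for real-valued integrals *)

Section parametric_integral.
Context d1 d2 (Y : measurableType d1) (Q : measurableType d2) (R : realType).
Variable la : {sigma_finite_measure set Q -> \bar R}.

(** Positive and negative parts are measurable in [y] by Tonelli, possibly with infinite values;
    [fine] then gives the default 0 where the difference is not finite, and it is measurable, so
    sections need not be integrable. *)
Lemma measurable_Rintegral_param (f : Y * Q -> R) : measurable_fun setT f ->
  measurable_fun setT (fun y => \int[la]_q f (y, q)).
Proof.
move=> mf; have mE : measurable_fun setT (EFin \o f) by exact/measurable_EFinP.
apply: measurableT_comp; first exact: fine_measurable.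
rewrite (_ : (fun _ => _) = (fun y => \int[la]_q (EFin \o f)^\+ (y, q) -
    \int[la]_q (EFin \o f)^\- (y, q))%E); last first.
  apply/funext => y; rewrite integralE; congr (_ - _)%E; apply: eq_integral => q _.
    by rewrite !funeposE.
  by rewrite !funenegE.
apply: emeasurable_funB.
- exact: (@measurable_fun_fubini_tonelli_F _ _ _ _ _ la (EFin \o f)^\+%E (measurable_funepos mE) (@funepos_ge0 _ _ _)).
- exact: (@measurable_fun_fubini_tonelli_F _ _ _ _ _ la (EFin \o f)^\-%E (measurable_funeneg mE) (@funeneg_ge0 _ _ _)).
Qed.

End parametric_integral.

Lemma ae_eq_integrable d (Y : measurableType d) (R : realType) (M : {measure set Y -> \bar R})
  (f g : Y -> \bar R) : measurable_fun setT g -> M.-integrable setT f ->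
  ae_eq M setT f g -> M.-integrable setT g.
Proof.
move=> mg fi fg; have mf := measurable_int _ fi; apply/integrableP; split => //.
have /integrableP[_] := fi; congr (_ < _)%E; apply: ae_eq_integral => //.
- exact: measurableT_comp.
- exact: measurableT_comp.
- by apply: filterS fg => y fg Ty; rewrite fg.
Qed.

Section real_fubini.
Context d1 d2 (Y : measurableType d1) (Q : measurableType d2) (R : realType).
Variables (M : {sigma_finite_measure set Y -> \bar R}) (la : {sigma_finite_measure set Q -> \bar R}).
Variable f : Y * Q -> R.
Hypothesis fi : (M \x la)%E.-integrable setT (EFin \o f).

Let mf : measurable_fun setT f.
Proof. by apply/measurable_EFinP; have := measurable_int _ fi; apply. Qed.

(** The extended inner integral and its real version agree wherever the section is integrable, that
    is, almost everywhere. *)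
Let ae1 : ae_eq M setT (fubini_F la (EFin \o f)) (fun y => (\int[la]_q f (y, q))%:E).
Proof.
have := ae_integrable1 fi; apply: filterS => y iy _.
by rewrite /Rintegral fineK//; exact: integrable_fin_num.
Qed.

Let ae2 : ae_eq la setT (fubini_G M (EFin \o f)) (fun q => (\int[M]_y f (y, q))%:E).
Proof.
have := ae_integrable2 fi; apply: filterS => q iq _.
by rewrite /Rintegral fineK//; exact: integrable_fin_num.
Qed.

Let m1 : measurable_fun setT (fun y => (\int[la]_q f (y, q))%:E).
Proof. by apply/measurable_EFinP; exact: measurable_Rintegral_param. Qed.

Let m2 : measurable_fun setT (fun q => (\int[M]_y f (y, q))%:E).
Proof.
apply/measurable_EFinP; apply: (@measurable_Rintegral_param _ _ _ _ _ M (fun p => f (p.2, p.1))).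
by apply: measurableT_comp => //; exact: measurable_fun_pair.
Qed.

Lemma integrable_fubini12 : M.-integrable setT (fun y => (\int[la]_q f (y, q))%:E).
Proof. exact: (ae_eq_integrable m1 (integrable_fubini_F fi) ae1). Qed.

Lemma Rintegral_fubini12 : \int[(M \x la)%E]_p f p = \int[M]_y \int[la]_q f (y, q).
Proof.
rewrite /Rintegral -integral12_prod_meas1//; congr fine.
exact: (ae_eq_integral _ _ measurableT (measurable_fubini_F fi) m1 ae1).
Qed.

Lemma Rintegral_fubini21 : \int[(M \x la)%E]_p f p = \int[la]_q \int[M]_y f (y, q).
Proof.
rewrite /Rintegral -integral21_prod_meas1//; congr fine.
exact: (ae_eq_integral _ _ measurableT (measurable_fubini_G fi) m2 ae2).
Qed.

End real_fubini.

Lemma ae_eq_Rintegral d (Y : measurableType d) (R : realType) (M : {measure set Y -> \bar R})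
  (f g : Y -> R) : measurable_fun setT f -> measurable_fun setT g ->
  ae_eq M setT f g -> \int[M]_y f y = \int[M]_y g y.
Proof.
move=> mf mg fg; congr fine; apply: ae_eq_integral => //; [exact/measurable_EFinP..|].
by apply: filterS fg => y fg Ty; rewrite fg.
Qed.

(** * Mollification *)

Section mollification.
Context d1 d2 (Y : measurableType d1) (Q : measurableType d2) (R : realType).
Variables (M : {sigma_finite_measure set Y -> \bar R}) (la : {sigma_finite_measure set Q -> \bar R}).
Variables (w : nat -> Q -> R) (tau : Q -> Y -> Y).
Hypothesis w0 : forall k q, 0 <= w k q.
Hypothesis mw : forall k, measurable_fun setT (w k).
Hypothesis w1 : forall k, (\int[la]_q (w k q)%:E = 1)%E.
Hypothesis mtau : measurable_fun setT (fun p : Y * Q => tau p.2 p.1).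
Hypothesis ptau : forall q, preserves M (tau q).
Variables (G : set (set Y)) (E : nat -> set Y).
Hypothesis GY : @measurable d1 Y = <<s G >>.
Hypothesis GI : setI_closed G.
Hypothesis Gfin : forall A, G A -> (M A < +oo)%E.
Hypothesis GE : forall j, G (E j).
Hypothesis E_cover : \bigcup_j E j = setT.
Hypothesis G_right_cont : forall A, G A -> forall y, \forall k \near \oo,
  forall q, w k q != 0 -> (A (tau q y) <-> A y).
Hypothesis G_enlarged : forall A, G A -> exists A', [/\ measurable A', (M A' < +oo)%E &
  forall k q y, w k q != 0 -> A (tau q y) -> A' y].
Local Notation L2 := (L2f M).

(** A convolution in abstract form: parameters [q], weighted by [w k], act on [Y] by the
    measure-preserving [tau q]. The space [Y] will be space-time, and also the space of triples
    (t,x,z) with [z] left in place. *)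
Definition mollified k (H : Y -> R) y := \int[la]_q (w k q * H (tau q y)).

(** A single integral over the product: linearity in [H] and a bound uniform in [k] are read off
    directly, and the iterated form is needed only for indicators. *)
Definition mollified_pairing k (W H : Y -> R) :=
  \int[(M \x la)%E]_p (w k p.2 * (W p.1 * H (tau p.2 p.1))).

Let mwk k : measurable_fun setT (fun p : Y * Q => w k p.2).
Proof. exact: measurableT_comp. Qed.

Let mW (W : Y -> R) : measurable_fun setT W -> measurable_fun setT (fun p : Y * Q => W p.1).
Proof. by move=> ?; exact: measurableT_comp. Qed.

Let mH (H : Y -> R) : measurable_fun setT H -> measurable_fun setT (fun p : Y * Q => H (tau p.2 p.1)).
Proof. by move=> ?; exact: measurableT_comp. Qed.

Lemma weighted_l k (h : Y -> R) : (forall y, 0 <= h y) -> M.-integrable setT (EFin \o h) ->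
  (M \x la)%E.-integrable setT (fun p => (w k p.2 * h p.1)%:E) /\
  \int[(M \x la)%E]_p (w k p.2 * h p.1) = \int[M]_y h y.
Proof.
move=> h0 hi; have mh : measurable_fun setT h by exact/measurable_EFinP/(measurable_int _ hi).
have mf : measurable_fun setT (fun p : Y * Q => (w k p.2 * h p.1)%:E).
  by apply/measurable_EFinP; apply: measurable_funM => //; exact: mW.
have inner y : (\int[la]_q (w k q * h y)%:E = (h y)%:E)%E.
  under eq_integral => q _ do rewrite EFinM muleC.
  rewrite ge0_integralZl//; [by rewrite w1 mule1|exact/measurable_EFinP| |by rewrite lee_fin].
  by move=> q _; rewrite lee_fin.
have tot : (\int[(M \x la)%E]_p (w k p.2 * h p.1)%:E = \int[M]_y (h y)%:E)%E.
  rewrite (fubini_tonelli1 (fun p => (w k p.2 * h p.1)%:E))//.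
    by apply: eq_integral => y _; rewrite /fubini_F /= inner.
  by move=> p; rewrite lee_fin mulr_ge0.
split; last by rewrite /Rintegral tot.
apply/integrableP; split => //.
under eq_integral => p _ do rewrite gee0_abs ?lee_fin ?mulr_ge0//.
rewrite tot; have /integrableP[_] := hi.
by under eq_integral => y _ do rewrite gee0_abs ?lee_fin//.
Qed.

(** Integrating in [y] first, invariance of [M] under [tau q] removes the shift, and the weights
    have mass 1. Together with [weighted_l] this bounds the pairing by two norms independent of
    [k]. *)
Lemma weighted_r k (h : Y -> R) : (forall y, 0 <= h y) -> M.-integrable setT (EFin \o h) ->
  (M \x la)%E.-integrable setT (fun p => (w k p.2 * h (tau p.2 p.1))%:E) /\
  \int[(M \x la)%E]_p (w k p.2 * h (tau p.2 p.1)) = \int[M]_y h y.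
Proof.
move=> h0 hi; have mh : measurable_fun setT h by exact/measurable_EFinP/(measurable_int _ hi).
have mf : measurable_fun setT (fun p : Y * Q => (w k p.2 * h (tau p.2 p.1))%:E).
  by apply/measurable_EFinP; apply: measurable_funM => //; exact: mH.
have inner q : (\int[M]_y (w k q * h (tau q y))%:E = (w k q)%:E * \int[M]_y (h y)%:E)%E.
  under eq_integral => y _ do rewrite EFinM.
  rewrite ge0_integralZl//; last by rewrite lee_fin.
  - congr (_ * _)%E; apply: (@ge0_integral_transports _ _ _ _ _ M M (tau q) (EFin \o h)) => //.
    exact/measurable_EFinP.
  - by apply/measurable_EFinP; apply: measurableT_comp => //; case: (ptau q).
  - by move=> y _; rewrite lee_fin.
have tot : (\int[(M \x la)%E]_p (w k p.2 * h (tau p.2 p.1))%:E = \int[M]_y (h y)%:E)%E.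
  rewrite (fubini_tonelli2 (fun p => (w k p.2 * h (tau p.2 p.1))%:E))//; last first.
    by move=> p; rewrite lee_fin mulr_ge0.
  under eq_integral => q _ do rewrite /fubini_G /= inner.
  rewrite ge0_integralZr//; [by rewrite w1 mul1e|exact/measurable_EFinP| |].
    by move=> q _; rewrite lee_fin.
  by apply: integral_ge0 => y _; rewrite lee_fin.
split; last by rewrite /Rintegral tot.
apply/integrableP; split => //.
under eq_integral => p _ do rewrite gee0_abs ?lee_fin ?mulr_ge0//.
rewrite tot; have /integrableP[_] := hi.
by under eq_integral => y _ do rewrite gee0_abs ?lee_fin//.
Qed.

Lemma mollified_pairing_integrable k W H : L2 W -> L2 H ->
  (M \x la)%E.-integrable setT (fun p => (w k p.2 * (W p.1 * H (tau p.2 p.1)))%:E).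
Proof.
move=> LW LH.
have [i1 _] := weighted_l k (fun y => sqr_ge0 (W y)) (L2_sqr_integrable LW).
have [i2 _] := weighted_r k (fun y => sqr_ge0 (H y)) (L2_sqr_integrable LH).
have := integrableD measurableT i1 i2; apply: le_integrable => //.
  apply/measurable_EFinP; apply: measurable_funM => //; apply: measurable_funM.
    by apply: mW; case: LW.
  by apply: mH; case: LH.
move=> [y q] _; rewrite /= lee_fin normrM (ger0_norm (w0 _ _)) -mulrDr [leRHS]ger0_norm; last first.
  by rewrite mulr_ge0 ?addr_ge0 ?sqr_ge0//.
rewrite ler_wpM2l// ler_norml; apply/andP; split; nra.
Qed.

Lemma mollified_pairing_le k W H e : 0 < e -> L2 W -> L2 H ->
  `|mollified_pairing k W H| <= e * sqn M W + e^-1 * sqn M H.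
Proof.
move=> e0 LW LH.
have [i1 E1] := weighted_l k (fun y => sqr_ge0 (W y)) (L2_sqr_integrable LW).
have [i2 E2] := weighted_r k (fun y => sqr_ge0 (H y)) (L2_sqr_integrable LH).
have ip := mollified_pairing_integrable k LW LH.
rewrite /sqn -E1 -E2 (le_trans (le_normr_Rintegral _ ip))//.
have j1 := integrableZl measurableT e i1; have j2 := integrableZl measurableT e^-1 i2.
rewrite -!RintegralZl// -RintegralD//; apply: le_Rintegral => //.
- exact: integrable_abse ip.
- by have := integrableD measurableT j1 j2; apply: eq_integrable.
move=> [y q] _ /=; rewrite normrM (ger0_norm (w0 _ _)) mulrCA (mulrCA e^-1) -mulrDr ler_wpM2l//.
have [z ->] : exists z, H (tau q y) = e * z.
  by exists (e^-1 * H (tau q y)); rewrite mulrA divff ?gt_eqF// mul1r.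
have -> : e^-1 * (e * z) ^+ 2 = e * z ^+ 2.
  by rewrite exprMn (expr2 e) !mulrA mulVf ?gt_eqF// mul1r.
have h1 : 0 <= e * (W y - z) ^+ 2 by rewrite mulr_ge0 ?sqr_ge0// ltW.
have h2 : 0 <= e * (W y + z) ^+ 2 by rewrite mulr_ge0 ?sqr_ge0// ltW.
have h3 : 0 <= e * W y ^+ 2 by rewrite mulr_ge0 ?sqr_ge0// ltW.
have h4 : 0 <= e * z ^+ 2 by rewrite mulr_ge0 ?sqr_ge0// ltW.
by rewrite ler_norml; apply/andP; split; lra.
Qed.

Let measurable_mollified_arg k H : measurable_fun setT H ->
  measurable_fun setT (fun p : Y * Q => w k p.2 * H (tau p.2 p.1)).
Proof. by move=> mh; apply: measurable_funM => //; exact: mH. Qed.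

Lemma measurable_mollified k H : measurable_fun setT H -> measurable_fun setT (mollified k H).
Proof.
move=> mh; exact: (@measurable_Rintegral_param _ _ _ _ _ la (fun p => w k p.2 * H (tau p.2 p.1))
  (measurable_mollified_arg k mh)).
Qed.

Lemma mollified_pairingE k W H : L2 W -> L2 H ->
  mollified_pairing k W H = \int[M]_y (W y * mollified k H y).
Proof.
move=> LW LH; have ip := mollified_pairing_integrable k LW LH.
rewrite /mollified_pairing (Rintegral_fubini12 ip).
have [mW' _] := LW; have [mH' _] := LH.
apply: ae_eq_Rintegral.
- apply: (@measurable_Rintegral_param _ _ _ _ _ la (fun p => w k p.2 * (W p.1 * H (tau p.2 p.1)))).
  by apply: measurable_funM => //; apply: measurable_funM; [exact: mW|exact: mH].
- by apply: measurable_funM => //; exact: measurable_mollified.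
have := ae_integrable1 ip; apply: filterS => y iy _.
(* Only the product with [W y] is known to be integrable in [q]. Where [W y] vanishes both sides are
   0; elsewhere one divides by it. *)
have [W0|W0] := eqVneq (W y) 0.
  rewrite W0 mul0r; under eq_Rintegral => q _ do rewrite /= ?W0 mul0r mulr0.
  by rewrite Rintegral_cst// mul0r.
have iwH : la.-integrable setT (EFin \o (fun q => w k q * H (tau q y))).
  have := integrableZl measurableT (W y)^-1 iy; apply: eq_integrable => // q _ /=.
  by rewrite -EFinM; congr (_%:E); rewrite mulrCA (mulrA (W y)^-1) mulVf// mul1r.
rewrite -RintegralZl//; apply: eq_Rintegral => q _ /=; ring.
Qed.

Let mollified_indic_cvg A y : G A -> mollified k \1_A y @[k --> \oo] --> (\1_A y : R).
Proof.
move=> GA; apply: cvg_near_cst; have := G_right_cont GA y; apply: filterS => k Ak.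
rewrite /mollified -[RHS]mul1r.
have <- : \int[la]_q (w k q) = 1 by rewrite /Rintegral w1.
rewrite -RintegralZr//; last first.
  apply/integrableP; split; first exact/measurable_EFinP.
  by under eq_integral => q _ do rewrite gee0_abs ?lee_fin//; rewrite w1 ltry.
apply: eq_Rintegral => q _; have [->|wq] := eqVneq (w k q) 0; first by rewrite !mul0r.
have [A1 A2] := Ak q wq; rewrite !indicE; congr (_ * (nat_of_bool _)%:R).
by apply/idP/idP; rewrite !inE.
Qed.

Let mollified_indic_bound k A A' y : measurable A ->
  (forall k q y, w k q != 0 -> A (tau q y) -> A' y) ->
  `|mollified k \1_A y| <= `|\1_A' y| :> R.
Proof.
move=> mA AA'.
have iw : la.-integrable setT (EFin \o w k).
  apply/integrableP; split; first exact/measurable_EFinP.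
  by under eq_integral => q _ do rewrite gee0_abs ?lee_fin//; rewrite w1 ltry.
have pt q : 0 <= w k q * \1_A (tau q y) <= w k q * \1_A' y.
  rewrite mulr_ge0//=; have [->|wq] := eqVneq (w k q) 0; first by rewrite !mul0r.
  rewrite ler_wpM2l// !indicE ler_nat.
  by case: (boolP (tau q y \in A)) => //; rewrite inE => /(AA' k q y wq) /mem_set ->.
rewrite !ger0_norm//; last by apply: Rintegral_ge0 => q _; case/andP: (pt q).
have := RintegralZr (\1_A' y) measurableT iw.
have -> : \int[la]_q (w k q) = 1 by rewrite /Rintegral w1.
rewrite mul1r => <-; apply: le_Rintegral => //.
- have := integrableZr measurableT (\1_A' y) iw; apply: le_integrable => //.
    apply/measurable_EFinP.
    have ms : measurable_fun setT (fun q : Q => tau q y).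
      rewrite (_ : (fun q => _) = (fun p : Y * Q => tau p.2 p.1) \o (pair y))//.
      exact: (measurableT_comp mtau (pair1_measurable y)).
    by apply: measurable_funM => //; apply: measurableT_comp => //; exact: measurable_indic.
  move=> q _; have /andP[p1 p2] := pt q.
  by rewrite /= !lee_fin !ger0_norm// (le_trans p1).
- exact: (integrableZr measurableT (\1_A' y) iw).
- by move=> q _; case/andP: (pt q).
Qed.

Lemma mollified_pairing_cvg W H : L2 W -> L2 H ->
  mollified_pairing k W H @[k --> \oo] --> \int[M]_y (W y * H y).
Proof.
move=> LW LH; pose l k H := mollified_pairing k W H - \int[M]_y (W y * H y).
suff : l k H @[k --> \oo] --> (0 : R).
  move=> l0; have -> : (fun k => mollified_pairing k W H) = (fun k => l k H + \int[M]_y (W y * H y)).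
    by apply/funext => k; rewrite /l subrK.
  by rewrite -[\int[M]_y (W y * H y) in X in _ --> X]add0r; apply: cvgD l0 _; exact: cvg_cst.
(* The functional is a difference of two pairings. Each is estimated with weight [2 * e]: the terms
   in [W] add up to [4 * e] times its squared norm, those in the argument to [e^-1] times its
   own. *)
apply: (L2_density GY GI Gfin GE E_cover (C := 4 * sqn M W)) LH => //.
- move=> k f g Lf Lg; rewrite /l /mollified_pairing.
  under eq_Rintegral => p _ do rewrite 2!mulrDr.
  under [X in _ - X]eq_Rintegral => p _ do rewrite mulrDr.
  rewrite !RintegralD//; [|exact: L2_mul_integrable..|exact: mollified_pairing_integrable|exact: mollified_pairing_integrable].
  by rewrite opprD addrACA.
- move=> k c f Lf; rewrite /l /mollified_pairing.
  under eq_Rintegral => p _ do rewrite (mulrCA _ c) (mulrCA _ c).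
  under [X in _ - X]eq_Rintegral => p _ do rewrite mulrCA.
  by rewrite !RintegralZl ?mulrBr//; [exact: L2_mul_integrable|exact: mollified_pairing_integrable].
- move=> k e f e0 Lf; rewrite /l (le_trans (ler_normB _ _))//.
  have e20 : 0 < 2 * e by rewrite mulr_gt0.
  have h1 := mollified_pairing_le k e20 LW Lf; have h2 := L2_mul_le e20 LW Lf.
  rewrite invfM in h1 h2; lra.
- move=> A GA; have mA : measurable A by rewrite GY; exact: sub_sigma_algebra.
  have [A' [mA' A'fin AA']] := G_enlarged GA.
  have LA : L2 \1_A by apply: L2_indic => //; exact: Gfin.
  have LA' : L2 \1_A' by exact: L2_indic.
  have mI : measurable_fun setT (\1_A : Y -> R) by exact: measurable_indic.
  rewrite -(subrr (\int[M]_y (W y * \1_A y))); apply: cvgB; last exact: cvg_cst.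
  under eq_fun do rewrite mollified_pairingE//.
  have [mW' _] := LW.
  apply: (Rdominated_cvg _ _ _ (integrable_abse (L2_mul_integrable LW LA'))).
  + by move=> k; apply: measurable_funM => //; exact: measurable_mollified.
  + exact: measurable_funM.
  + by move=> y; apply: cvgM; [exact: cvg_cst|exact: mollified_indic_cvg].
  + by move=> k y /=; rewrite !normrM ler_wpM2l//; exact: mollified_indic_bound.
Qed.

End mollification.

Lemma integrable_indic_fin d (T : measurableType d) (R : realType) (M : {measure set T -> \bar R})
  (A : set T) : measurable A -> (M A < +oo)%E -> M.-integrable setT (EFin \o \1_A).
Proof.
move=> mA fA; apply/integrableP; split; first by apply/measurable_EFinP; exact: measurable_indic.
under eq_integral => x _ do rewrite /= ger0_norm//.
by rewrite integral_indic// setIT.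
Qed.

(** * Normalised bumps as mollifiers *)

Section mollifier.
Variables (R : realType) (N : nat) (lam : {sigma_finite_measure set 'rV[R]_N -> \bar R}).
Hypothesis lamE : lam = lebesgue_rV R N :> {measure set 'rV[R]_N -> \bar R}.
Local Notation RN := 'rV[R]_N.
Local Notation mR := (measurableTypeR R).
Local Notation V := (RN * mR)%type.
Local Notation lamV := (lam \x (@lebesgue_measure R))%E.

Let lamA A : lam A = lebesgue_rV R N A.
Proof. by move: lamE => /(congr1 (fun m : {measure set RN -> \bar R} => m A)). Qed.

Lemma measurable_bump e : measurable_fun setT (bump e : V -> R).
Proof. by apply: continuous_measurable_spacetime; apply: smooth_continuous; exact: smooth_bump. Qed.

Let box (e : R) : set V := [set v : RN | forall i, e / 2 < v ord0 i < e] `*` `]e / 2, e[%classic.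

Let measurable_boxV e : measurable (box e).
Proof. by apply: measurableX; [exact: measurable_open_box|exact: measurable_itv]. Qed.

Let lamV_box e : 0 < e -> (0 < lamV (box e) < +oo)%E.
Proof.
move=> e0.
have l1 : @lebesgue_measure R `]e / 2, e[%classic = (e / 2)%:E.
  rewrite lebesgue_measure_itv /= lte_fin ltr_pdivrMr// ltr_pMr// ltr1n -EFinB.
  by congr (_%:E); lra.
have -> : (lamV (box e) = lam [set v : RN | forall i, (e / 2 < v ord0 i < e)%R] * (e / 2)%:E)%E.
  rewrite [LHS]product_measure1E//; last exact: measurable_open_box.
  by congr (_ * _)%E; exact: l1.
rewrite lamA; apply/andP; split.
  by rewrite mule_gt0 ?lte_fin ?divr_gt0//; exact: lebesgue_open_box_gt0.
apply: lte_mul_pinfty; rewrite ?ltry//.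
have [k ek] : exists k : nat, e < k%:R by exists (Num.truncn e).+1; rewrite truncnS_gt.
have fn : (lebesgue_rV R N [set v | forall i, (e / 2 < v ord0 i < e)%R] < +oo)%E.
  apply: le_lt_trans (lebesgue_cube_fin R N k); apply: le_measure.
  - by rewrite inE; exact: measurable_open_box.
  - by rewrite inE; exact: measurable_cube.
  - by move=> v /= H i; have /andP[h1 h2] := H i; apply/andP; split; lra.
by rewrite ge0_fin_numE.
Qed.

Let bumpE e (p : V) : bump e p != 0 -> box e p.
Proof. by move=> /bump_neq0[p2 p1]; split=> //=; rewrite in_itv. Qed.

Lemma bump_integrable e : 0 < e -> lamV.-integrable setT (fun p => (bump e p)%:E).
Proof.
move=> e0; have [C C0 HC] := smooth_cc_bounded (@smooth_cc_bump R N e).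
have /andP[_ bfin] := lamV_box e0.
have bi : lamV.-integrable setT (fun p => C%:E * (\1_(box e) p)%:E)%E.
  have ib : lamV.-integrable setT (EFin \o \1_(box e)) by apply: integrable_indic_fin.
  exact: (integrableZl measurableT C ib).
apply: le_integrable bi => //; first by apply/measurable_EFinP; exact: measurable_bump.
move=> p _; rewrite -EFinM !abse_EFin lee_fin indicE.
have [->|pb] := eqVneq (bump e p) 0; first by rewrite normr0.
by rewrite mem_set ?mulr1; [rewrite (le_trans (HC p))// ler_norm|exact: bumpE].
Qed.

Definition bump_mass e : R := \int[lamV]_p bump e p.

(** Mass zero would force [bump e] to vanish almost everywhere, but it is positive on a box of
    positive measure. *)
Lemma bump_mass_gt0 e : 0 < e -> 0 < bump_mass e.
Proof.
move=> e0; have bi := bump_integrable e0.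
have b0 : 0 <= bump_mass e by apply: Rintegral_ge0 => p _; exact: bump_ge0.
rewrite lt0r b0 andbT; apply/eqP => b1.
have : (\int[lamV]_p `|(bump e p)%:E| = 0)%E.
  under eq_integral => p _ do rewrite gee0_abs ?lee_fin ?bump_ge0//.
  have <- : (bump_mass e)%:E = 0%E by rewrite b1.
  by rewrite /bump_mass /Rintegral fineK//; exact: integrable_fin_num.
have mE : measurable_fun setT (fun p : V => (bump e p)%:E).
  by apply/measurable_EFinP; exact: measurable_bump.
move=> /(ae_eq_integral_abs _ measurableT mE) [A [mA A0 bA]].
have /andP[bx _] := lamV_box e0.
have : (lamV (box e) <= lamV A)%E.
  apply: le_measure; rewrite ?inE//.
  move=> p [/= p1 p2]; apply: bA => /(_ I) [] b0'.
  have : 0 < bump e p by apply: bump_gt0 => //; move: p2; rewrite in_itv.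
  by rewrite b0' ltxx.
by rewrite A0 leNgt bx.
Qed.

Definition mollifier (k : nat) (p : V) : R := (bump_mass k.+1%:R^-1)^-1 * bump k.+1%:R^-1 p.

Let k0 (k : nat) : 0 < k.+1%:R^-1 :> R. Proof. by rewrite invr_gt0. Qed.

Lemma mollifier_ge0 k p : 0 <= mollifier k p.
Proof. by rewrite mulr_ge0 ?bump_ge0// invr_ge0 ltW// bump_mass_gt0. Qed.

Lemma measurable_mollifier k : measurable_fun setT (mollifier k).
Proof. by apply: measurable_funM => //; exact: measurable_bump. Qed.

Lemma mollifier_mass k : (\int[lamV]_p (mollifier k p)%:E = 1)%E.
Proof.
have bi := bump_integrable (k0 k).
rewrite /mollifier; under eq_integral => p _ do rewrite EFinM.
rewrite integralZl//.
have -> : (\int[lamV]_p (bump k.+1%:R^-1 p)%:E = (bump_mass k.+1%:R^-1)%:E)%E.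
  by rewrite /bump_mass /Rintegral fineK//; exact: integrable_fin_num.
by rewrite -EFinM mulVf// gt_eqF// bump_mass_gt0.
Qed.

Lemma mollifier_neq0 k p : mollifier k p != 0 ->
  0 < p.2 < k.+1%:R^-1 /\ forall i, 0 < p.1 ord0 i < k.+1%:R^-1.
Proof.
rewrite mulf_eq0 negb_or => /andP[_ /bump_neq0[/andP[a b] H]].
have h : 0 < k.+1%:R^-1 / 2 :> R by rewrite divr_gt0.
split; first by rewrite b (lt_trans h).
by move=> i; have /andP[c ->] := H i; rewrite (lt_trans h).
Qed.

End mollifier.

(** * Spaces and shifts for which mollification converges *)

Section admissible.
Variables (R : realType) (d : measure_display) (Q : measurableType d) (w : nat -> Q -> R).

Definition generating d1 (Y : measurableType d1) (M : {measure set Y -> \bar R})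
    (G : set (set Y)) (E : nat -> set Y) :=
  [/\ @measurable d1 Y = <<s G >>, setI_closed G,
      forall A, G A -> (M A < +oo)%E, forall j, G (E j) & \bigcup_j E j = setT].

(* Only shifts by [q] in the support of the weights matter: the indicators of the sets
   of [G] are eventually constant along them, and stay below a common integrable one. *)
Definition small_shift d1 (Y : measurableType d1) (M : {measure set Y -> \bar R})
    (act : Q -> Y -> Y) (G : set (set Y)) :=
  (forall A, G A -> forall y, \forall k \near \oo, forall q, w k q != 0 -> (A (act q y) <-> A y)) /\
  (forall A, G A -> exists A', [/\ measurable A', (M A' < +oo)%E &
    forall k q y, w k q != 0 -> A (act q y) -> A' y]).

Definition admissible d1 (Y : measurableType d1) (M : {measure set Y -> \bar R}) (act : Q -> Y -> Y) :=
  [/\ measurable_fun setT (fun p : Y * Q => act p.2 p.1), forall q, preserves M (act q) &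
   exists G E, generating M G E /\ small_shift M act G].

(** The exhaustions [E1] and [E2] are needed because a cylinder over [A] need not be a rectangle of
    the generating family; it is the countable union of the rectangles with sides [A] and [E2 j]. *)
Lemma g_sigma_prod d1 d2 (T1 : measurableType d1) (T2 : measurableType d2)
    (G1 : set (set T1)) (G2 : set (set T2)) (E1 : nat -> set T1) (E2 : nat -> set T2) :
  @measurable d1 T1 = <<s G1 >> -> @measurable d2 T2 = <<s G2 >> ->
  (forall j, G1 (E1 j)) -> (forall j, G2 (E2 j)) ->
  \bigcup_j E1 j = setT -> \bigcup_j E2 j = setT ->
  @measurable _ (T1 * T2)%type = <<s [set A `*` B | A in G1 & B in G2] >>.
Proof.
move=> m1 m2 GE1 GE2 c1 c2; set G := [set A `*` B | A in G1 & B in G2].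
apply/seteqP; split; last first.
  apply: smallest_sub; first exact: sigma_algebra_measurable.
  move=> _ [A GA [B GB <-]]; apply: measurableX.
    by rewrite m1; exact: sub_sigma_algebra.
  by rewrite m2; exact: sub_sigma_algebra.
pose T : measurableType _ := g_sigma_algebraType G.
have f1 : measurable_fun setT (fst : T -> T1).
  apply: (measurability _ m1) => _ [A GA <-]; rewrite setTI.
  have -> : (fst : T -> T1) @^-1` A = \bigcup_j (A `*` E2 j).
    by rewrite -setX_bigcupr c2; apply/seteqP; split => [[a b] //|[a b] []].
  apply: bigcupT_measurable => j; apply: sub_sigma_algebra; exists A => //; exists (E2 j) => //.
have f2 : measurable_fun setT (snd : T -> T2).
  apply: (measurability _ m2) => _ [B GB <-]; rewrite setTI.
  have -> : (snd : T -> T2) @^-1` B = \bigcup_j (E1 j `*` B).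
    by rewrite -setX_bigcupl c1; apply/seteqP; split => [[a b] //|[a b] []].
  apply: bigcupT_measurable => j; apply: sub_sigma_algebra; exists (E1 j) => //; exists B => //.
have f12 : measurable_fun setT (fun x : T => (fst x, snd x) : T1 * T2) by exact: measurable_fun_pair.
move=> A mA; have := f12 measurableT A mA; rewrite setTI.
by congr (_ _); apply/seteqP; split => -[].
Qed.

Lemma admissible_prod d1 d2 (T1 : measurableType d1) (T2 : measurableType d2)
    (M1 : {sigma_finite_measure set T1 -> \bar R}) (M2 : {sigma_finite_measure set T2 -> \bar R})
    (a1 : Q -> T1 -> T1) (a2 : Q -> T2 -> T2) :
  admissible M1 a1 -> admissible M2 a2 ->
  admissible (M1 \x M2)%E (fun q y => (a1 q y.1, a2 q y.2)).
Proof.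
move=> [ma1 p1 [G1 [E1 [[g1 I1 f1 e1 c1] [r1 n1]]]]] [ma2 p2 [G2 [E2 [[g2 I2 f2 e2 c2] [r2 n2]]]]].
have mG1 A : G1 A -> measurable A by move=> ?; rewrite g1; exact: sub_sigma_algebra.
have mG2 A : G2 A -> measurable A by move=> ?; rewrite g2; exact: sub_sigma_algebra.
split.
- apply: measurable_fun_pair.
    apply: (measurableT_comp ma1 (measurable_fun_pair (measurableT_comp measurable_fst measurable_fst) measurable_snd)).
  apply: (measurableT_comp ma2 (measurable_fun_pair (measurableT_comp measurable_snd measurable_fst) measurable_snd)).
- by move=> q; apply: preserves_prod.
exists [set A `*` B | A in G1 & B in G2].
(* Pairs of indices are enumerated by [pickle]; a number that codes no pair gets the harmless
   default with both indices 0. *)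
exists (fun n => if unpickle n is Some ij then E1 ij.1 `*` E2 ij.2 else E1 0%N `*` E2 0%N).
split.
  split.
  - exact: (g_sigma_prod g1 g2 e1 e2 c1 c2).
  - move=> _ _ [A GA [B GB <-]] [A' GA' [B' GB' <-]].
    by rewrite -setXI; exists (A `&` A'); [exact: I1|exists (B `&` B') => //; exact: I2].
  - move=> _ [A GA [B GB <-]].
    rewrite [X in (X < _)%E](product_measure1E _ _ (mG1 _ GA) (mG2 _ GB)).
    apply: lte_mul_pinfty => //; last exact: f2.
    by rewrite ge0_fin_numE//; exact: f1.
  - move=> j; case: unpickle => [[i k]|]; [exists (E1 i) => //; exists (E2 k) => //|].
    by exists (E1 0%N) => //; exists (E2 0%N).
  - apply/seteqP; split => // -[x y] _.
    have [i _ xi] : (\bigcup_j E1 j) x by rewrite c1.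
    have [j _ yj] : (\bigcup_j E2 j) y by rewrite c2.
    by exists (pickle (i, j)) => //; rewrite pickleK.
split.
- move=> _ [A GA [B GB <-]] [x y].
  have := r1 A GA x; have := r2 B GB y; apply: filterS2 => k h2 h1 q wq.
  by have [h11 h12] := h1 q wq; have [h21 h22] := h2 q wq; split => -[/= xA yB]; split; auto.
- move=> _ [A GA [B GB <-]].
  have [A' [mA' fA' hA']] := n1 A GA; have [B' [mB' fB' hB']] := n2 B GB.
  exists (A' `*` B'); split.
  + exact: measurableX.
  + rewrite [X in (X < _)%E]product_measure1E//; apply: lte_mul_pinfty => //.
    by rewrite ge0_fin_numE.
  + by move=> k q [x y] wq [/= xA yB]; split; [exact: (hA' k q)|exact: (hB' k q)].
Qed.

(** For the variable [z], which is not shifted. The pi-system consists of all sets of finite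
    measure, and sigma-finiteness provides the exhaustion. *)
Lemma admissible_id d1 (Y : measurableType d1) (M : {sigma_finite_measure set Y -> \bar R}) :
  admissible M (fun q y => y).
Proof.
have /sigma_finiteP[F [cF _ fF]] := sigma_finiteT M.
split.
- exact: measurable_fst.
- by move=> q; split => // ; exact: measurable_id.
exists [set A | measurable A /\ (M A < +oo)%E], F; split.
  split.
  - apply/seteqP; split; last by apply: smallest_sub; [exact: sigma_algebra_measurable|move=> A []].
    move=> A mA; have -> : A = \bigcup_j (A `&` F j) by rewrite -setI_bigcupr -cF setIT.
    apply: sigma_algebra_bigcup => j; apply: sub_sigma_algebra.
    have [mF fFj] := fF j; split; first exact: measurableI.
    by apply: le_lt_trans fFj; apply: le_measure; rewrite ?inE//; exact: measurableI.
  - move=> A B [mA fA] [mB fB]; split; first exact: measurableI.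
    by apply: le_lt_trans fA; apply: le_measure; rewrite ?inE//; exact: measurableI.
  - by move=> A [].
  - by move=> j; exact: fF.
  - by rewrite -cF.
split.
- by move=> A _ y; apply/nearW => k q _.
- by move=> A [mA fA]; exists A; split.
Qed.

End admissible.

Section admissible_shifts.
Variables (R : realType) (N : nat).
Local Notation RN := 'rV[R]_N.
Local Notation mR := (measurableTypeR R).
Local Notation V := (RN * mR)%type.
Variable w : nat -> V -> R.
Hypothesis w_supp : forall k p, w k p != 0 ->
  0 < p.2 < k.+1%:R^-1 /\ forall i, 0 < p.1 ord0 i < k.+1%:R^-1.

Let small_k (e : R) : 0 < e -> \forall k \near \oo, k.+1%:R^-1 <= e.
Proof. by move=> e0; near=> k; apply: ltW; near: k; exact: near_infty_natSinv_lt (PosNum e0). Unshelve. all: by end_near. Qed.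

(** The included end [a] and the excluded end [b] match positive shifts: [a <= y] survives every
    shift to the right, while [y < a] and [y < b] survive small ones. *)
Let right_cont (a b y : R) : exists2 e, 0 < e & forall s, 0 < s < e -> (a <= y + s < b) = (a <= y < b).
Proof.
have [ya|ay] := ltP y a.
  exists (a - y); rewrite ?subr_gt0// => s /andP[s0 se]; apply/negbTE; rewrite negb_and -ltNge.
  by apply/orP; left; lra.
have [yb|by'] := ltP y b.
  exists (b - y); rewrite ?subr_gt0// => s /andP[s0 se]; apply/andP; split; lra.
exists 1 => // s /andP[s0 _]; apply/negbTE; rewrite negb_and -!leNgt.
by apply/orP; right; lra.
Qed.

Let enlarge (a b y s c : R) : 0 < s -> s < c -> c <= 1 -> a <= y + s < b -> a - 1 <= y < b.
Proof. by move=> s0 sc c1 /andP[h1 h2]; apply/andP; split; lra. Qed.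

Let leb_fin (a b : R) : (@lebesgue_measure R `[a, b[%classic < +oo)%E.
Proof. by rewrite lebesgue_measure_itv /=; case: ifP => _; rewrite ?ltry. Qed.

Lemma admissible_time : admissible w (@lebesgue_measure R) (fun q (t : mR) => t + q.2 : mR).
Proof.
split.
- by apply: measurable_funD => //; apply: measurableT_comp.
- by move=> q; exact: preserves_lebesgue_shift.
pose G := [set X | exists a b : R, X = `[a, b[%classic].
exists G, (fun j => `[- j%:R, j%:R[%classic); split.
  split.
  - apply/seteqP; split; last first.
      apply: smallest_sub; first exact: sigma_algebra_measurable.
      by move=> _ [a [b ->]]; exact: measurable_itv.
    rewrite RGenCInfty.measurableE.
    apply: smallest_sub; first exact: smallest_sigma_algebra.
    move=> _ [a ->].
    have -> : `[a, +oo[%classic = \bigcup_(j : nat) `[a, j%:R[%classic.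
      apply/seteqP; split => x /=; rewrite ?in_itv /= ?andbT.
        by move=> ax; exists (Num.truncn x).+1 => //=; rewrite in_itv /= ax truncnS_gt.
      by move=> [j _]; rewrite /= in_itv /= => /andP[].
    apply: sigma_algebra_bigcup => j; apply: sub_sigma_algebra; by exists a, j%:R.
  - move=> _ _ [a [b ->]] [c [e ->]]; exists (Num.max a c), (Num.min b e).
    apply/seteqP; split => x /=; rewrite !in_itv /= ge_max lt_min.
      by move=> [/andP[-> ->] /andP[-> ->]].
    by move=> /andP[/andP[-> ->] /andP[-> ->]].
  - by move=> _ [a [b ->]]; exact: leb_fin.
  - by move=> j; exists (- j%:R), j%:R.
  - apply/seteqP; split => // x _; exists (Num.truncn `|x|).+1 => //=.
    rewrite in_itv /= -[- _]opprK.
    have := truncnS_gt `|x|; rewrite ltr_norml => /andP[h ->]; rewrite opprK andbT; exact: ltW.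
split.
- move=> _ [a [b ->]] y; have [e e0 H] := right_cont a b y.
  have := small_k e0; apply: filterS => k ke q /w_supp[/andP[q0 qk] _].
  by rewrite /= !in_itv /= H// q0 (lt_le_trans qk).
- move=> _ [a [b ->]]; exists `[a - 1, b[%classic; split.
  + exact: measurable_itv.
  + exact: leb_fin.
  + move=> k q y /w_supp[/andP[q0 qk] _] /=; rewrite !in_itv /=.
    have k1 : k.+1%:R^-1 <= 1 :> R by rewrite invf_le1// ler1n.
    exact: (enlarge q0 qk k1).
Qed.

Definition hobox (a b : RN) : set RN := [set v | forall i, a ord0 i <= v ord0 i < b ord0 i].

Lemma measurable_hobox a b : measurable (hobox a b).
Proof.
rewrite (_ : hobox a b = \bigcap_(i in [set: 'I_N])
        ((fun v : RN => v ord0 i) @^-1` `[a ord0 i, b ord0 i[)).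
  apply: fin_bigcap_measurable => // i _; rewrite -[X in measurable X]setTI.
  exact: measurable_coord.
apply/seteqP; split => [v Av i _|v Av i]; first by have := Av i; rewrite /= in_itv.
by have := Av i I; rewrite /= in_itv.
Qed.

Lemma hobox_fin a b : (lebesgue_rV R N (hobox a b) < +oo)%E.
Proof.
have [k hk] : exists k : nat, `|a| + `|b| < k%:R by exists (Num.truncn (`|a| + `|b|)).+1; rewrite truncnS_gt.
apply: le_lt_trans (lebesgue_cube_fin R N k); apply: le_measure.
- by rewrite inE; exact: measurable_hobox.
- by rewrite inE; exact: measurable_cube.
- move=> v /= H i; have /andP[h1 h2] := H i.
  have := rV_coord_le a i; have := rV_coord_le b i; rewrite !ler_norml => /andP[b1 b2] /andP[a1 a2].
  have := normr_ge0 a; have := normr_ge0 b => b0 a0.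
  by apply/andP; split; lra.
Qed.

Lemma admissible_space (lam : {sigma_finite_measure set RN -> \bar R}) :
  lam = lebesgue_rV R N :> {measure set RN -> \bar R} ->
  admissible w lam (fun q (x : RN) => x + q.1).
Proof.
move=> lamE.
have lamA A : (lam : {measure set RN -> \bar R}) A = lebesgue_rV R N A by rewrite lamE.
split.
- apply: measurable_addrV; first exact: measurable_fst.
  by apply: measurableT_comp; [exact: measurable_fst|exact: measurable_snd].
- move=> q; have [m p] := preserves_lebesgue_rV q.1.
  by split => // A mA; rewrite !lamA; exact: p.
pose G := [set X | exists a b : RN, X = hobox a b].
exists G, (fun j => hobox (const_mx (- j%:R)) (const_mx j%:R)); split.
  split.
  - apply/seteqP; split; last first.
      apply: smallest_sub; first exact: sigma_algebra_measurable.
      by move=> _ [a [b ->]]; exact: measurable_hobox.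
    pose T : measurableType _ := g_sigma_algebraType G.
    (* To see that boxes generate the Borel sets, it is enough that the identity from the space with
       the generated sigma-algebra is measurable, and this is checked coordinate by coordinate. *)
    have mid : measurable_fun setT (id : T -> RN).
      apply: measurable_fun_rV => i.
      apply: (measurability _ (RGenCInfty.measurableE R)) => _ [_ [a ->] <-]; rewrite setTI.
      (* A half-space is the union of boxes whose lower corner is [a] in coordinate [i] and [- j] in
         the others. *)
      have -> : (fun t : T => (t : RN) ord0 i) @^-1` `[a, +oo[ = \bigcup_(j : nat)
          hobox (\row_l (if l == i then a else - j%:R)) (const_mx j%:R).
        apply/seteqP; split => x /=; rewrite ?in_itv /= ?andbT.
          move=> ax; exists (Num.truncn `|x : RN|).+1 => //= l; rewrite !mxE.
          have := le_lt_trans (rV_coord_le (x : RN) l) (truncnS_gt `|x : RN|).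
          by rewrite ltr_norml => /andP[h ->]; rewrite andbT; case: eqVneq => [->//|_]; exact: ltW.
        by move=> [j _] /(_ i); rewrite !mxE eqxx => /andP[].
      apply: bigcupT_measurable => j; apply: sub_sigma_algebra.
      by exists (\row_l (if l == i then a else - j%:R)), (const_mx j%:R).
    move=> A mA; have := mid measurableT A mA; rewrite setTI.
    by congr (_ _); apply/seteqP; split.
  - move=> _ _ [a [b ->]] [c [e ->]].
    exists (\row_i Num.max (a ord0 i) (c ord0 i)), (\row_i Num.min (b ord0 i) (e ord0 i)).
    apply/seteqP; split => x /=.
      by move=> [H1 H2] i; have := H1 i; have := H2 i; rewrite !mxE ge_max lt_min => /andP[-> ->] /andP[-> ->].
    by move=> H; split => i; have := H i; rewrite !mxE ge_max lt_min => /andP[/andP[h1 h2] /andP[h3 h4]]; apply/andP.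
  - by move=> _ [a [b ->]]; rewrite lamA; exact: hobox_fin.
  - by move=> j; exists (const_mx (- j%:R)), (const_mx j%:R).
  - apply/seteqP; split => // x _; exists (Num.truncn `|x|).+1 => //= l; rewrite !mxE.
    have := le_lt_trans (rV_coord_le x l) (truncnS_gt `|x|).
    by rewrite ltr_norml => /andP[h ->]; rewrite andbT; exact: ltW.
split.
- move=> _ [a [b ->]] y.
  have /choice[e He] i : exists e, 0 < e /\ forall s, 0 < s < e ->
      (a ord0 i <= y ord0 i + s < b ord0 i) = (a ord0 i <= y ord0 i < b ord0 i).
    by have [e e0 H] := right_cont (a ord0 i) (b ord0 i) (y ord0 i); exists e.
  have : \forall k \near \oo, forall i, k.+1%:R^-1 <= e i.
    apply: filter_forall => i; apply: small_k; exact: (He i).1.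
  apply: filterS => k ke q /w_supp[_ q1].
  have E i : (a ord0 i <= (y + q.1) ord0 i < b ord0 i) = (a ord0 i <= y ord0 i < b ord0 i).
    by rewrite mxE (He i).2//; have /andP[-> h] := q1 i; rewrite (lt_le_trans h).
  by split=> H i; have := H i; rewrite E.
- move=> _ [a [b ->]]; exists (hobox (\row_i (a ord0 i - 1)) b); split.
  + exact: measurable_hobox.
  + by rewrite lamA; exact: hobox_fin.
  + move=> k q y /w_supp[_ q1] H i; have := H i; rewrite !mxE.
    have k1 : k.+1%:R^-1 <= 1 :> R by rewrite invf_le1// ler1n.
    by have /andP[q0 qk] := q1 i; exact: (enlarge q0 qk k1).
Qed.

End admissible_shifts.

(* The library declares the product of two sub-probabilities as the canonical
   sigma-finite structure on [m1 \x m2]; products of general sigma-finite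
   measures need an explicit one. *)
Section sigma_finite_product.
Context d1 d2 (T1 : measurableType d1) (T2 : measurableType d2) (R : realType).
Variables (m1 : {sigma_finite_measure set T1 -> \bar R}) (m2 : {sigma_finite_measure set T2 -> \bar R}).

Lemma sigma_finite_product : sigma_finite setT (m1 \x m2)%E.
Proof.
have /sigma_finiteP[F [TF ndF Foo]] := sigma_finiteT m1.
have /sigma_finiteP[G [TG ndG Goo]] := sigma_finiteT m2.
exists (fun n => F n `*` G n).
  apply/seteqP; split => // -[x y] _.
  have [n _ Fx] : (\bigcup_i F i) x by rewrite -TF.
  have [k _ Gy] : (\bigcup_i G i) y by rewrite -TG.
  exists (maxn n k) => //; split => /=.
  - by move: x Fx; exact/subsetPset/ndF/leq_maxl.
  - by move: y Gy; exact/subsetPset/ndG/leq_maxr.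
move=> k; have [? ?] := Foo k; have [? ?] := Goo k.
split; first exact: measurableX.
rewrite [X in (X < _)%E]product_measure1E//; apply: lte_mul_pinfty => //.
by rewrite ge0_fin_numE.
Qed.

Definition sf_product : {sigma_finite_measure set (T1 * T2)%type -> \bar R} :=
  let m : {measure set (T1 * T2)%type -> \bar R} := (m1 \x m2)%E in
  HB.pack_for {sigma_finite_measure set (T1 * T2)%type -> \bar R} (m : set (T1 * T2)%type -> \bar R) m
    (Measure_isSigmaFinite.Build _ _ _ m sigma_finite_product).

End sigma_finite_product.

Lemma admissible_mollified_cvg (R : realType) (N : nat)
    (lam : {sigma_finite_measure set 'rV[R]_N -> \bar R})
    (lamE : lam = lebesgue_rV R N :> {measure set 'rV[R]_N -> \bar R})
    d (Y : measurableType d) (M : {sigma_finite_measure set Y -> \bar R})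
    (act : ('rV[R]_N * measurableTypeR R)%type -> Y -> Y) (W H : Y -> R) :
  admissible (mollifier lam) M act -> L2f M W -> L2f M H ->
  \int[M]_y (W y * mollified (sf_product lam (@lebesgue_measure R))
    (mollifier lam) act k H y) @[k --> \oo]
    --> \int[M]_y (W y * H y).
Proof.
move=> [mact pact [G [E [[g1 g2 g3 g4 g5] [s1 s2]]]]] LW LH.
have w1 k : (\int[sf_product lam (@lebesgue_measure R)]_q (mollifier lam k q)%:E = 1)%E.
  exact: (mollifier_mass lamE k).
have w0 := mollifier_ge0 lamE; have mw := @measurable_mollifier R N lam.
have := @mollified_pairing_cvg _ _ Y _ R M (sf_product lam (@lebesgue_measure R)) (mollifier lam) act
  w0 mw w1 mact pact G E g1 g2 g3 g4 g5 s1 s2 W H LW LH.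
apply: cvg_trans; apply: near_eq_cvg; apply/nearW => k.
exact: (@mollified_pairingE _ _ Y _ R M (sf_product lam (@lebesgue_measure R)) (mollifier lam) act
  w0 mw w1 mact pact k W H LW LH).
Qed.

Lemma product_measure1_xsection d1 d2 (T1 : measurableType d1) (T2 : measurableType d2) (R : realType)
    (m1 : {sigma_finite_measure set T1 -> \bar R}) (m2 : {sigma_finite_measure set T2 -> \bar R}) A :
  (m1 \x m2)%E A = (\int[m1]_x (m2 \o xsection A) x)%E.
Proof. by []. Qed.

(** Integration by parts treats (x,t) as one point and [z] as the jump, whereas integration in time
    needs [t] separated from (x,z). This change of variables connects the two arrangements. *)
Lemma transports_regroup (R : realType) d1 d2 d3 (X : measurableType d1) (T : measurableType d2)
    (Z : measurableType d3) (m1 : {sigma_finite_measure set X -> \bar R})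
    (m2 : {sigma_finite_measure set T -> \bar R}) (m3 : {sigma_finite_measure set Z -> \bar R}) :
  transports (sf_product m1 m2 \x m3)%E (m2 \x sf_product m1 m3)%E
    (fun y : (X * T) * Z => (y.1.2, (y.1.1, y.2))).
Proof.
set s := fun y => _.
have ms : measurable_fun setT s.
  apply: measurable_fun_pair; first by apply: measurableT_comp; [exact: measurable_snd|exact: measurable_fst].
  apply: measurable_fun_pair; last exact: measurable_snd.
  by apply: measurableT_comp; [exact: measurable_fst|exact: measurable_fst].
split=> // A mA.
have mAs : measurable (s @^-1` A) by rewrite -[X in measurable X]setTI; exact: ms.
apply: (etrans (product_measure1_xsection (sf_product m1 m2) m3 (s @^-1` A))).
rewrite fubini_tonelli2//; last exact: measurable_fun_xsection.
apply: eq_integral => t _; rewrite /fubini_G.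
apply: eq_integral => x _ /=; congr (m3 _).
apply/seteqP; split => z; rewrite /xsection /mkset.
  by move=> /set_mem sz; apply/mem_set/mem_set.
by move=> /set_mem/set_mem sz; apply/mem_set.
Qed.

Lemma ae_bounded_mul_integrable d (Y : measurableType d) (R : realType) (M : {measure set Y -> \bar R})
    (f h : Y -> R) (C : R) : measurable_fun setT f -> {ae M, forall y, `|f y| <= C} ->
  M.-integrable setT (EFin \o h) -> M.-integrable setT (fun y => (f y * h y)%:E).
Proof.
move=> mf fC hi; have mh : measurable_fun setT h by exact/measurable_EFinP/(measurable_int _ hi).
(* Truncating [f] at the levels plus and minus [|C|] gives a function bounded everywhere and almost
   everywhere equal to [f]. *)
pose g y := Num.max (- `|C|) (Num.min `|C| (f y)).
have gC y : `|g y| <= `|C|.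
  rewrite ler_norml /g le_max lexx /= ge_max ge_min lexx /= andbT.
  by rewrite (le_trans _ (normr_ge0 C))// oppr_le0.
have mg : measurable_fun setT g by apply: measurable_maxr => //; exact: measurable_minr.
have gi : M.-integrable setT (fun y => (g y * h y)%:E).
  have := integrableZl measurableT `|C| hi; apply: le_integrable => //.
    by apply/measurable_EFinP; exact: measurable_funM.
  by move=> y _; rewrite /= lee_fin !normrM normr_id ler_wpM2r.
apply: ae_eq_integrable gi _; first by apply/measurable_EFinP; exact: measurable_funM.
apply: filterS fC => y fC _; congr ((_ * _)%:E); rewrite /g.
have := le_trans fC (ler_norm C); rewrite ler_norml => /andP[f1 f2].
by rewrite (min_idPr f2) (max_idPr f1).
Qed.

Lemma integrable_fubini21 d1 d2 (Y : measurableType d1) (Q : measurableType d2) (R : realType)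
    (m1 : {sigma_finite_measure set Y -> \bar R}) (m2 : {sigma_finite_measure set Q -> \bar R})
    (f : Y * Q -> R) : (m1 \x m2)%E.-integrable setT (EFin \o f) ->
  m2.-integrable setT (fun q => (\int[m1]_y f (y, q))%:E).
Proof.
move=> fi; have mf : measurable_fun setT f by apply/measurable_EFinP; have := measurable_int _ fi; apply.
have mE : measurable_fun setT (EFin \o f) by exact/measurable_EFinP.
have mI : measurable_fun setT (fun q => (\int[m1]_y f (y, q))%:E).
  have mf' : measurable_fun setT (fun p : Q * Y => f (p.2, p.1)).
    by apply: measurableT_comp => //; exact: measurable_fun_pair.
  have H := @measurable_Rintegral_param _ _ _ _ _ m1 (fun p : Q * Y => f (p.2, p.1)) mf'.
  by apply/measurable_EFinP; exact: H.
apply/integrableP; split => //.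
apply: le_lt_trans ((integrable21ltyP m1 m2 mE).1 fi).
have mA : measurable_fun setT (fun z : Y * Q => (`|(f z)%:E|)%E) by exact: measurableT_comp.
apply: ge0_le_integral => //.
- exact: measurableT_comp.
- exact: (@measurable_fun_fubini_tonelli_G _ _ _ _ _ m1 (fun z : Y * Q => (`|(f z)%:E|)%E) mA (fun=> abse_ge0 _)).
move=> q _; apply: le_trans (le_abse_integral _ measurableT _); last first.
  exact: (measurableT_comp mE (pair2_measurable q)).
by rewrite /Rintegral; case: (integral _ _ _) => [r||] //=; rewrite ?normr0 ?leey.
Qed.

(** * The nonlocal energy *)

Section difference_bounds.
Variables (R : realType) (N : nat).
Local Notation RN := 'rV[R]_N.
Local Notation V := (RN * R)%type.
Implicit Types (f : V -> R) (p : V) (z : RN).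

(** The weight whose integrability is the Lévy condition; all differences of test functions are
    compared with it. *)
Definition mtrunc z : R := Num.min (enorm z ^+ 2) 1.

Lemma enorm_ge0 z : 0 <= enorm z. Proof. exact: sqrtr_ge0. Qed.

Lemma enorm_sqr z : enorm z ^+ 2 = \sum_i z ord0 i ^+ 2.
Proof. by rewrite sqr_sqrtr// sumr_ge0// => i _; exact: sqr_ge0. Qed.

Lemma enormN z : enorm (- z) = enorm z.
Proof. by rewrite /enorm; congr Num.sqrt; apply: eq_bigr => i _; rewrite mxE sqrrN. Qed.

Lemma norm_le_enorm z : `|z| <= enorm z.
Proof.
have ci i : `|z ord0 i| <= enorm z.
  rewrite -sqrtr_sqr; apply: ler_wsqrtr; rewrite (bigD1 i)//= lerDl.
  by apply: sumr_ge0 => j _; exact: sqr_ge0.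
rewrite [leLHS]/Num.Def.normr /= mx_normrE; apply/bigmax_leP; split; first exact: enorm_ge0.
by move=> [i j] _ /=; rewrite ord1.
Qed.

Lemma mtrunc_ge0 z : 0 <= mtrunc z.
Proof. by rewrite le_min sqr_ge0 ler01. Qed.

Lemma norm_sdir z : `|sdir z| = `|z|.
Proof. by rewrite [LHS]prod_normE /= normr0; apply/max_idPl. Qed.

Lemma le_mtrunc (a C D : R) z : 0 <= C -> 0 <= D -> a <= C * `|z| ^+ 2 -> a <= D ->
  a <= (C + D) * mtrunc z.
Proof.
move=> C0 D0 aC aD; rewrite /mtrunc minEle; case: ifPn => _; last first.
  by rewrite mulr1 (le_trans aD)// lerDr.
rewrite (le_trans aC)// mulrDl (@le_trans _ _ (C * enorm z ^+ 2))//.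
  rewrite ler_wpM2l// lerXn2r ?nnegrE ?enorm_ge0//; first exact: norm_le_enorm.
by rewrite lerDl mulr_ge0// sqr_ge0.
Qed.

Lemma difference_sqr_bound f : smooth_cc f ->
  exists2 C : R, 0 <= C & forall p z, (f (p + sdir z) - f p) ^+ 2 <= C * mtrunc z.
Proof.
move=> cf; have [L L0 HL] := smooth_cc_lipschitz cf; have [B B0 HB] := smooth_cc_bounded cf.
exists (L ^+ 2 + (B + B) ^+ 2) => [|p z]; first by rewrite addr_ge0// sqr_ge0.
rewrite -(real_normK (num_real (_ - _))); apply: le_mtrunc; rewrite ?sqr_ge0//.
  by rewrite -exprMn lerXn2r ?nnegrE ?mulr_ge0//; rewrite -norm_sdir; exact: HL.
rewrite lerXn2r ?nnegrE ?addr_ge0// (le_trans (ler_normB _ _))// lerD//.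
Qed.

(** A second-order bound obtained from first derivatives alone: by the mean value theorem the
    remainder is a sum of increments of partial derivatives, each Lipschitz, times coordinates of
    [z]. *)
Lemma taylor_bound f : smooth_cc f ->
  exists2 C : R, 0 <= C & forall p z, `|f (p + sdir z) - f p - 'D_(sdir z) f p| <= C * `|z| ^+ 2.
Proof.
move=> cf; have sf := cf.1.
have /choice[B HB] i : exists C : R, 0 <= C /\
    forall p q, `|'D_(sdir (ei R i)) f (p + q) - 'D_(sdir (ei R i)) f p| <= C * `|q|.
  by have [C C0 HC] := smooth_cc_lipschitz (smooth_cc_derive (sdir (ei R i)) cf); exists C.
exists (\sum_i B i) => [|p z]; first by apply: sumr_ge0 => i _; have [] := HB i.
have [|t /andP[t0 t1] ->] := @derive_MVT _ _ f p (sdir z).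
  by move=> y; exact: smooth_derivable.
rewrite !derive_sdir// -sumrB (le_trans (ler_norm_sum _ _ _))// mulr_suml ler_sum// => i _.
rewrite -mulrBr normrM expr2 mulrCA; apply: ler_pM => //; first exact: rV_coord_le.
have [B0 BL] := HB i; rewrite (le_trans (BL _ _))// ler_wpM2l//.
by rewrite normrZ norm_sdir (ger0_norm t0) ler_piMl.
Qed.

(** Inside the unit ball the integrand of the operator is a Taylor remainder; outside, the
    compensator is switched off and boundedness of [f] is enough. *)
Lemma compensated_bound f : smooth_cc f -> exists2 C : R, 0 <= C &
  forall p z, `|f (p + sdir z) - f p - 'D_(sdir z) f p * \1_[set z | enorm z <= 1] z| <= C * mtrunc z.
Proof.
move=> cf; have [C C0 HC] := taylor_bound cf; have [B B0 HB] := smooth_cc_bounded cf.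
exists (C + (B + B)) => [|p z]; first by rewrite !addr_ge0.
have [z1|z1] := leP (enorm z) 1.
  rewrite indicE mem_set// mulr1 /mtrunc.
  have /min_idPl -> : enorm z ^+ 2 <= 1 by rewrite exprn_ile1// enorm_ge0.
  rewrite (le_trans (HC _ _))// mulrDl (@le_trans _ _ (C * enorm z ^+ 2))//.
    by rewrite ler_wpM2l// lerXn2r ?nnegrE ?enorm_ge0//; exact: norm_le_enorm.
  by rewrite lerDl mulr_ge0 ?addr_ge0// sqr_ge0.
rewrite indicE memNset ?mulr0 ?subr0; last by rewrite /= => /(lt_le_trans z1); rewrite ltxx.
rewrite /mtrunc; have /min_idPr -> : 1 <= enorm z ^+ 2 by rewrite exprn_ege1// ltW.
rewrite mulr1 (le_trans (ler_normB _ _))//.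
by apply: (@le_trans _ _ (B + B)); [exact: lerD|rewrite lerDr].
Qed.

Lemma grad_slice f (x : RN) (t : R) z : smooth f ->
  dotp z (grad (fun x => f (x, t)) x) = 'D_(sdir z) f (x, t).
Proof.
move=> sf; rewrite derive_sdir// /dotp; apply: eq_bigr => i _; congr (_ * _).
rewrite mxE /derive; set F := (X in lim (X @ _)); set G := (X in _ = lim (X @ _)).
suff -> : F = G by [].
apply/funext => h; rewrite /F /G /=; congr (_ *: (f _ - _)).
by rewrite /sdir; congr pair; rewrite /= scaler0 add0r.
Qed.

Lemma measurable_sumsq : measurable_fun setT (fun z : RN => \sum_i z ord0 i ^+ 2).
Proof.
apply: measurable_sum => i; apply: measurable_funX; exact: measurable_coord.
Qed.

Lemma measurable_mtrunc : measurable_fun setT mtrunc.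
Proof.
apply: measurable_minr => //.
rewrite (_ : (fun _ => _) = (fun z : RN => \sum_i z ord0 i ^+ 2)); first exact: measurable_sumsq.
by apply/funext => z; rewrite enorm_sqr.
Qed.

Lemma measurable_unit_ball : measurable [set z : RN | enorm z <= 1].
Proof.
rewrite (_ : mkset _ = (fun z : RN => \sum_i z ord0 i ^+ 2) @^-1` `]-oo, 1]).
  by rewrite -[X in measurable X]setTI; exact: measurable_sumsq.
apply/seteqP; split => z /=; rewrite in_itv /= -enorm_sqr.
  by move=> z1; rewrite exprn_ile1// enorm_ge0.
by rewrite expr_le1// enorm_ge0.
Qed.

Lemma smooth_cc_cube f : smooth_cc f ->
  exists n, forall p, f p != 0 -> (cube n `*` `]- n%:R, n%:R]%classic) p.
Proof.
move=> [sf /compact_bounded[M [_ /(_ (`|M| + 1))]]].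
rewrite (le_lt_trans (ler_norm _))// ?ltrDl// => /(_ isT) HM.
exists (Num.truncn (`|M| + 1)).+1 => -[x t] fp.
have fc : closure [set x | f x != 0] (x, t) by exact: subset_closure.
have := le_lt_trans (HM _ fc) (truncnS_gt _).
rewrite [X in X < _]prod_normE gt_max => /andP[/= xM tM]; split => /=.
  move=> i; have := le_lt_trans (rV_coord_le x i) xM.
  by rewrite ltr_norml => /andP[-> /ltW ->].
by rewrite in_itv /=; move: tM; rewrite ltr_norml => /andP[-> /ltW ->].
Qed.

End difference_bounds.

Lemma ae_fst d1 d2 (T1 : measurableType d1) (T2 : measurableType d2) (R : realType)
    (m1 : {sigma_finite_measure set T1 -> \bar R}) (m2 : {sigma_finite_measure set T2 -> \bar R})
    (P : T1 -> Prop) :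
  {ae m1, forall x, P x} -> {ae (m1 \x m2)%E, forall y, P y.1}.
Proof.
move=> [A [mA A0 PA]]; exists (A `*` setT); split.
- exact: measurableX.
- by rewrite [LHS]product_measure1E// [X in (X * _)%E]A0 mul0e.
- by move=> [x y] /= nP; split => //; exact: PA.
Qed.

(** * Symmetrisation of the nonlocal term *)

Section symmetrisation.
Variables (R : realType) (N : nat).
Local Notation RN := 'rV[R]_N.
Local Notation mR := (measurableTypeR R).
Local Notation V := (RN * mR)%type.
Variables (lam mu : {sigma_finite_measure set RN -> \bar R}).
Hypothesis lam_shift : forall a, preserves lam (fun x => x + a).
Hypothesis lam_cube : forall n, (lam (cube n) < +oo)%E.
Hypothesis mu_even : preserves mu (fun z => - z).
Hypothesis mu_int : mu.-integrable setT (EFin \o @mtrunc R N).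
Local Notation lamV := (sf_product lam (@lebesgue_measure R)).
Local Notation Mz := (lamV \x mu)%E.
Implicit Types (f F : V -> R) (psi : RN * R -> R) (p : V) (z : RN).

Definition xshift p z : V := (p.1 + z, p.2).

Lemma xshiftE p z : xshift p z = p + sdir z :> V.
Proof. by rewrite /xshift /sdir; case: p => x t; congr pair; rewrite /= addr0. Qed.

Definition xdiff f (y : V * RN) : R := f (xshift y.1 y.2) - f y.1.

Lemma preserves_xshift z : preserves lamV (fun p => xshift p z).
Proof.
have [m1 m2] := preserves_prod (lam_shift z) (conj (@measurable_id _ mR setT) (fun A mA => erefl) :
  preserves (@lebesgue_measure R) id).
by split.
Qed.

Lemma measurable_xshift (s : RN -> RN) : measurable_fun setT s ->
  measurable_fun setT (fun y : V * RN => xshift y.1 (s y.2)).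
Proof.
move=> ms; apply: measurable_fun_pair.
  apply: measurable_addrV.
    by apply: measurableT_comp; [exact: measurable_fst|exact: measurable_fst].
  by apply: measurableT_comp => //; exact: measurable_snd.
by apply: measurableT_comp; [exact: measurable_snd|exact: measurable_fst].
Qed.

Lemma measurable_comp_xshift f (s : RN -> RN) : measurable_fun setT f -> measurable_fun setT s ->
  measurable_fun setT (fun y : V * RN => f (xshift y.1 (s y.2))).
Proof. by move=> mf ms; exact: (measurableT_comp mf (measurable_xshift ms)). Qed.

Lemma measurable_xdiff f : measurable_fun setT f -> measurable_fun setT (xdiff f).
Proof.
move=> mf; apply: measurable_funB.
  exact: (@measurable_comp_xshift f id mf (@measurable_id _ _ setT)).
exact: (measurableT_comp mf measurable_fst).
Qed.

(** Integrate in [p] first: translation invariance makes the inner integral independent of [z], and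
    what remains is the integral of [mtrunc]. The map [s] will be the identity, the constant 0 and
    the reflection, so that points [p + z], [p] and [p - z] are all covered. *)
Lemma weighted_shift_integrable (h : V -> R) (s : RN -> RN) : measurable_fun setT s ->
  (forall p, 0 <= h p) -> lamV.-integrable setT (EFin \o h) ->
  Mz.-integrable setT (fun y => (mtrunc y.2 * h (xshift y.1 (s y.2)))%:E).
Proof.
move=> ms h0 hi; have mh : measurable_fun setT h by apply/measurable_EFinP; have := measurable_int _ hi; apply.
have mf : measurable_fun setT (fun y : V * RN => (mtrunc y.2 * h (xshift y.1 (s y.2)))%:E).
  apply/measurable_EFinP; apply: measurable_funM.
    by apply: measurableT_comp; [exact: measurable_mtrunc|exact: measurable_snd].
  exact: (measurable_comp_xshift mh ms).
apply/integrable21ltyP => //=.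
have inner z : (\int[lamV]_p `|(mtrunc z * h (xshift p (s z)))%:E| =
    (mtrunc z)%:E * \int[lamV]_p (h p)%:E)%E.
  under eq_integral => p _ do rewrite gee0_abs ?lee_fin ?mulr_ge0 ?mtrunc_ge0// EFinM.
  rewrite ge0_integralZl//; last by rewrite lee_fin mtrunc_ge0.
  - congr (_ * _)%E.
    apply: (@ge0_integral_transports _ _ _ _ _ lamV lamV (fun p => xshift p (s z)) (EFin \o h)).
    + exact: preserves_xshift.
    + exact/measurable_EFinP.
    + by move=> p; rewrite /= lee_fin.
  - apply/measurable_EFinP; apply: measurableT_comp => //; exact: (preserves_xshift (s z)).1.
  - by move=> p _; rewrite lee_fin.
under eq_integral => z _ do rewrite inner.
rewrite ge0_integralZr//; last 3 first.
- by apply/measurable_EFinP; exact: measurable_mtrunc.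
- by move=> z _; rewrite lee_fin mtrunc_ge0.
- by apply: integral_ge0 => p _; rewrite lee_fin.
have fin (d : measure_display) (T : measurableType d) (m : {measure set T -> \bar R}) (g : T -> R) :
    (forall x, 0 <= g x) -> m.-integrable setT (EFin \o g) -> (\int[m]_x (g x)%:E < +oo)%E.
  move=> g0 /integrableP[_].
  by under eq_integral => x _ do rewrite /= ger0_norm//.
apply: lte_mul_pinfty; last exact: fin.
- by apply: integral_ge0 => z _; rewrite lee_fin mtrunc_ge0.
- rewrite ge0_fin_numE; first by apply: fin => // z; exact: mtrunc_ge0.
  by apply: integral_ge0 => z _; rewrite lee_fin mtrunc_ge0.
Qed.

Definition cubeV n : set V := cube n `*` `]- n%:R, n%:R]%classic.

Definition chi n : V -> R := \1_(cubeV n).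

Lemma chi_ge0 n p : 0 <= chi n p. Proof. by []. Qed.

Lemma measurable_cubeV n : measurable (cubeV n).
Proof. by apply: measurableX; [exact: measurable_cube|exact: measurable_itv]. Qed.

Lemma cubeV_fin n : (lamV (cubeV n) < +oo)%E.
Proof.
rewrite [X in (X < _)%E]product_measure1E//; last exact: measurable_cube.
have l1 (a b : R) : (@lebesgue_measure R `]a, b]%classic < +oo)%E.
  by rewrite lebesgue_measure_itv /=; case: ifP => _; rewrite ?ltry.
apply: lte_mul_pinfty => //; last exact: l1.
by rewrite ge0_fin_numE//; exact: lam_cube.
Qed.

Lemma chi_integrable n : lamV.-integrable setT (EFin \o chi n).
Proof. by apply: integrable_indic_fin; [exact: measurable_cubeV|exact: cubeV_fin]. Qed.

Lemma chi_supp psi n : (forall p, psi p != 0 -> (cube n `*` `]- n%:R, n%:R]%classic) p) ->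
  forall p : V, psi p != 0 -> chi n p = 1.
Proof. by move=> H p /H np; rewrite /chi indicE mem_set. Qed.

(** The difference vanishes unless [p] or [p + z] lies in a cube containing the support, so its
    square is at most [C * mtrunc z] times the sum of the two indicators. *)
Lemma xdiff_L2 psi : smooth_cc psi -> L2f Mz (xdiff psi).
Proof.
move=> cp; have [C C0 HC] := difference_sqr_bound cp; have [n Hn] := smooth_cc_cube cp.
have Hchi := chi_supp Hn.
have mp : measurable_fun setT (psi : V -> R).
  by apply: continuous_measurable_spacetime; apply: smooth_continuous; case: cp.
have mx := measurable_xdiff mp.
apply: integrable_L2 => //.
have i1 := weighted_shift_integrable (@measurable_id _ RN setT) (chi_ge0 n) (chi_integrable n).
have i2 := weighted_shift_integrable (measurable_cst (0 : RN)) (chi_ge0 n) (chi_integrable n).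
have := integrableZl measurableT C (integrableD measurableT i1 i2).
apply: le_integrable => //; first by apply/measurable_EFinP; exact: measurable_funX.
move=> [p z] _; rewrite /= !lee_fin ger0_norm ?sqr_ge0// [leRHS]ger0_norm; last first.
  by rewrite mulr_ge0// addr_ge0// mulr_ge0// mtrunc_ge0.
rewrite -mulrDr mulrA /xdiff /= xshiftE.
have x0 : xshift p 0 = p by rewrite /xshift addr0; case: (p).
rewrite x0.
have [e1|e1] := eqVneq (psi (p + sdir z)) 0; last first.
  by rewrite (Hchi _ e1) (le_trans (HC p z))// ler_peMr ?lerDl// mulr_ge0// mtrunc_ge0.
have [e2|e2] := eqVneq (psi p) 0; last first.
  by rewrite (Hchi _ e2) (le_trans (HC p z))// ler_peMr ?lerDr// mulr_ge0// mtrunc_ge0.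
by rewrite e1 e2 subr0 expr0n /= mulr_ge0// ?addr_ge0// mulr_ge0// mtrunc_ge0.
Qed.

(** The gradient terms at [z] and [- z] cancel in this symmetric combination, so it is bounded by a
    multiple of [mtrunc z]. *)
Definition second_diff psi (y : V * RN) : R :=
  psi (xshift y.1 y.2) + psi (xshift y.1 (- y.2)) - psi y.1 *+ 2.

Lemma second_diff_bound psi : smooth_cc psi ->
  exists2 C : R, 0 <= C & forall y, `|second_diff psi y| <= C * mtrunc y.2.
Proof.
move=> cp; have [C C0 HC] := compensated_bound cp; exists (C + C); first by rewrite addr_ge0.
move=> [p z]; rewrite /second_diff /= !xshiftE.
have -> : psi (p + sdir z) + psi (p + sdir (- z)) - psi p *+ 2 =
   (psi (p + sdir z) - psi p - 'D_(sdir z) psi p * \1_[set z | enorm z <= 1] z) +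
   (psi (p + sdir (- z)) - psi p - 'D_(sdir (- z)) psi p * \1_[set z | enorm z <= 1] (- z)).
  have -> : \1_[set z : RN | enorm z <= 1] (- z) = \1_[set z | enorm z <= 1] z :> R.
    by rewrite !indicE; congr (nat_of_bool _)%:R; apply/idP/idP; rewrite !inE /= enormN.
  have -> : 'D_(sdir (- z)) psi p = - 'D_(sdir z) psi p.
    rewrite -scaleN1r sdirZ deriveZdir ?mulN1r//; apply: smooth_derivable; case: cp => //.
  by rewrite mulr2n; ring.
rewrite (le_trans (ler_normD _ _))// mulrDl lerD//.
by have := HC p (- z); rewrite /mtrunc enormN.
Qed.

Lemma second_diff_integrable psi : smooth_cc psi ->
  Mz.-integrable setT (EFin \o second_diff psi).
Proof.
move=> cp; have [C C0 HC] := second_diff_bound cp; have [n Hn] := smooth_cc_cube cp.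
have Hchi := chi_supp Hn.
have mp : measurable_fun setT (psi : V -> R).
  by apply: continuous_measurable_spacetime; apply: smooth_continuous; case: cp.
have mN : measurable_fun setT (fun z : RN => - z) := mu_even.1.
have i1 := weighted_shift_integrable (@measurable_id _ RN setT) (chi_ge0 n) (chi_integrable n).
have i2 := weighted_shift_integrable (measurable_cst (0 : RN)) (chi_ge0 n) (chi_integrable n).
have i3 := weighted_shift_integrable mN (chi_ge0 n) (chi_integrable n).
have := integrableZl measurableT C (integrableD measurableT (integrableD measurableT i1 i2) i3).
apply: le_integrable => //.
  apply/measurable_EFinP; apply: measurable_funB.
    by apply: measurable_funD; [exact: (@measurable_comp_xshift psi id mp (@measurable_id _ _ setT))|exact: (@measurable_comp_xshift psi -%R mp mN)].
  under eq_fun do rewrite mulr2n.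
  by apply: measurable_funD; exact: (measurableT_comp mp measurable_fst).
move=> [p z] _; rewrite /= !lee_fin [leRHS]ger0_norm; last first.
  by rewrite mulr_ge0// !addr_ge0// mulr_ge0// mtrunc_ge0.
rewrite -!mulrDr mulrA.
have x0 : xshift p 0 = p by rewrite /xshift addr0; case: (p).
rewrite x0; have H := HC (p, z); rewrite /= in H.
have Cm : 0 <= C * mtrunc z by rewrite mulr_ge0// mtrunc_ge0.
have one : chi n (xshift p z) + chi n p + chi n (xshift p (- z)) >= 1 ->
    `|second_diff psi (p, z)| <= C * mtrunc z * (chi n (xshift p z) + chi n p + chi n (xshift p (- z))).
  by move=> h; rewrite (le_trans H)// ler_peMr.
have [e1|e1] := eqVneq (psi (xshift p z)) 0; last first.
  by apply: one; rewrite (Hchi _ e1) -addrA lerDl addr_ge0.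
have [e2|e2] := eqVneq (psi p) 0; last first.
  by apply: one; rewrite (Hchi _ e2) addrAC lerDr addr_ge0.
have [e3|e3] := eqVneq (psi (xshift p (- z))) 0; last first.
  by apply: one; rewrite (Hchi _ e3) lerDr addr_ge0.
by rewrite /second_diff /= e1 e2 e3 addr0 mul0rn subr0 normr0 mulr_ge0// !addr_ge0.
Qed.

(** Evenness of [mu] allows [z] to be replaced by [- z] in the integral; averaging the two forms
    removes the compensator, since the unit ball is symmetric. *)
Lemma levy_opE psi p : smooth_cc psi ->
  mu.-integrable setT (fun z => (second_diff psi (p, z))%:E) /\
  levy_op mu (fun x => psi (x, p.2)) p.1 = 2^-1 * \int[mu]_z second_diff psi (p, z).
Proof.
move=> cp; have [C C0 HC] := compensated_bound cp; have sp := cp.1.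
have mp : measurable_fun setT (psi : V -> R).
  by apply: continuous_measurable_spacetime; exact: smooth_continuous.
have mN : measurable_fun setT (fun z : RN => - z) := mu_even.1.
pose v z := psi (xshift p z) - psi p - 'D_(sdir z) psi p * \1_[set z | enorm z <= 1] z.
have mshift : measurable_fun setT (fun z => psi (xshift p z)).
  exact: (measurableT_comp (@measurable_comp_xshift psi id mp (@measurable_id _ _ setT)) (pair1_measurable p)).
have mv : measurable_fun setT v.
  apply: measurable_funB; first by apply: measurable_funB => //; exact: measurable_cst.
  apply: measurable_funM; last by apply: measurable_indic; exact: measurable_unit_ball.
  rewrite (_ : (fun _ => _) = (fun z : RN => \sum_i z ord0 i * 'D_(sdir (ei R i)) psi p)).
    apply: measurable_sum => i; apply: measurable_funM; last exact: measurable_cst.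
    exact: measurable_coord.
  by apply/funext => z; rewrite derive_sdir.
have vi : mu.-integrable setT (EFin \o v).
  have := integrableZl measurableT C mu_int; apply: le_integrable => //.
    exact/measurable_EFinP.
  move=> z _; rewrite /= lee_fin [leRHS]ger0_norm; last by rewrite mulr_ge0// mtrunc_ge0.
  by rewrite /v xshiftE; exact: HC.
have vNi : mu.-integrable setT (EFin \o (fun z => v (- z))).
  exact: (integrable_transports mu_even vi).
have E : levy_op mu (fun x => psi (x, p.2)) p.1 = \int[mu]_z v z.
  rewrite /levy_op Rintegral_mkcond; apply: eq_Rintegral => z _.
  rewrite patchE; case: ifPn => z0.
    have -> : dotp z (grad (fun x => psi (x, p.2)) p.1) = 'D_(sdir z) psi p.
      by rewrite grad_slice//; case: (p).
    by rewrite /v /xshift; case: (p).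
  (* The operator integrates over [z != 0], whereas [v] is integrated everywhere; this is the same
     because [v] vanishes at 0. *)
  have -> : z = 0 by apply/eqP; apply: contraNT z0 => z0; rewrite inE.
  rewrite /v (_ : sdir 0 = 0)//.
  by rewrite derive0 mul0r subr0 /xshift addr0; case: (p) => x t /=; rewrite subrr.
have E' : levy_op mu (fun x => psi (x, p.2)) p.1 = \int[mu]_z v (- z).
  by rewrite E -(Rintegral_transports mu_even vi).
have sE z : second_diff psi (p, z) = v z + v (- z).
  rewrite /second_diff /v /=.
  have -> : \1_[set z : RN | enorm z <= 1] (- z) = \1_[set z | enorm z <= 1] z :> R.
    by rewrite !indicE; congr (nat_of_bool _)%:R; apply/idP/idP; rewrite !inE /= enormN.
  have -> : 'D_(sdir (- z)) psi p = - 'D_(sdir z) psi p.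
    by rewrite -scaleN1r sdirZ deriveZdir ?mulN1r//; exact: smooth_derivable.
  by rewrite mulr2n; ring.
have si : mu.-integrable setT (fun z => (second_diff psi (p, z))%:E).
  by have := integrableD measurableT vi vNi; apply: eq_integrable => // z _; rewrite sE.
split => //.
under eq_Rintegral => z _ do rewrite sE.
by rewrite RintegralD// -E -E'; lra.
Qed.

(* Translation invariance in [x] moves half of the symmetrised second difference of
   [psi] onto [F]. *)
Lemma integration_by_parts F psi (C : R) : measurable_fun setT F ->
  {ae lamV, forall p, `|F p| <= C} -> smooth_cc psi -> L2f Mz (xdiff F) ->
  \int[lamV]_p (F p * levy_op mu (fun x => psi (x, p.2)) p.1) =
  - 2^-1 * \int[Mz]_y (xdiff F y * xdiff psi y).
Proof.
move=> mF FC cp LF; have sp := cp.1.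
have mp : measurable_fun setT (psi : V -> R).
  by apply: continuous_measurable_spacetime; exact: smooth_continuous.
have si := second_diff_integrable cp.
have FCz : {ae Mz, forall y, `|F y.1| <= C} by exact: (@ae_fst _ _ _ _ _ lamV mu (fun p => `|F p| <= C) FC).
have FSi : Mz.-integrable setT (fun y => (F y.1 * second_diff psi y)%:E).
  by apply: (ae_bounded_mul_integrable (C := C)) => //; exact: (measurableT_comp mF measurable_fst).
have LD := L2_mul_integrable LF (xdiff_L2 cp).
have -> : \int[lamV]_p (F p * levy_op mu (fun x => psi (x, p.2)) p.1) =
    2^-1 * \int[Mz]_y (F y.1 * second_diff psi y).
  rewrite (Rintegral_fubini12 FSi) -(RintegralZl _ measurableT (integrable_fubini12 FSi)).
  apply: eq_Rintegral => p _; have [spi ->] := levy_opE p cp.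
  by rewrite mulrCA; congr (_ * _); exact: (esym (RintegralZl (F p) measurableT spi)).
(* From here on [z] is fixed. The one-sided differences of [psi] are then integrable in [p], and the
   translation by [z] can be applied to one of them alone; jointly in (p,z) they need not be
   integrable, as [mu] may be infinite near 0. *)
rewrite (Rintegral_fubini21 FSi) (Rintegral_fubini21 LD) mulNr -mulrN; congr (_ * _).
rewrite -mulN1r -RintegralZl//; last first.
  rewrite (_ : _ \o _ = EFin \o (fun z => \int[lamV]_p (xdiff F (p, z) * xdiff psi (p, z))))//.
  exact: (integrable_fubini21 LD).
apply: eq_Rintegral => z _ /=.
have [n Hn] := smooth_cc_cube cp.
have psi_i : lamV.-integrable setT (EFin \o psi).
  have [B B0 HB] := smooth_cc_bounded cp.
  have := integrableZl measurableT B (chi_integrable n); apply: le_integrable => //.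
    exact/measurable_EFinP.
  move=> p _; rewrite /= lee_fin [leRHS]ger0_norm ?mulr_ge0//.
  have [->|e] := eqVneq (psi p) 0; first by rewrite normr0 mulr_ge0.
  by rewrite (chi_supp Hn e) mulr1; exact: HB.
have shift_i s : lamV.-integrable setT (EFin \o (fun p => psi (xshift p s))).
  exact: (integrable_transports (preserves_xshift s) psi_i).
have ai : lamV.-integrable setT (EFin \o (fun p => F p * (psi (xshift p z) - psi p))).
  by apply: (ae_bounded_mul_integrable (C := C)) => //; apply: integrableB (shift_i z) psi_i.
have bi : lamV.-integrable setT (EFin \o (fun p => F p * (psi (xshift p (- z)) - psi p))).
  by apply: (ae_bounded_mul_integrable (C := C)) => //; apply: integrableB (shift_i (- z)) psi_i.
have bzi := integrable_transports (preserves_xshift z) bi.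
have xK p : xshift (xshift p z) (- z) = p by rewrite /xshift /= addrK; case: p.
transitivity (\int[lamV]_p (F p * (psi (xshift p z) - psi p)) +
    \int[lamV]_p (F (xshift p z) * (psi p - psi (xshift p z)))).
  rewrite -[X in _ = _ + X](_ : \int[lamV]_p (F p * (psi (xshift p (- z)) - psi p)) = _).
    rewrite -RintegralD//; apply: eq_Rintegral => p _.
    by rewrite /second_diff /= mulr2n; ring.
  rewrite -(Rintegral_transports (preserves_xshift z) bi).
  by apply: eq_Rintegral => p _; rewrite xK.
rewrite -RintegralD//; last first.
  by apply: eq_integrable bzi => // p _ /=; rewrite xK.
rewrite -RintegralZl//; last first.
  have := integrableZl measurableT (-1) (integrableD measurableT ai bzi).
  apply: eq_integrable => // p _ /=; rewrite xK /xdiff /= mulrDr; congr (_%:E).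
  by ring.
by apply: eq_Rintegral => p _; rewrite /xdiff /=; ring.
Qed.

End symmetrisation.

Lemma transports_swap (R : realType) d1 d2 (X : measurableType d1) (Y : measurableType d2)
    (m1 : {sigma_finite_measure set X -> \bar R}) (m2 : {sigma_finite_measure set Y -> \bar R}) :
  transports (m1 \x m2)%E (m2 \x m1)%E (fun p : X * Y => (p.2, p.1)).
Proof.
set s := fun y => _.
have ms : measurable_fun setT s by exact: measurable_fun_pair.
split=> // A mA.
have mAs : measurable (s @^-1` A) by rewrite -[X in measurable X]setTI; exact: ms.
have := @measurable_indic _ _ R setT A mA.
move=> mI.
have E : (m2 \x m1)%E A = (\int[m2]_y \int[m1]_x (\1_A (y, x))%:E)%E.
  rewrite [LHS]product_measure1_xsection; apply: eq_integral => y _ /=.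
  have my : measurable (xsection A y) by exact: measurable_xsection.
  rewrite -(setIT (xsection A y)) -integral_indic//; apply: eq_integral => x _.
  by rewrite !indicE mem_xsection.
apply: etrans _ (esym E); apply: (etrans (product_measure1_xsection m1 m2 (s @^-1` A))).
have mI' : measurable_fun setT (fun p : X * Y => (\1_A (s p))%:E : \bar R).
  by apply/measurable_EFinP; exact: (measurableT_comp mI ms).
rewrite -(@fubini_tonelli _ _ _ _ _ m1 m2 (fun p => (\1_A (s p))%:E))//.
apply: eq_integral => x _ /=.
have mx : measurable (xsection (s @^-1` A) x) by exact: measurable_xsection.
rewrite -(setIT (xsection _ x)) -integral_indic//; apply: eq_integral => y _.
by rewrite !indicE; congr (nat_of_bool _)%:R%:E; rewrite mem_xsection; apply/idP/idP => /set_mem h; exact/mem_set.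
Qed.

(** * The primitive in time *)

Section volterra.
Context (R : realType) d (Z : measurableType d).
Variables (m : {sigma_finite_measure set Z -> \bar R}) (T : R).
Hypothesis T_gt0 : 0 < T.
Local Notation mR := (measurableTypeR R).
Local Notation leb := (@lebesgue_measure R).
Local Notation M := (sf_product leb m).
Implicit Types (G H : mR * Z -> R).

Definition ordered s t : R := if [&& 0 < s, s < t & t < T] then 1 else 0.

Definition kernel_integral (k : mR -> mR -> R) H (y : mR * Z) :=
  \int[leb]_s (k s y.1 * H (s, y.2)).

(** For [0 < t < T] this is the primitive of [H] from 0 to [t], and it is 0 for other [t]. The
    transposed kernel gives the primitive from [t] to [T], which is the form taken by the test
    functions. *)
Definition volterra := kernel_integral ordered.
Definition volterra_adj := kernel_integral (fun s t => ordered t s).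

Lemma measurable_ordered : measurable_fun setT (fun q : mR * mR => ordered q.1 q.2).
Proof.
apply: measurable_fun_ifT => //.
by apply: measurable_and; [exact: measurable_fun_ltr|apply: measurable_and; exact: measurable_fun_ltr].
Qed.

Lemma measurable_kernel_integral (k : mR -> mR -> R) H :
  measurable_fun setT (fun q : mR * mR => k q.1 q.2) -> measurable_fun setT H ->
  measurable_fun setT (kernel_integral k H).
Proof.
move=> mk mH; apply: (@measurable_Rintegral_param _ _ _ _ _ leb
  (fun p : (mR * Z) * mR => k p.2 p.1.1 * H (p.2, p.1.2))).
apply: measurable_funM.
  apply: (measurableT_comp mk (g := fun p : (mR * Z) * mR => (p.2, p.1.1))).
  apply: measurable_fun_pair; first exact: measurable_snd.
  exact: (measurableT_comp measurable_fst measurable_fst).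
apply: (measurableT_comp mH); apply: measurable_fun_pair; first exact: measurable_snd.
exact: (measurableT_comp measurable_snd measurable_fst).
Qed.

Definition window (s : mR) : R := \1_(`]0, T[%classic : set mR) s.

Lemma window_integrable : leb.-integrable setT (EFin \o window).
Proof.
apply: integrable_indic_fin; first exact: measurable_itv.
have l1 : (@lebesgue_measure R `]0%R, T[%classic < +oo)%E.
  by rewrite lebesgue_measure_itv /=; case: ifP => _; rewrite ltry.
exact: l1.
Qed.

Lemma window_mass : \int[leb]_s window s = T.
Proof.
rewrite /Rintegral /window integral_indic//.
rewrite setIT; have l1 : fine (@lebesgue_measure R `]0%R, T[%classic) = T.
  by rewrite lebesgue_measure_itv /= lte_fin T_gt0 /= subr0.
exact: l1.
Qed.

(** The condition is symmetric in the two times, so one boundedness proof serves [ordered] and its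
    transpose. *)
Definition window_kernel (k : mR -> mR -> R) :=
  measurable_fun setT (fun q : mR * mR => k q.1 q.2) /\
  forall s t, 0 <= k s t <= window s * window t.

Lemma window_le1 s : window s <= 1. Proof. by rewrite /window indicE lern1 leq_b1. Qed.

Lemma window_kernel_ordered : window_kernel ordered.
Proof.
split; first exact: measurable_ordered.
move=> s t; rewrite /ordered /window !indicE; case: ifP => [/and3P[s0 st tT]|]; last first.
  by rewrite lexx mulr_ge0.
by rewrite ler01 !mem_set ?mul1r//= in_itv /= ?s0 ?tT ?andbT ?(lt_trans s0)// (lt_trans st).
Qed.

Lemma window_kernel_swap k : window_kernel k -> window_kernel (fun s t => k t s).
Proof.
move=> [mk kw]; split; last by move=> s t; rewrite mulrC; exact: kw.
apply: (measurableT_comp mk (g := fun q : mR * mR => (q.2, q.1))).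
exact: measurable_fun_pair.
Qed.

(* Discriminant form of the Cauchy-Schwarz inequality against the window. *)
Lemma sqr_le_window (k h : mR -> R) : measurable_fun setT k -> (forall s, 0 <= k s <= window s) ->
  L2f leb h -> (\int[leb]_s (k s * h s)) ^+ 2 <= T * \int[leb]_s (h s ^+ 2).
Proof.
move=> mk kw Lh; set W := \int[leb]_s _.
have wi := window_integrable.
have k2 s : k s ^+ 2 <= window s.
  have /andP[k0 k1] := kw s.
  have w1 : window s <= 1 by rewrite /window indicE lern1 leq_b1.
  by nra.
have k2i : leb.-integrable setT (fun s => (k s ^+ 2)%:E).
  apply: le_integrable wi => //; first by apply/measurable_EFinP; exact: measurable_funX.
  move=> s _; rewrite /= lee_fin ger0_norm ?sqr_ge0// ger0_norm//.
have Lk : L2f leb k by exact: integrable_L2.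
have hi := L2_sqr_integrable Lh; have khi := L2_mul_integrable Lk Lh.
have K1 : \int[leb]_s (k s ^+ 2) <= T by rewrite -window_mass; apply: le_Rintegral.
set S := \int[leb]_s (h s ^+ 2); set K := \int[leb]_s (k s ^+ 2) in K1.
have Tn : T != 0 by rewrite gt_eqF.
have : 0 <= \int[leb]_s ((W / T * k s - h s) ^+ 2) by apply: Rintegral_ge0 => s _; exact: sqr_ge0.
have -> : \int[leb]_s ((W / T * k s - h s) ^+ 2) = (W / T) ^+ 2 * K - 2 * (W / T) * W + S.
  rewrite /K -(RintegralZl ((W / T) ^+ 2) measurableT k2i).
  rewrite {3}/W -(RintegralZl (2 * (W / T)) measurableT khi).
  have i1 := integrableZl measurableT ((W / T) ^+ 2) k2i.
  have i2 := integrableZl measurableT (2 * (W / T)) khi.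
  rewrite -(RintegralB measurableT i1 i2) -(RintegralD measurableT (integrableB measurableT i1 i2) hi).
  by apply: eq_Rintegral => s _; ring.
move=> H.
have e1 : W ^+ 2 = T * (W / T * W) by field.
have e2 : (W / T) ^+ 2 * K <= W / T * W.
  have -> : W / T * W = (W / T) ^+ 2 * T by field.
  by rewrite ler_wpM2l ?sqr_ge0.
by rewrite e1 ler_pM2l//; lra.
Qed.

Lemma integrable_tensor d1 d2 (Y : measurableType d1) (Q : measurableType d2)
    (m1 : {sigma_finite_measure set Y -> \bar R}) (m2 : {sigma_finite_measure set Q -> \bar R})
    (a : Y -> R) (b : Q -> R) :
  m1.-integrable setT (EFin \o a) -> m2.-integrable setT (EFin \o b) ->
  (m1 \x m2)%E.-integrable setT (fun p => (a p.1 * b p.2)%:E).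
Proof.
move=> ai bi.
have ma : measurable_fun setT a by apply/measurable_EFinP; have := measurable_int _ ai; apply.
have mb : measurable_fun setT b by apply/measurable_EFinP; have := measurable_int _ bi; apply.
apply/integrable12ltyP.
  apply/measurable_EFinP; apply: measurable_funM.
    exact: (measurableT_comp ma measurable_fst).
  exact: (measurableT_comp mb measurable_snd).
have inner y : (\int[m2]_q `|(a (y, q).1 * b (y, q).2)%:E| = `|a y|%:E * \int[m2]_q `|(b q)%:E|)%E.
  transitivity (\int[m2]_q (`|a y|%:E * `|(b q)%:E|))%E.
    by apply: eq_integral => q _; rewrite EFinM abseM.
  rewrite ge0_integralZl//.
  by apply: measurableT_comp => //; exact/measurable_EFinP.
under eq_integral => y _ do rewrite inner.
rewrite ge0_integralZr//; last by apply: integral_ge0.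
- apply: lte_mul_pinfty; first by apply: integral_ge0.
  + rewrite ge0_fin_numE; last by apply: integral_ge0.
    by have /integrableP[_] := ai.
  + by have /integrableP[_] := bi.
- by apply/measurable_EFinP; exact: measurableT_comp.
Qed.

(** In the extended reals the bound holds at every [y]: a slice with infinite integral makes the
    right-hand side infinite when the window is 1, and both sides are 0 when the window is 0. *)
Lemma kernel_sqr_le k H y : window_kernel k -> measurable_fun setT H ->
  ((kernel_integral k H y ^+ 2)%:E <= (T * window y.1)%:E * \int[leb]_s (H (s, y.2) ^+ 2)%:E)%E.
Proof.
move=> [mk kw] mH; case: y => t z /=.
have I0 : (0 <= \int[leb]_s (H (s, z) ^+ 2)%:E)%E by apply: integral_ge0 => s _; rewrite lee_fin sqr_ge0.
have w0 : 0 <= window t by [].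
have w1 : window t = 0 \/ window t = 1.
  by rewrite /window indicE; case: (_ \in _); [right|left].
case: w1 => wt.
  rewrite wt mulr0 mul0e /kernel_integral /=; under eq_Rintegral => s _.
    have := kw s t; rewrite wt mulr0 => /le_anti <-; rewrite mul0r.
    over.
  by rewrite Rintegral_cst//= mul0r expr0n.
rewrite wt mulr1.
have mHz : measurable_fun setT (fun s => H (s, z)).
  exact: (measurableT_comp mH (pair2_measurable z)).
have [Ioo|] := boolP (\int[leb]_s (H (s, z) ^+ 2)%:E < +oo)%E; last first.
  by rewrite -leNgt leye_eq => /eqP ->; rewrite mulry gtr0_sg// mul1e leey.
have LH : L2f leb (fun s => H (s, z)) by split.
have If : (\int[leb]_s (H (s, z) ^+ 2)%:E)%E \is a fin_num by rewrite ge0_fin_numE.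
rewrite -(fineK If) -EFinM lee_fin.
apply: (@sqr_le_window (fun s => k s t) (fun s => H (s, z))) => //.
  exact: (measurableT_comp mk (pair2_measurable (t : mR))).
by move=> s; rewrite -[window s]mulr1 -wt.
Qed.

(** Integrating [kernel_sqr_le] over time and [z] bounds the squared norm by [T ^+ 2] times that of
    [H]; the finiteness of the time interval is what makes the primitive square-integrable. *)
Lemma L2_kernel_integral k H : window_kernel k -> L2f M H -> L2f M (kernel_integral k H).
Proof.
move=> wk LH; have [mH Hoo] := LH; have mV := measurable_kernel_integral wk.1 mH.
split=> //.
pose h (y : mR * Z) := ((T * window y.1)%:E * \int[leb]_s (H (s, y.2) ^+ 2)%:E)%E.
have mw : measurable_fun setT window by apply: measurable_indic; exact: measurable_itv.
have mH2 : measurable_fun setT (fun y => (H y ^+ 2)%:E).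
  by apply/measurable_EFinP; exact: measurable_funX.
have mG : measurable_fun setT (fun z : Z => \int[leb]_s (H (s, z) ^+ 2)%:E)%E.
  by apply: (@measurable_fun_fubini_tonelli_G _ _ _ _ _ leb (fun y => (H y ^+ 2)%:E)) => // y; rewrite lee_fin sqr_ge0.
have I0 z : (0 <= \int[leb]_s (H (s, z) ^+ 2)%:E)%E by apply: integral_ge0 => s _; rewrite lee_fin sqr_ge0.
have h0 y : (0 <= h y)%E by rewrite mule_ge0// lee_fin mulr_ge0// ltW.
have mh : measurable_fun setT h.
  apply: emeasurable_funM; last exact: (measurableT_comp mG measurable_snd).
  by apply/measurable_EFinP; apply: measurable_funM => //; exact: (measurableT_comp mw measurable_fst).
apply: (@le_lt_trans _ _ (\int[M]_y h y)%E).
  apply: ge0_le_integral => //.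
  - by move=> y _; rewrite lee_fin sqr_ge0.
  - by apply/measurable_EFinP; exact: measurable_funX.
  - by move=> y _; exact: kernel_sqr_le.
have -> : (\int[M]_y h y = \int[leb]_t \int[m]_z h (t, z))%E by exact: (@fubini_tonelli1 _ _ _ _ _ leb m h mh h0).
have inner t : (\int[m]_z h (t, z) = (T * window t)%:E * \int[M]_y (H y ^+ 2)%:E)%E.
  rewrite /h /= ge0_integralZl//; last by rewrite lee_fin mulr_ge0// ltW.
  congr (_ * _)%E; apply/esym.
  by apply: (@fubini_tonelli2 _ _ _ _ _ leb m (fun y => (H y ^+ 2)%:E)) => // y; rewrite lee_fin sqr_ge0.
under eq_integral => t _ do rewrite inner.
have Tw : leb.-integrable setT (fun t => (T * window t)%:E).
  exact: (integrableZl measurableT T window_integrable).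
rewrite ge0_integralZr//; last 3 first.
- by apply/measurable_EFinP; exact: measurable_funM.
- by move=> t _; rewrite lee_fin mulr_ge0// ltW.
- by apply: integral_ge0 => y _; rewrite lee_fin sqr_ge0.
apply: lte_mul_pinfty => //.
- by apply: integral_ge0 => t _; rewrite lee_fin mulr_ge0// ltW.
- exact: integrable_fin_num.
Qed.

Lemma L2_volterra H : L2f M H -> L2f M (volterra H).
Proof. exact: L2_kernel_integral window_kernel_ordered. Qed.

Lemma L2_volterra_adj H : L2f M H -> L2f M (volterra_adj H).
Proof. exact: L2_kernel_integral (window_kernel_swap window_kernel_ordered). Qed.

Lemma window_integrable_mul (h : mR * Z -> R) : M.-integrable setT (EFin \o h) ->
  (leb \x M)%E.-integrable setT (fun p => (window p.1 * h p.2)%:E).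
Proof. exact: (integrable_tensor window_integrable). Qed.

(** Only the product is integrable, so [c y] is pulled out of the inner integral by cases: where it
    vanishes both sides are 0, and elsewhere dividing by it shows the inner section to be integrable
    for almost every [y]. *)
Lemma Rintegral_fubini21_pull d1 d2 (Y : measurableType d1) (Q : measurableType d2)
    (la : {sigma_finite_measure set Q -> \bar R}) (mu : {sigma_finite_measure set Y -> \bar R})
    (c : Y -> R) (k : Q * Y -> R) : measurable_fun setT c -> measurable_fun setT k ->
  (la \x mu)%E.-integrable setT (fun p => (c p.2 * k p)%:E) ->
  \int[(la \x mu)%E]_p (c p.2 * k p) = \int[mu]_y (c y * \int[la]_q k (q, y)).
Proof.
move=> mc mk ip; rewrite (Rintegral_fubini21 ip).
have mk' : measurable_fun setT (fun p : Y * Q => k (p.2, p.1)).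
  by apply: measurableT_comp => //; exact: measurable_fun_pair.
apply: ae_eq_Rintegral.
- apply: (@measurable_Rintegral_param _ _ _ _ _ la (fun p : Y * Q => c p.1 * k (p.2, p.1))).
  by apply: measurable_funM => //; exact: (measurableT_comp mc measurable_fst).
- apply: measurable_funM => //.
  exact: (@measurable_Rintegral_param _ _ _ _ _ la (fun p : Y * Q => k (p.2, p.1)) mk').
have := ae_integrable2 ip; apply: filterS => y iy _.
have [c0|c0] := eqVneq (c y) 0.
  rewrite c0 mul0r; under eq_Rintegral => q _ do rewrite /= ?c0 mul0r.
  by rewrite Rintegral_cst// mul0r.
have ik : la.-integrable setT (EFin \o (fun q => k (q, y))).
  have := integrableZl measurableT (c y)^-1 iy; apply: eq_integrable => // q _ /=.
  by rewrite -EFinM; congr (_%:E); rewrite mulrA mulVf// mul1r.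
exact: (RintegralZl (c y) measurableT ik).
Qed.

(** Both sides are the integral of [H (s, z) * ordered s t * G (t, z)] over triples (s,t,z); [h1]
    and [h2] single out [t] and [s], respectively, as the variable integrated first. *)
Lemma volterra_duality H G : L2f M H -> L2f M G ->
  \int[M]_y (volterra H y * G y) = \int[M]_y (H y * volterra_adj G y).
Proof.
move=> LH LG; have [mH _] := LH; have [mG _] := LG.
pose P3 := (sf_product leb leb \x m)%E.
pose h1 (y : (mR * mR) * Z) : mR * (mR * Z) := (y.1.2, (y.1.1, y.2)).
pose h2 (y : (mR * mR) * Z) : mR * (mR * Z) := (y.1.1, (y.1.2, y.2)).
have t1 : transports P3 (leb \x M)%E h1 by exact: transports_regroup.
have idm : preserves m id by split => //; exact: (@measurable_id _ _ setT).
have [s1 s2] : preserves P3 (fun y => ((y.1.2, y.1.1), y.2)).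
  exact: (@preserves_prod _ _ _ _ _ (sf_product leb leb) m (fun p => (p.2, p.1)) id
    (transports_swap leb leb) idm).
have t2 : transports P3 (leb \x M)%E h2.
  have [a1 a2] := t1; split; first exact: (measurableT_comp a1 s1).
  move=> A mA; have mA1 : measurable (h1 @^-1` A) by rewrite -[X in measurable X]setTI; exact: a1.
  exact: (etrans (s2 _ mA1) (a2 _ mA)).
pose k1 (p : mR * (mR * Z)) := ordered p.2.1 p.1 * G (p.1, p.2.2).
pose k2 (p : mR * (mR * Z)) := ordered p.1 p.2.1 * H (p.1, p.2.2).
pose g1 (p : mR * (mR * Z)) := H p.2 * k1 p.
pose g2 (p : mR * (mR * Z)) := G p.2 * k2 p.
have mre : measurable_fun setT (fun p : mR * (mR * Z) => (p.1, p.2.2)).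
  apply: measurable_fun_pair; first exact: measurable_fst.
  exact: (measurableT_comp measurable_snd measurable_snd).
have mor : measurable_fun setT (fun p : mR * (mR * Z) => ordered p.1 p.2.1).
  apply: (measurableT_comp measurable_ordered (g := fun p : mR * (mR * Z) => (p.1, p.2.1))).
  apply: measurable_fun_pair; first exact: measurable_fst.
  exact: (measurableT_comp measurable_fst measurable_snd).
have mor' : measurable_fun setT (fun p : mR * (mR * Z) => ordered p.2.1 p.1).
  apply: (measurableT_comp measurable_ordered (g := fun p : mR * (mR * Z) => (p.2.1, p.1))).
  apply: measurable_fun_pair; last exact: measurable_fst.
  exact: (measurableT_comp measurable_fst measurable_snd).
have mk1 : measurable_fun setT k1 by apply: measurable_funM => //; exact: (measurableT_comp mG mre).
have mk2 : measurable_fun setT k2 by apply: measurable_funM => //; exact: (measurableT_comp mH mre).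
have mg1 : measurable_fun setT g1.
  by apply: measurable_funM => //; exact: (measurableT_comp mH measurable_snd).
have mg2 : measurable_fun setT g2.
  by apply: measurable_funM => //; exact: (measurableT_comp mG measurable_snd).
(* Read on triples, these are [window t * H (s, z) ^+ 2] and [window s * G (t, z) ^+ 2]; their sum
   dominates the integrand because the kernel is at most either window. *)
have i1 := integrable_transports t1 (window_integrable_mul (L2_sqr_integrable LH)).
have i2 := integrable_transports t2 (window_integrable_mul (L2_sqr_integrable LG)).
have fi : P3.-integrable setT (EFin \o (g1 \o h1)).
  have := integrableD measurableT i1 i2; apply: le_integrable => //.
    by apply/measurable_EFinP; exact: (measurableT_comp mg1 t1.1).
  move=> [[s t] z] _; rewrite /= lee_fin /g1 /h1 /h2 /=.
  have /andP[w0 w1] := window_kernel_ordered.2 s t.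
  have ws : ordered s t <= window s by rewrite (le_trans w1)// ler_piMr// window_le1.
  have wt : ordered s t <= window t by rewrite (le_trans w1)// ler_piMl// window_le1.
  rewrite /k1 /= mulrCA normrM (ger0_norm w0) [leRHS]ger0_norm; last first.
    by rewrite addr_ge0// mulr_ge0// sqr_ge0.
  have HG : `|H (s, z) * G (t, z)| <= H (s, z) ^+ 2 + G (t, z) ^+ 2.
    by rewrite ler_norml; nra.
  apply: (le_trans (ler_wpM2l w0 HG)).
  by rewrite mulrDr lerD// ler_wpM2r// sqr_ge0.
have g1i : (leb \x M)%E.-integrable setT (EFin \o g1).
  by apply: (transports_integrable t1 _ fi); exact/measurable_EFinP.
have g2i : (leb \x M)%E.-integrable setT (EFin \o g2).
  apply: (transports_integrable t2); first exact/measurable_EFinP.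
  apply: eq_integrable fi => // -[[s t] z] _; congr (_%:E).
  by rewrite /g1 /g2 /k1 /k2 /h1 /h2 /=; ring.
have E : \int[(leb \x M)%E]_p g1 p = \int[(leb \x M)%E]_p g2 p.
  rewrite -(Rintegral_transports t1 g1i) -(Rintegral_transports t2 g2i).
  by apply: eq_Rintegral => -[[s t] z] _; rewrite /g1 /g2 /k1 /k2 /h1 /h2 /=; ring.
have e1 := Rintegral_fubini21_pull mH mk1 g1i.
have e2 := Rintegral_fubini21_pull mG mk2 g2i.
apply: etrans _ e1; apply: etrans _ (esym E); apply: etrans _ (esym e2).
by apply: eq_Rintegral => y _; rewrite mulrC.
Qed.

Lemma volterra_add_adj H t z : measurable_fun setT H ->
  leb.-integrable setT (fun s => (H (s, z))%:E) -> (forall s, ~~ (0 < s < T) -> H (s, z) = 0) ->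
  0 < t < T -> volterra H (t, z) + volterra_adj H (t, z) = \int[leb]_s H (s, z).
Proof.
move=> mH Hi H0 /andP[t0 tT]; rewrite /volterra /volterra_adj /kernel_integral /=.
have mHz : measurable_fun setT (fun s => H (s, z)) by exact: (measurableT_comp mH (pair2_measurable z)).
have m1 : measurable_fun setT (fun s : mR => ordered s t).
  exact: (measurableT_comp measurable_ordered (pair2_measurable (t : mR))).
have m2 : measurable_fun setT (fun s : mR => ordered t s).
  exact: (measurableT_comp measurable_ordered (pair1_measurable (t : mR))).
have ip k : window_kernel k -> leb.-integrable setT (fun s => (k s t * H (s, z))%:E).
  move=> [mk kw]; apply: le_integrable Hi => //.
    apply/measurable_EFinP; apply: measurable_funM => //.
    exact: (measurableT_comp mk (pair2_measurable (t : mR))).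
  move=> s _; have /andP[k0 k1] := kw s t; rewrite /= lee_fin normrM ger0_norm// ler_piMl//.
  by rewrite (le_trans k1)// mulr_ile1// window_le1.
have i1 := ip _ window_kernel_ordered.
have i2 := ip _ (window_kernel_swap window_kernel_ordered).
rewrite -(RintegralD measurableT i1 i2); apply: ae_eq_Rintegral => //.
- by apply: measurable_funD; exact: measurable_funM.
(* The two kernels add up to 1 on the interval except on the diagonal [s = t], a null set. *)
exists [set t]; split => //.
  exact: (@lebesgue_measure_set1 R t).
move=> s /= ns; apply: contrapT => st; apply: ns => _; rewrite -mulrDl.
have [sT|/H0 ->] := boolP (0 < s < T); last by rewrite mulr0.
rewrite /ordered t0 tT; case/andP: sT => -> -> /=; rewrite andbT.
by have [ts|ts|e] := ltgtP s t; rewrite ?add0r ?addr0 ?mul1r//.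
Qed.

(* For almost every [z], the Volterra kernel and its transpose add up to [1] on the
   square (0, T)^2, so twice the pairing is the integral of a square. *)
Lemma volterra_pairing_ge0 H : L2f M H -> (forall t z, ~~ (0 < t < T) -> H (t, z) = 0) ->
  0 <= \int[M]_y (volterra H y * H y).
Proof.
move=> LH H0; have mH := LH.1; set I := \int[M]_y _.
have LV := L2_volterra LH; have LA := L2_volterra_adj LH.
have i1 := L2_mul_integrable LV LH; have i2 := L2_mul_integrable LH LA.
suff : 0 <= I + I by lra.
rewrite {2}/I volterra_duality// -(RintegralD measurableT i1 i2).
rewrite (Rintegral_fubini21 (integrableD measurableT i1 i2)).
pose J z := \int[leb]_s H (s, z).
have mH' : measurable_fun setT (fun p : Z * mR => H (p.2, p.1)).
  by apply: measurableT_comp => //; exact: measurable_fun_pair.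
have mJ : measurable_fun setT J := @measurable_Rintegral_param _ _ _ _ _ leb _ mH'.
rewrite (@ae_eq_Rintegral _ _ _ _ _ (fun z => J z ^+ 2)); first by apply: Rintegral_ge0 => z _; exact: sqr_ge0.
- pose f (y : mR * Z) := volterra H y * H y + H y * volterra_adj H y.
  have mf : measurable_fun setT f.
    by apply: measurable_funD; apply: measurable_funM => //; [exact: LV.1|exact: LA.1].
  have mf' : measurable_fun setT (fun p : Z * mR => f (p.2, p.1)).
    by apply: measurableT_comp => //; exact: measurable_fun_pair.
  exact: (@measurable_Rintegral_param _ _ _ _ _ leb _ mf').
- exact: measurable_funX.
have := ae_integrable2 (L2_sqr_integrable LH); apply: filterS => z iz _.
have mHz : measurable_fun setT (fun s => H (s, z)) by exact: (measurableT_comp mH (pair2_measurable z)).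
(* A square-integrable slice carried by a bounded interval is integrable, since
   [|H| <= window + H ^+ 2]. *)
have Hi : leb.-integrable setT (fun s => (H (s, z))%:E).
  have := integrableD measurableT window_integrable iz; apply: le_integrable => //.
    exact/measurable_EFinP.
  move=> s _; rewrite /= lee_fin [leRHS]ger0_norm ?addr_ge0 ?sqr_ge0//.
  have [sT|sT] := boolP (0 < s < T); last by rewrite H0// normr0 addr_ge0// sqr_ge0.
  rewrite /window indicE mem_set/= ?in_itv//= ler_norml; nra.
rewrite expr2 -(RintegralZl (J z) measurableT Hi); apply: eq_Rintegral => t _.
have [tT|tT] := boolP (0 < t < T); last by rewrite H0// !mulr0 mul0r addr0.
rewrite /J -(@volterra_add_adj H t z)//; first by ring.
by move=> s; exact: H0.
Qed.

End volterra.

(** * The backward time primitive of a test function *)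

Section time_primitive.
Variables (R : realType) (N : nat) (T : R).
Hypothesis T_gt0 : 0 < T.
Local Notation RN := 'rV[R]_N.
Local Notation mR := (measurableTypeR R).
Local Notation leb := (@lebesgue_measure R).
Local Notation tdir := (@tdir R N).
Implicit Types (rho : RN * R -> R) (p : RN * R).

Let th (s : mR) : RN * R := (s : R) *: tdir.

Lemma add_tdirE p (s : R) : p + s *: tdir = (p.1, p.2 + s).
Proof. by rewrite /tdir; case: p => x t; congr pair; rewrite /= ?scaler0 ?addr0// [_ *: _]mulr1. Qed.

Lemma continuous_tline (f : RN * R -> R) p : continuous f -> continuous (fun s : R => f (p + s *: tdir)).
Proof.
move=> cf s; apply: continuous_comp; last exact: cf.
by apply: cvgD; [exact: cvg_cst|apply: cvgZr_tmp; exact: cvg_id].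
Qed.

Let mth (f : RN * R -> R) : continuous f -> forall p, measurable_fun setT (fun s => f (p + th s)).
Proof. by move=> cf p; apply: continuous_measurable_fun; exact: continuous_tline. Qed.

(** The range of integration is the fixed interval (0,T), so smoothness is that of an average. For
    [0 < t < T] the value is still the integral of [rho] from [t] to [T], because [rho] vanishes
    from time [T] on. *)
Definition time_primitive rho := average leb th (window T) rho.

Lemma window_neq0 (s : mR) : window T s != 0 -> 0 < s < T.
Proof.
rewrite /window indicE; case: (boolP (_ \in _)) => [|_]; last by rewrite eqxx.
by move=> /set_mem /=; rewrite in_itv.
Qed.

(** Reading [rho] at later times moves its support backward in time, so the support stays before
    [T]. *)
Lemma test_function_time_primitive rho : test_function T rho -> test_function T (time_primitive rho).
Proof.
move=> [srho [crho supp]]; have cc : smooth_cc rho by [].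
split; first exact: (smooth_average (window_integrable T) mth cc).
pose K : set (RN * R) := [set s *: tdir | s in `[0, T]%classic].
have cK : compact K.
  apply: continuous_compact; last exact: segment_compact.
  by apply: continuous_subspaceT => s; apply: cvgZr_tmp; exact: cvg_id.
have wK s : window T s != 0 -> K (th s).
  move=> /window_neq0/andP[s0 sT]; exists (s : R) => //.
  by rewrite /= in_itv/= !ltW.
have [c1 c2] := average_support leb crho cK wK; split => // p /c2[a ha [b [s /= sT <-] <-]].
have := supp _ ha; rewrite /= => aT.
rewrite /tdir /= [_ *: _]mulr1; apply: le_lt_trans aT.
by rewrite gerBl; move: sT; rewrite in_itv /= => /andP[].
Qed.

Lemma test_function_eq0 rho p : test_function T rho -> T <= p.2 -> rho p = 0.
Proof.
move=> [_ [_ supp]] Tp; apply/eqP/negP => /negP n0.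
by have := supp p (@subset_closure _ [set x | rho x != 0] p n0); rewrite /= ltNge Tp.
Qed.

(** The fundamental theorem of calculus leaves [rho] at time [p.2 + T] minus [rho p]; the first term
    is 0 because [p.2 >= 0] puts that time at or after [T]. *)
Lemma time_primitive_derive rho p : test_function T rho -> 0 <= p.2 ->
  'D_tdir (time_primitive rho) p = - rho p.
Proof.
move=> trho p0; have [srho [crho supp]] := trho; have cc : smooth_cc rho by [].
have -> : 'D_tdir (time_primitive rho) p = average leb th (window T) ('D_tdir rho) p.
  exact: (congr1 (fun h => h p) (average_derive (window_integrable T) mth tdir cc)).
rewrite /average.
pose G (s : R) := rho (p + s *: tdir).
have dG (s : R) : is_derive s 1 G ('D_tdir rho (p + s *: tdir)).
  by apply: is_derive_line; exact: smooth_derivable.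
have cG : continuous G by apply: continuous_tline; exact: smooth_continuous.
have cD : continuous (fun s : R => 'D_tdir rho (p + s *: tdir)).
  exact: (@continuous_tline ('D_tdir rho) p (smooth_continuous (smooth_derive tdir srho))).
have E : \int[leb]_s ('D_tdir rho (p + th s) * window T s) =
    fine (\int[leb]_(s in `[0, T]%classic) ('D_tdir rho (p + s *: tdir))%:E).
  rewrite /Rintegral [in RHS]integral_mkcond; congr fine; apply: ae_eq_integral => //.
  - apply/measurable_EFinP; apply: measurable_funM; first exact: (@mth ('D_tdir rho) (smooth_continuous (smooth_derive tdir srho)) p).
    by apply: measurable_indic; exact: measurable_itv.
  - apply/(measurable_restrictT _ _).1 => //.
    apply: measurable_funTS; apply/measurable_EFinP; exact: continuous_measurable_fun.
  (* The window is open and the fundamental theorem uses the closed interval; they differ by the two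
     endpoints, a null set. *)
  exists [set 0; T]; split.
  - exact: measurableU.
  - rewrite measureU0//; exact: lebesgue_measure_set1.
  move=> s /= ns; apply: contrapT => /not_orP[/eqP s0 /eqP sT]; apply: ns => _.
  rewrite patchE /window indicE /=.
  have -> : (s \in (`[0, T]%classic : set R)) = (s \in (`]0, T[%classic : set R)).
    by apply/idP/idP => /set_mem/=; rewrite in_itv/= => /andP[a b]; apply/mem_set;
      rewrite /= in_itv/= ?lt_def ?s0 ?a ?b ?ltW// eq_sym sT.
  by case: ifP => _ /=; rewrite ?mulr1 ?mulr0.
have F2 := @continuous_FTC2 R (fun s => 'D_tdir rho (p + s *: tdir)) G 0 T T_gt0.
rewrite E F2 /G; last 3 first.
- exact: continuous_subspaceT.
- split; [by move=> s _; have [] := dG s|exact: cvg_at_right_filter (cG 0)|exact: cvg_at_left_filter (cG T)].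
- by move=> s _; rewrite derive1E; have [_ ->] := dG s.
by rewrite scale0r addr0 add_tdirE /= (test_function_eq0 trho) ?sub0r//= lerDr.
Qed.

Lemma ordered_slice_integrable rho x (t : R) : smooth_cc rho ->
  leb.-integrable setT (fun r => (ordered T t r * rho (x, r))%:E).
Proof.
move=> cc; have [C C0 HC] := smooth_cc_bounded cc.
have := integrableZl measurableT C (window_integrable T); apply: le_integrable => //.
  apply/measurable_EFinP; apply: measurable_funM.
    exact: (measurableT_comp (measurable_ordered T) (pair1_measurable (t : mR))).
  rewrite (_ : (fun r => rho (x, r)) = (fun r => rho ((x, 0) + r *: tdir))).
    apply: continuous_measurable_fun; apply: continuous_tline; exact: smooth_continuous cc.1.
  by apply/funext => r; rewrite add_tdirE add0r.
move=> r _; rewrite /= lee_fin [leRHS]ger0_norm ?mulr_ge0// normrM mulrC.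
have /andP[k0 k1] := (window_kernel_ordered T).2 t r.
by rewrite [`|ordered _ _ _|]ger0_norm// ler_pM// (le_trans k1)// ler_piMl// window_le1.
Qed.

Lemma time_primitiveE rho x t : test_function T rho -> 0 < t < T ->
  time_primitive rho (x, t) = \int[leb]_r (ordered T t r * rho (x, r)).
Proof.
move=> trho /andP[t0 tT]; have [srho [crho supp]] := trho; have cc : smooth_cc rho by [].
pose f (r : mR) : R := rho (x, r) * window T (r - t).
have w_shift := preserves_lebesgue_shift t.
have E s : rho ((x, t) + th s) * window T s = f (s + t).
  by rewrite /f /th add_tdirE /= addrK addrC.
have ordE r : f r = ordered T t r * rho (x, r).
  (* For [r >= T] both sides vanish with [rho]; for [r < T] the upper condition [r - t < T] of the
     window is automatic since [t > 0]. *)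
  rewrite /f mulrC; have [Tr|rT] := leP T r; first by rewrite (test_function_eq0 trho)// !mulr0.
  congr (_ * _); rewrite /window /ordered t0 rT andbT /= indicE.
  have [tr|rt] := ltP t r.
    by rewrite mem_set//= in_itv /= subr_gt0 tr /= ltrBlDr (lt_trans rT)// ltrDl.
  by rewrite memNset//= in_itv /= subr_gt0 ltNge rt.
have fi : leb.-integrable setT (EFin \o f).
  have := ordered_slice_integrable x t cc; apply: eq_integrable => // r _.
  by rewrite /= ordE.
rewrite /time_primitive /average; under eq_Rintegral => s _ do rewrite E.
by rewrite (Rintegral_transports w_shift fi); apply: eq_Rintegral => r _; exact: ordE.
Qed.

(** The same difference as [xdiff], with time as the first variable, where [volterra] acts. *)
Definition tdiff (f : RN * mR -> R) (y : mR * (RN * RN)) : R :=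
  f (y.2.1 + y.2.2, y.1) - f (y.2.1, y.1).

Lemma tdiff_time_primitive rho (y : mR * (RN * RN)) : test_function T rho -> 0 < y.1 < T ->
  tdiff (time_primitive rho) y = volterra_adj T (tdiff rho) y.
Proof.
move=> trho; case: y => t [x z] /= tT; have [srho [crho supp]] := trho; have cc : smooth_cc rho by [].
rewrite /tdiff /= !time_primitiveE// -(RintegralB measurableT (ordered_slice_integrable _ _ cc)
  (ordered_slice_integrable _ _ cc)).
by apply: eq_Rintegral => r _; rewrite /tdiff /= mulrBr.
Qed.

End time_primitive.

Lemma L2f_transports d d' (Y : measurableType d) (Y' : measurableType d') (R : realType)
    (m : {measure set Y -> \bar R}) (m' : {measure set Y' -> \bar R}) (h : Y -> Y') (f : Y' -> R) :
  transports m m' h -> measurable_fun setT f -> L2f m (f \o h) <-> L2f m' f.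
Proof.
move=> tr mf; have mf2 : measurable_fun setT (fun y => (f y ^+ 2)%:E).
  by apply/measurable_EFinP; exact: measurable_funX.
have E := ge0_integral_transports tr mf2 (fun y => sqr_ge0 (f y)).
split=> [[_ Loo]|[_ Loo]]; split => //; first by rewrite -E.
- exact: (measurableT_comp mf tr.1).
- by rewrite [X in (X < _)%E]E.
Qed.

(** * The energy identity for test functions *)

Section energy.
Variables (R : realType) (N : nat).
Local Notation RN := 'rV[R]_N.
Local Notation mR := (measurableTypeR R).
Local Notation V := (RN * mR)%type.
Local Notation leb := (@lebesgue_measure R).
Variables (lam mu : {sigma_finite_measure set RN -> \bar R}) (T : R).
Hypothesis T_gt0 : 0 < T.
Hypothesis lam_shift : forall a, preserves lam (fun x => x + a).
Hypothesis lam_cube : forall n, (lam (cube n) < +oo)%E.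
Hypothesis mu_even : preserves mu (fun z => - z).
Hypothesis mu_int : mu.-integrable setT (EFin \o @mtrunc R N).
Local Notation lamV := (sf_product lam leb).
Local Notation M := (sf_product leb (sf_product lam mu)).
Implicit Types (f F : V -> R) (rho : RN * R -> R).

Definition regroup (y : V * RN) : mR * (RN * RN) := (y.1.2, (y.1.1, y.2)).

Lemma regroup_transports : transports (lamV \x mu)%E M regroup.
Proof. exact: transports_regroup. Qed.

Lemma measurable_tdiff f : measurable_fun setT f -> measurable_fun setT (tdiff f).
Proof.
move=> mf; have m1 : measurable_fun setT (fun y : mR * (RN * RN) => y.2.1).
  exact: (measurableT_comp measurable_fst measurable_snd).
have m2 : measurable_fun setT (fun y : mR * (RN * RN) => y.2.2).
  exact: (measurableT_comp measurable_snd measurable_snd).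
apply: measurable_funB.
  apply: (measurableT_comp mf (g := fun y : mR * (RN * RN) => (y.2.1 + y.2.2, y.1))).
  by apply: measurable_fun_pair; [exact: measurable_addrV|exact: measurable_fst].
apply: (measurableT_comp mf (g := fun y : mR * (RN * RN) => (y.2.1, y.1))).
by apply: measurable_fun_pair; [exact: m1|exact: measurable_fst].
Qed.

Lemma xdiffE f : xdiff f = tdiff f \o regroup.
Proof. by apply/funext => -[[x t] z]. Qed.

Lemma L2_xdiff_tdiff f : measurable_fun setT f -> L2f (lamV \x mu)%E (xdiff f) <-> L2f M (tdiff f).
Proof.
by move=> mf; rewrite xdiffE; exact: (L2f_transports regroup_transports (measurable_tdiff mf)).
Qed.

Lemma tdiff_L2 rho : smooth_cc rho -> L2f M (tdiff (rho : V -> R)).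
Proof.
move=> cc; apply/L2_xdiff_tdiff; last exact: xdiff_L2.
exact: continuous_measurable_spacetime (smooth_continuous cc.1).
Qed.

(** After integration by parts, the difference of the time primitive is [volterra_adj] of the
    difference of [rho] on (0,T), and duality moves the primitive onto [F]. At other times the
    difference of [F] is 0. *)
Lemma energy_identity F rho (C : R) : measurable_fun setT F ->
  {ae lamV, forall p, `|F p| <= C} -> (forall p, ~~ (0 < p.2 < T) -> F p = 0) ->
  L2f M (tdiff F) -> test_function T rho ->
  \int[lamV]_p (F p * levy_op mu (fun x => time_primitive T rho (x, p.2)) p.1) =
  - 2^-1 * \int[M]_y (volterra T (tdiff F) y * tdiff rho y).
Proof.
move=> mF FC F0 LF trho; have [srho [crho _]] := trho; have cc : smooth_cc rho by [].
have [spsi [cpsi _]] := test_function_time_primitive trho.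
have ccp : smooth_cc (time_primitive T rho) by [].
rewrite (integration_by_parts lam_shift lam_cube mu_even mu_int mF FC ccp); last exact/L2_xdiff_tdiff.
congr (_ * _).
have i := L2_mul_integrable LF (tdiff_L2 ccp).
rewrite !xdiffE; apply: etrans; first exact: (Rintegral_transports regroup_transports i).
rewrite (volterra_duality T LF (tdiff_L2 cc)); apply: eq_Rintegral => y _.
have [yT|yT] := boolP (0 < y.1 < T); first by rewrite tdiff_time_primitive.
by rewrite {1 3}/tdiff !F0// subrr !mul0r.
Qed.

Lemma energy_pairing_ge0 F : (forall p, ~~ (0 < p.2 < T) -> F p = 0) -> L2f M (tdiff F) ->
  0 <= \int[M]_y (volterra T (tdiff F) y * tdiff F y).
Proof.
move=> F0 LF; apply: volterra_pairing_ge0 => // t z tT.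
by rewrite /tdiff !F0// subrr.
Qed.

End energy.

(** * Admissible test functions *)

Section mollified_test.
Variables (R : realType) (N : nat) (T : R).
Local Notation RN := 'rV[R]_N.
Local Notation mR := (measurableTypeR R).
Local Notation V := (RN * mR)%type.
Local Notation leb := (@lebesgue_measure R).
Variable lam : {sigma_finite_measure set RN -> \bar R}.
Hypothesis lamE : lam = lebesgue_rV R N :> {measure set RN -> \bar R}.
Hypothesis lam_shift : forall a, preserves lam (fun x => x + a).
Local Notation lamV := (sf_product lam leb).

Definition shiftV (q p : V) : V := (p.1 + q.1, p.2 + q.2).

Definition mollify k (G : V -> R) := mollified lamV (mollifier lam) shiftV k G.

(** The reflected kernel: substituting [r = p + q] writes the mollification of [G] at [p] as the
    integral of [kappa k (p - r) * G r], an [average] of a smooth function with weight [G]. *)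
Let kappa k (p : RN * R) : R := mollifier lam k (- p).
Let opp (r : V) : RN * R := - (r : RN * R).

Let smooth_cc_kappa k : smooth_cc (kappa k).
Proof.
pose e : R := k.+1%:R^-1; pose A (p : RN * R) : RN * R := - p.
have kE : kappa k = (fun p => (bump_mass lam e)^-1 * (bump e \o A) p) by [].
have cA : continuous A.
  by move=> p; apply: cvgN; exact: cvg_id.
have sk : smooth (kappa k).
  rewrite kE; apply: smoothM; first exact: smooth_cst.
  apply: (@smooth_affine _ _ _ A A _ cA _ (@smooth_bump R N e)) => p v h.
  by rewrite /A opprD scalerN.
split=> //.
pose K : set (RN * R) := [set z : RN | forall i, `[- e, - (e / 2)]%classic (z ord0 i)] `*` `[- e, - (e / 2)]%classic.
have kK : compact K by apply: compact_setX; [exact: compact_rV_itv|exact: segment_compact].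
apply: (subclosed_compact _ kK); first exact: closed_closure.
rewrite [X in _ `<=` X](_ : K = closure K); last first.
  exact/closure_id/(compact_closed (@norm_hausdorff _ _) kK).
apply: closureS => p /=.
rewrite kE mulf_eq0 negb_or => /andP[_ /bump_neq0[/andP[a b] H]].
split=> [i|] /=; rewrite in_itv /=.
  by have := H i; rewrite /A /= mxE lerNl lerNr => /andP[/ltW -> /ltW ->].
by rewrite lerNl lerNr !ltW.
Qed.

Lemma preserves_shiftV q : preserves lamV (fun p => shiftV q p).
Proof. exact: (preserves_prod (lam_shift q.1) (preserves_lebesgue_shift q.2)). Qed.

Lemma mollifier_bounded k : exists2 C : R, 0 <= C & forall q, `|mollifier lam k q| <= C.
Proof.
have [C C0 HC] := smooth_cc_bounded (smooth_cc_kappa k); exists C => // q.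
by have := HC (- (q : RN * R)); rewrite /kappa opprK.
Qed.

Lemma integrable_mollifier_mul k G : lamV.-integrable setT (EFin \o G) ->
  lamV.-integrable setT (fun q => (mollifier lam k q * G q)%:E).
Proof.
move=> Gi; have [C C0 HC] := mollifier_bounded k.
apply: (ae_bounded_mul_integrable (C := C)) => //; first exact: measurable_mollifier.
exact: aeW.
Qed.

Let mopp (f : RN * R -> R) : continuous f -> forall p, measurable_fun setT (fun r => f (p + opp r)).
Proof.
move=> cf p; apply: continuous_measurable_spacetime => r; apply: continuous_comp; last exact: cf.
by apply: cvgD; [exact: cvg_cst|apply: cvgN; exact: cvg_id].
Qed.

Lemma mollifyE k G : lamV.-integrable setT (EFin \o G) ->
  mollify k G = average lamV opp G (kappa k).
Proof.
move=> Gi; apply/funext => p; rewrite /mollify /mollified /average.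
have mG : measurable_fun setT G by apply/measurable_EFinP; have := measurable_int _ Gi; apply.
pose f (r : V) := kappa k ((p : RN * R) + opp r) * G r.
have fi : lamV.-integrable setT (EFin \o f).
  have [C C0 HC] := smooth_cc_bounded (smooth_cc_kappa k).
  apply: (ae_bounded_mul_integrable (C := C)) => //.
    exact: mopp (smooth_continuous (smooth_cc_kappa k).1) p.
  by apply: aeW => r.
rewrite -(Rintegral_transports (preserves_shiftV p) fi); apply: eq_Rintegral => q _.
rewrite /f /kappa /opp opprD opprK; congr (mollifier lam k _ * G _).
  by rewrite /shiftV; case: (q) => q1 q2; case: (p) => p1 p2 /=; congr pair => /=; rewrite addrC addrK.
by rewrite /shiftV; congr pair; rewrite addrC.
Qed.

(** The kernel [kappa k] lives at times at most [- e / 2], with [e] the inverse of [k + 1], and [G]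
    at times before [T]; so the closed support of the convolution stays at times at most
    [T - e / 2]. *)
Lemma test_function_mollify k G m : lamV.-integrable setT (EFin \o G) ->
  (forall p, G p != 0 -> cube m p.1 /\ 0 < p.2 < T) -> test_function T (mollify k G).
Proof.
move=> Gi Gsupp; rewrite (mollifyE _ Gi).
have cc := smooth_cc_kappa k; have [sk ck] := cc.
split; first exact: (smooth_average Gi mopp cc).
pose K : set (RN * R) := [set z : RN | forall i, `[- m%:R, m%:R]%classic (z ord0 i)] `*` `[- T, 0]%classic.
have cK : compact K by apply: compact_setX; [exact: compact_rV_itv|exact: segment_compact].
have GK r : G r != 0 -> K (opp r).
  move=> /Gsupp[c /andP[r0 rT]]; split => [i|] /=; rewrite in_itv /=.
    by rewrite mxE lerN2; have /andP[h1 h2] := c i; rewrite h2 lerNl ltW.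
  by rewrite lerN2 oppr_le0 !ltW.
have [c1 c2] := average_support lamV ck cK GK; split => // p /c2[a ha [b [_ bT] <-]].
have e0 : 0 < k.+1%:R^-1 / 2 :> R by rewrite divr_gt0.
have : closure [set x : RN * R | kappa k x != 0] `<=` [set p | p.2 <= - (k.+1%:R^-1 / 2)].
  rewrite [X in _ `<=` X](_ : _ = closure [set p : RN * R | p.2 <= - (k.+1%:R^-1 / 2)]).
    apply: closureS => x /=.
    by rewrite mulf_eq0 negb_or => /andP[_ /bump_neq0[/andP[h1 h2] _]]; rewrite lerNr ltW.
  apply/closure_id; apply: (@preimage_closed _ _ (fun p : RN * R => p.2) [set t : R | t <= _]).
    by move=> x _; exact: cvg_snd.
  exact: closed_le.
move=> /(_ _ ha) /= aT; move: bT; rewrite /= in_itv /= => /andP[bT _].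
have : a.2 - b.2 < T by move: e0 aT; set e := _ / 2; move=> e0 aT; lra.
by [].
Qed.

Variable mu : {sigma_finite_measure set RN -> \bar R}.
Local Notation M := (sf_product leb (sf_product lam mu)).

Lemma admissible_shiftV : admissible (mollifier lam) lamV shiftV.
Proof.
have ws := @mollifier_neq0 R N lam.
exact: (admissible_prod (admissible_space ws lamE) (admissible_time ws)).
Qed.

(** The jump [z] is left alone: translating [G] in space-time translates its difference in (t,x) and
    keeps [z]. *)
Definition shiftM (q : V) (y : mR * (RN * RN)) : mR * (RN * RN) :=
  (y.1 + q.2, (y.2.1 + q.1, y.2.2)).

Lemma admissible_shiftM : admissible (mollifier lam) M shiftM.
Proof.
have ws := @mollifier_neq0 R N lam.
have ax := admissible_prod (M1 := lam) (M2 := mu) (admissible_space ws lamE) (admissible_id (mollifier lam) mu).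
exact: (admissible_prod (M1 := leb) (M2 := sf_product lam mu) (admissible_time ws) ax).
Qed.

Lemma mollify_cvg W G : L2f lamV W -> L2f lamV G ->
  \int[lamV]_p (W p * mollify k G p) @[k --> \oo] --> \int[lamV]_p (W p * G p).
Proof. exact: (admissible_mollified_cvg lamE admissible_shiftV). Qed.

(** Differences in [x] commute with translations, so the difference of a mollification is the
    mollification of the difference, and the abstract convergence applies on triples. *)
Lemma tdiff_mollify k G : lamV.-integrable setT (EFin \o G) ->
  tdiff (mollify k G) = mollified lamV (mollifier lam) shiftM k (tdiff G).
Proof.
move=> Gi; apply/funext => -[t [x z]]; rewrite /tdiff /mollify /mollified /=.
have gi (p : V) : lamV.-integrable setT (fun q => (mollifier lam k q * G (shiftV q p))%:E).
  apply: (integrable_mollifier_mul k (G := fun q => G (shiftV q p))).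
  have := integrable_transports (preserves_shiftV p) Gi; apply: eq_integrable => // q _ /=.
  by rewrite /shiftV addrC [q.2 + _]addrC.
rewrite -(RintegralB measurableT (gi _) (gi _)); apply: eq_Rintegral => q _.
by rewrite -mulrBr /shiftV /= addrAC.
Qed.

Lemma tdiff_mollify_cvg W G : lamV.-integrable setT (EFin \o G) ->
  L2f M W -> L2f M (tdiff G) ->
  \int[M]_y (W y * tdiff (mollify k G) y) @[k --> \oo] --> \int[M]_y (W y * tdiff G y).
Proof.
move=> Gi LW LG; under eq_cvg => k do rewrite (tdiff_mollify k Gi).
exact: (admissible_mollified_cvg lamE admissible_shiftM LW LG).
Qed.

(** On a set of finite measure that carries [G], [|G| <= 1 + G ^+ 2]. *)
Lemma box_integrable G m : (lam (cube m) < +oo)%E -> L2f lamV G ->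
  (forall p, G p != 0 -> cube m p.1 /\ 0 < p.2 < T) -> lamV.-integrable setT (EFin \o G).
Proof.
move=> cfin LG Gsupp; have mG := LG.1.
have ic : lam.-integrable setT (EFin \o (\1_(cube m) : RN -> R)).
  by apply: integrable_indic_fin => //; exact: measurable_cube.
have := integrableD measurableT (integrable_tensor ic (window_integrable T)) (L2_sqr_integrable LG).
apply: le_integrable => //; first exact/measurable_EFinP.
move=> p _; rewrite /= lee_fin [leRHS]ger0_norm; last by rewrite addr_ge0 ?sqr_ge0// mulr_ge0.
have [->|/Gsupp[c pT]] := eqVneq (G p) 0; first by rewrite normr0 addr_ge0 ?sqr_ge0// mulr_ge0.
rewrite /window !indicE !mem_set//= ?in_itv// mul1r ler_norml; nra.
Qed.

Lemma extend_weak_identity (U G : V -> R) (W : mR * (RN * RN) -> R) (c : R) m :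
  (lam (cube m) < +oo)%E -> L2f lamV U -> L2f M W ->
  (forall rho, test_function T rho -> \int[lamV]_p (U p * rho p) = c * \int[M]_y (W y * tdiff rho y)) ->
  L2f lamV G -> (forall p, G p != 0 -> cube m p.1 /\ 0 < p.2 < T) -> L2f M (tdiff G) ->
  \int[lamV]_p (U p * G p) = c * \int[M]_y (W y * tdiff G y).
Proof.
move=> cfin LU LW weak LG Gsupp LDG.
have Gi := box_integrable cfin LG Gsupp.
have h1 := mollify_cvg LU LG; have h2 := tdiff_mollify_cvg Gi LW LDG.
have h3 : \int[lamV]_p (U p * mollify k G p) @[k --> \oo] --> c * \int[M]_y (W y * tdiff G y).
  rewrite (_ : (fun k => _) = (fun k => c * \int[M]_y (W y * tdiff (mollify k G) y))).
    by apply: cvgM; [exact: cvg_cst|].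
  by apply/funext => k; exact: weak (test_function_mollify k Gi Gsupp).
by apply: (cvg_unique _ h1 h3).
Qed.

End mollified_test.

(** * Cutoffs in space *)

Section cutoff.
Variables (R : realType) (N : nat).
Local Notation RN := 'rV[R]_N.
Implicit Types (x z : RN).

(** Piecewise linear in the norm: only a Lipschitz bound is asked of it, because smoothness is
    supplied by mollifying afterwards. *)
Definition cutoff n x : R := Num.max 0 (Num.min 1 (n.+1%:R - `|x|)).

Lemma cutoff_ge0 n x : 0 <= cutoff n x.
Proof. by rewrite /cutoff le_max lexx. Qed.

Lemma cutoff_le1 n x : cutoff n x <= 1.
Proof. by rewrite /cutoff ge_max ler01 ge_min lexx. Qed.

Lemma cutoff_cube n x : cutoff n x != 0 -> cube n.+1 x.
Proof.
move=> c0 i; have xn : `|x| < n.+1%:R.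
  rewrite ltNge; apply: contra c0 => nx; rewrite /cutoff; apply/eqP/max_idPl.
  by rewrite ge_min subr_le0 nx orbT.
have := le_lt_trans (rV_coord_le x i) xn.
by rewrite ltr_norml => /andP[-> /ltW ->].
Qed.

Lemma cutoff_eq1 n x : `|x| <= n%:R -> cutoff n x = 1.
Proof.
move=> xn; rewrite /cutoff (min_idPl _); last by rewrite lerBrDr addrC -natr1 lerD2r.
by apply/max_idPr.
Qed.

Lemma cutoff_cvg x : cutoff n x @[n --> \oo] --> (1 : R).
Proof.
apply: cvg_near_cst; near=> n; apply: cutoff_eq1.
near: n; exists (Num.truncn `|x|).+1 => // n /= nx.
by apply: ltW; apply: lt_le_trans (truncnS_gt `|x|) _; rewrite ler_nat.
Unshelve. all: by end_near. Qed.

Lemma measurable_cutoff n : measurable_fun setT (@cutoff n).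
Proof.
apply: measurable_maxr => //; apply: measurable_minr => //.
apply: measurable_funB => //; apply: continuous_measurable_rV.
exact: norm_continuous.
Qed.

Lemma cutoff_lipschitz n x z : `|cutoff n (x + z) - cutoff n x| <= Num.sqrt (mtrunc z).
Proof.
have m0 := mtrunc_ge0 z.
have key : `|cutoff n (x + z) - cutoff n x| <= enorm z.
  apply: le_trans (norm_le_enorm z).
  have h1 := ler_normD x z; have h2 : `|x| <= `|x + z| + `|z|.
    by have := ler_normB (x + z) z; rewrite addrK.
  move: h1 h2; rewrite /cutoff; move: (`|x + z|) (`|x|) (`|z|) (n.+1%:R : R) => a b c k h1 h2.
  by rewrite !maxEle !minEle; case: (leP 1 (k - a)) => ?; case: (leP 1 (k - b)) => ?;
    do ?[case: (leP 0 _) => ?]; rewrite ler_norml; lra.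
have key1 : `|cutoff n (x + z) - cutoff n x| <= 1.
  have := cutoff_ge0 n x; have := cutoff_le1 n x; have := cutoff_ge0 n (x + z); have := cutoff_le1 n (x + z).
  by rewrite ler_norml; lra.
rewrite -(ger0_norm (sqrtr_ge0 (mtrunc z))) -ler_sqr ?nnegrE// !real_normK ?num_real// sqr_sqrtr//.
rewrite -[leLHS]real_normK ?num_real// /mtrunc le_min.
rewrite (lerXn2r 2 _ _ key) ?nnegrE// ?enorm_ge0//=.
by rewrite -(expr1n _ 2) lerXn2r ?nnegrE.
Qed.

End cutoff.

Section cutoff_limit.
Variables (R : realType) (N : nat) (T : R).
Local Notation RN := 'rV[R]_N.
Local Notation mR := (measurableTypeR R).
Local Notation V := (RN * mR)%type.
Local Notation leb := (@lebesgue_measure R).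
Variables lam mu : {sigma_finite_measure set RN -> \bar R}.
Hypothesis lamE : lam = lebesgue_rV R N :> {measure set RN -> \bar R}.
Hypothesis lam_shift : forall a, preserves lam (fun x => x + a).
Hypothesis lam_cube : forall n, (lam (cube n) < +oo)%E.
Hypothesis mu_int : mu.-integrable setT (EFin \o @mtrunc R N).
Local Notation lamV := (sf_product lam leb).
Local Notation M := (sf_product leb (sf_product lam mu)).
Implicit Types (F U : V -> R).

Definition cut n F (p : V) : R := cutoff n p.1 * F p.

Lemma measurable_cut n F : measurable_fun setT F -> measurable_fun setT (cut n F).
Proof.
move=> mF; apply: measurable_funM => //.
exact: (measurableT_comp (@measurable_cutoff R N n) measurable_fst).
Qed.

Lemma cut_le n F p : `|cut n F p| <= `|F p|.
Proof. by rewrite normrM ger0_norm ?cutoff_ge0// ler_piMl// cutoff_le1. Qed.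

Lemma cut_L2 n F : L2f lamV F -> L2f lamV (cut n F).
Proof. by move=> LF; apply: (L2_le _ LF); [exact: measurable_cut LF.1|exact: cut_le]. Qed.

Lemma cut_cvg F p : cut n F p @[n --> \oo] --> F p.
Proof. by rewrite -[X in _ --> X]mul1r; apply: cvgM; [exact: cutoff_cvg|exact: cvg_cst]. Qed.

Lemma cut_supp n F p : (forall p, F p != 0 -> 0 < p.2 < T) -> cut n F p != 0 ->
  cube n.+1 p.1 /\ 0 < p.2 < T.
Proof. by move=> FT; rewrite mulf_eq0 negb_or => /andP[/cutoff_cube c /FT]. Qed.

Lemma cut_pairing_cvg U F : L2f lamV U -> L2f lamV F ->
  \int[lamV]_p (U p * cut n F p) @[n --> \oo] --> \int[lamV]_p (U p * F p).
Proof.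
move=> LU LF; have [mU _] := LU; have [mF _] := LF.
apply: (Rdominated_cvg (g := fun p => `|U p * F p|) _ _ _ (integrable_abse (L2_mul_integrable LU LF))).
- by move=> n; apply: measurable_funM => //; exact: measurable_cut.
- exact: measurable_funM.
- by move=> p; apply: cvgM; [exact: cvg_cst|exact: cut_cvg].
- by move=> n p; rewrite normrM [leRHS]normrM ler_wpM2l// cut_le.
Qed.

(** The majorant, independent of [n], of the part of the difference that falls on the cutoff: the
    cutoff changes by at most the square root of [mtrunc z], which is [min (enorm z) 1]. It is
    square-integrable when [F] is. *)
Definition weighted F (y : mR * (RN * RN)) : R := Num.sqrt (mtrunc y.2.2) * F (y.2.1, y.1).

Lemma weighted_L2 F : L2f lamV F -> L2f M (weighted F).
Proof.
move=> LF; have [mF _] := LF; have mw : measurable_fun setT (weighted F).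
  apply: measurable_funM.
    apply: (measurableT_comp (f := fun z : RN => Num.sqrt (mtrunc z)) (g := fun y : mR * (RN * RN) => y.2.2)).
      by apply: measurableT_comp; [exact: continuous_measurable_fun (@sqrt_continuous R)|exact: measurable_mtrunc].
    exact: (measurableT_comp measurable_snd measurable_snd).
  apply: (measurableT_comp mF (g := fun y : mR * (RN * RN) => (y.2.1, y.1))).
  apply: measurable_fun_pair; last exact: measurable_fst.
  exact: (measurableT_comp measurable_fst measurable_snd).
apply/(L2f_transports (regroup_transports lam mu) mw).
apply: integrable_L2; first exact: (measurableT_comp mw (regroup_transports lam mu).1).
have := weighted_shift_integrable lam_shift mu_int (measurable_cst (0 : RN))
  (fun p => sqr_ge0 (F p)) (L2_sqr_integrable LF).
apply: eq_integrable => // -[[x t] z] _.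
by rewrite /weighted /regroup /xshift /= exprMn sqr_sqrtr ?mtrunc_ge0// addr0.
Qed.

(** Discrete product rule: the cutoff at [x + z] multiplies the difference of [F], and the increment
    of the cutoff multiplies [F] at [x]. *)
Lemma tdiff_cut_bound n F y :
  `|tdiff (cut n F) y| <= `|tdiff F y| + `|weighted F y|.
Proof.
case: y => t [x z]; rewrite /tdiff /cut /weighted /=.
set c := cutoff n (x + z); set c' := cutoff n x; set f := F (x + z, t); set f' := F (x, t).
have -> : c * f - c' * f' = c * (f - f') + (c - c') * f' by ring.
apply: (le_trans (ler_normD _ _)); rewrite !normrM; apply: lerD.
  by rewrite [`|c|]ger0_norm ?cutoff_ge0// ler_piMl// cutoff_le1.
by rewrite ler_wpM2r// [leRHS]ger0_norm ?sqrtr_ge0// cutoff_lipschitz.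
Qed.

Lemma tdiff_cut_L2 n F : L2f lamV F -> L2f M (tdiff F) -> L2f M (tdiff (cut n F)).
Proof.
move=> LF LD; have Lw := weighted_L2 LF.
(* The factors 2 absorb the cross term: [(b + c) ^+ 2 <= (2 * b) ^+ 2 + (2 * c) ^+ 2]. *)
apply: (L2_dom _ (L2Z 2 LD) (L2Z 2 Lw)); first exact: measurable_tdiff (measurable_cut n LF.1).
move=> y; have := tdiff_cut_bound n F y.
rewrite -[tdiff (cut n F) y ^+ 2]real_normK ?num_real// -[(2 * tdiff F y) ^+ 2]real_normK ?num_real//.
rewrite -[(2 * weighted F y) ^+ 2]real_normK ?num_real//.
rewrite (normrM 2 (tdiff F y)) (normrM 2 (weighted F y)) (ger0_norm (_ : 0 <= 2))//.
set a := `|tdiff (cut n F) y|; set b := `|tdiff F y|; set c := `|weighted F y| => h.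
have : a ^+ 2 <= (b + c) ^+ 2 by rewrite lerXn2r// nnegrE ?addr_ge0// normr_ge0.
by have := sqr_ge0 (b - c); have := sqr_ge0 b; have := sqr_ge0 c; nra.
Qed.

Lemma tdiff_cut_cvg W F : L2f M W -> L2f lamV F -> L2f M (tdiff F) ->
  \int[M]_y (W y * tdiff (cut n F) y) @[n --> \oo] --> \int[M]_y (W y * tdiff F y).
Proof.
move=> LW LF LD; have Lw := weighted_L2 LF; have [mW _] := LW; have [mF _] := LF.
have i1 := integrable_abse (L2_mul_integrable LW LD).
have i2 := integrable_abse (L2_mul_integrable LW Lw).
apply: (Rdominated_cvg (g := fun y => `|W y * tdiff F y| + `|W y * weighted F y|)).
- by move=> n; apply: measurable_funM => //; exact: measurable_tdiff (measurable_cut n mF).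
- by apply: measurable_funM => //; exact: measurable_tdiff.
- move=> [t [x z]]; apply: cvgM; first exact: cvg_cst.
  by rewrite /tdiff; apply: cvgB; exact: cut_cvg.
- exact: (integrableD measurableT i1 i2).
- move=> n y; rewrite (normrM _ (tdiff F y)) (normrM _ (weighted F y)) (normrM _ (tdiff _ y)) -mulrDr.
  by rewrite ler_wpM2l// tdiff_cut_bound.
Qed.

Lemma weak_identity_L2 U F W (c : R) : L2f lamV U -> L2f M W ->
  (forall rho, test_function T rho -> \int[lamV]_p (U p * rho p) = c * \int[M]_y (W y * tdiff rho y)) ->
  L2f lamV F -> (forall p, F p != 0 -> 0 < p.2 < T) -> L2f M (tdiff F) ->
  \int[lamV]_p (U p * F p) = c * \int[M]_y (W y * tdiff F y).
Proof.
move=> LU LW weak LF FT LD.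
have h1 := cut_pairing_cvg LU LF; have h2 := tdiff_cut_cvg LW LF LD.
have h3 : \int[lamV]_p (U p * cut n F p) @[n --> \oo] --> c * \int[M]_y (W y * tdiff F y).
  rewrite (_ : (fun n => _) = (fun n => c * \int[M]_y (W y * tdiff (cut n F) y))).
    by apply: cvgM; [exact: cvg_cst|].
  apply/funext => n; apply: (extend_weak_identity lamE lam_shift (lam_cube n.+1) LU LW weak).
  - exact: cut_L2.
  - by move=> p; exact: cut_supp.
  - exact: tdiff_cut_L2.
by apply: (cvg_unique _ h1 h3).
Qed.

(** [U] itself becomes the test function, through cutoff and mollification; in the limit the
    integral of [U ^+ 2] is 0. *)
Lemma weak_zero U : L2f lamV U -> (forall p, U p != 0 -> 0 < p.2 < T) ->
  (forall rho, test_function T rho -> \int[lamV]_p (U p * rho p) = 0) ->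
  {ae lamV, forall p, U p = 0}.
Proof.
move=> LU UT weak; have [mU _] := LU.
have cut0 n : \int[lamV]_p (U p * cut n U p) = 0.
  have Gi := box_integrable (lam_cube n.+1) (cut_L2 n LU) (fun p => @cut_supp n U p UT).
  have h1 := mollify_cvg lamE LU (cut_L2 n LU).
  have h2 : \int[lamV]_p (U p * mollify lam k (cut n U) p) @[k --> \oo] --> (0 : R).
    rewrite (_ : (fun k => _) = (fun k => 0)); first exact: cvg_cst.
    by apply/funext => k; exact: weak (test_function_mollify lam_shift k Gi (fun p => @cut_supp n U p UT)).
  by apply: (cvg_unique _ h1 h2).
have : \int[lamV]_p (U p * U p) = 0.
  have h1 := cut_pairing_cvg LU LU.
  have h2 : \int[lamV]_p (U p * cut n U p) @[n --> \oo] --> (0 : R).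
    by rewrite (_ : (fun n => _) = (fun n => 0)); [exact: cvg_cst|exact/funext].
  by apply: (cvg_unique _ h1 h2).
move=> E; have iU := L2_sqr_integrable LU.
have mU2 : measurable_fun setT (fun p => (U p ^+ 2)%:E).
  by apply/measurable_EFinP; exact: measurable_funX.
have : (\int[lamV]_p `|(U p ^+ 2)%:E| = 0)%E.
  under eq_integral => p _ do rewrite gee0_abs ?lee_fin ?sqr_ge0//.
  rewrite -[LHS]fineK; last exact: integrable_fin_num iU.
  by move: E; rewrite /Rintegral; under eq_integral => p _ do rewrite -expr2; move=> ->.
move=> /(ae_eq_integral_abs _ measurableT mU2); apply: filterS => p /(_ I) [] /eqP.
by rewrite sqrf_eq0 => /eqP.
Qed.

End cutoff_limit.

(** * From Q_T to the whole of space-time *)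

Section restriction_to_QT.
Variables (R : realType) (N : nat) (T : R).
Local Notation RN := 'rV[R]_N.
Local Notation mR := (measurableTypeR R).
Local Notation V := (RN * mR)%type.
Local Notation leb := (@lebesgue_measure R).
Variables lam : {sigma_finite_measure set RN -> \bar R}.
Hypothesis lamE : lam = lebesgue_rV R N :> {measure set RN -> \bar R}.
Local Notation lamV := (sf_product lam leb).
Local Notation mQ := (@measurable_QT R N T).
Local Notation lebQ := (@lebesgue_QT R N T).
Implicit Types (f : V -> R).

Lemma lebesgue_QTE (A : set V) : lebQ A = lamV (A `&` @QT R N T).
Proof. by rewrite /lebesgue_QT /mrestr -lamE. Qed.

(** Extension by zero in time turns statements on Q_T into statements on a genuine product space,
    where Tonelli and translations apply. *)
Definition restrict_QT f (p : V) : R := window T p.2 * f p.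

Lemma window_QT (p : V) : window T p.2 = \1_(@QT R N T : set V) p.
Proof.
by rewrite /window !indicE; congr (nat_of_bool _)%:R.
Qed.

Lemma restrict_QT_neq0 f p : restrict_QT f p != 0 -> 0 < p.2 < T.
Proof. by rewrite mulf_eq0 negb_or => /andP[/window_neq0]. Qed.

Lemma restrict_QT_eq0 f (p : V) : ~~ (0 < p.2 < T) -> restrict_QT f p = 0.
Proof. by move=> h; apply/eqP; apply: contraNT h => /restrict_QT_neq0. Qed.

Lemma restrict_QT_in f (p : V) : 0 < p.2 < T -> restrict_QT f p = f p.
Proof. by move=> pT; rewrite /restrict_QT window_QT indicE mem_set// mul1r. Qed.

Lemma measurable_restrict_QT f : measurable_fun setT f -> measurable_fun setT (restrict_QT f).
Proof.
move=> mf; apply: measurable_funM => //; apply: (measurableT_comp _ measurable_snd).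
by apply: measurable_indic; exact: measurable_itv.
Qed.

Lemma restrict_QT_patch f (p : V) : (restrict_QT f p)%:E = ((EFin \o f) \_ (@QT R N T : set V)) p.
Proof.
by rewrite /restrict_QT window_QT indicE patchE; case: ifP => _ /=; rewrite ?mul1r ?mul0r.
Qed.

Lemma ge0_integral_QT (f : V -> \bar R) : measurable_fun setT f -> (forall p, (0 <= f p)%E) ->
  (\int[lebQ]_p f p = \int[lamV]_(p in @QT R N T) f p)%E.
Proof.
move=> mf f0.
have mC : measurable (~` (@QT R N T : set V)) by apply: measurableC; exact: mQ.
rewrite -(setUv (@QT R N T : set V)) ge0_integral_setU//=; last 3 first.
- exact: mQ.
- by rewrite setUv.
- by apply/disj_set2P; rewrite setICr.
rewrite [X in (_ + X)%E = _](_ : _ = 0%E); last first.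
  by apply: null_set_integral => //; [exact: measurable_funTS|rewrite [LHS]lebesgue_QTE setICl measure0].
rewrite adde0; apply: eq_measure_integral => A mA AQ.
rewrite [LHS]lebesgue_QTE; congr (lamV _).
by apply/seteqP; split => [p []//|p Ap]; split => //; exact: AQ.
Qed.

Lemma integral_QT (f : V -> \bar R) : lebQ.-integrable setT f ->
  lamV.-integrable setT (f \_ (@QT R N T : set V)) /\
  (\int[lebQ]_p f p = \int[lamV]_p (f \_ (@QT R N T : set V)) p)%E.
Proof.
move=> fi; have mf := measurable_int _ fi; split.
  apply/(integrable_mkcond _ _).1; first exact: mQ.
  apply/integrableP; split; first exact: measurable_funTS.
  by rewrite -ge0_integral_QT//; [have /integrableP[] := fi|exact: measurableT_comp].
rewrite [LHS]integralE; apply: etrans _ (integral_mkcond (@QT R N T : set V) f).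
rewrite [RHS]integralE; congr (_ - _)%E.
- exact: (ge0_integral_QT (measurable_funepos mf) (@funepos_ge0 _ _ f)).
- exact: (ge0_integral_QT (measurable_funeneg mf) (@funeneg_ge0 _ _ f)).
Qed.

Lemma integrable_restrict_QT f : lebQ.-integrable setT (EFin \o f) ->
  lamV.-integrable setT (EFin \o restrict_QT f).
Proof.
move=> /integral_QT[+ _]; apply: eq_integrable => // p _.
by rewrite -restrict_QT_patch.
Qed.

Lemma Rintegral_QT f : lebQ.-integrable setT (EFin \o f) ->
  \int[lebQ]_p f p = \int[lamV]_p restrict_QT f p.
Proof.
move=> /integral_QT[_ E]; rewrite /Rintegral; congr fine; apply: (etrans E).
by apply: eq_integral => p _; rewrite -restrict_QT_patch.
Qed.

Lemma ae_restrict_QT (P : V -> Prop) : {ae lebQ, forall p, P p} ->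
  {ae lamV, forall p, 0 < p.2 < T -> P p}.
Proof.
move=> [A [mA A0 PA]]; exists (A `&` (@QT R N T : set V)); split.
- by apply: measurableI => //; exact: mQ.
- by rewrite -[LHS]lebesgue_QTE.
by move=> p /= np; apply: contrapT => nA; apply: np => pT; apply: contrapT => nP; apply: nA; split => //; exact: PA.
Qed.

Lemma ae_QT (P : V -> Prop) : {ae lamV, forall p, 0 < p.2 < T -> P p} ->
  {ae lebQ, forall p, P p}.
Proof.
move=> [A [mA A0 PA]]; exists (A `|` ~` (@QT R N T : set V)); split.
- by apply: measurableU => //; apply: measurableC; exact: mQ.
- rewrite [LHS]lebesgue_QTE setIUl setICl setU0; apply/eqP; rewrite eq_le measure_ge0 andbT -A0.
  by apply: le_measure; rewrite ?inE//; apply: measurableI => //; exact: mQ.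
move=> p /= nP; have [pT|pT] := boolP (0 < p.2 < T); last by right; rewrite /QT /=; exact/negP.
by left; apply: PA => /= h; apply: nP; exact: h.
Qed.

Lemma Lfun_oo_ae f : f \in Lfun lebQ +oo%E -> exists2 C : R, 0 <= C & {ae lebQ, forall p, `|f p| <= C}.
Proof.
rewrite inE => /andP[_]; rewrite inE /= /finite_norm unlock /=; case: ifPn => [m0 Eoo|m0 _].
  have E1 := @ess_sup_inf.ess_sup_ge _ _ R lebQ (abse \o (EFin \o f)).
  set E := ess_sup_inf.ess_sup _ _ in Eoo E1.
  exists (fine (maxe 0%E E)); first by rewrite fine_ge0// le_max lexx.
  apply: filterS E1 => p /= fE; rewrite -lee_fin fineK ?le_max ?fE ?orbT//.
  by rewrite ge0_fin_numE ?gt_max ?Eoo ?ltry// le_max lexx.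
(* If Q_T had measure zero, the essential supremum norm would be 0 by convention; the bound 0 is
   then right because every set is null. *)
exists 0 => //; exists setT; split => //; apply/eqP; rewrite eq_le measure_ge0 andbT.
by rewrite leNgt.
Qed.

Lemma Lfun2_L2 f : f \in Lfun lebQ 2%:E -> L2f lamV (restrict_QT f).
Proof.
move=> f2; have mf : measurable_fun setT f by move: f2; rewrite inE => /andP[]; rewrite inE.
apply: integrable_L2; first exact: measurable_restrict_QT.
have := integrable_restrict_QT (Lfun2_integrable_sqr f2); apply: eq_integrable => // p _ /=.
by rewrite /restrict_QT exprMn window_QT indicE; case: (_ \in _); rewrite ?expr1n// expr0n.
Qed.

(** Tonelli on each time slice turns the energy seminorm into an L2 norm of [tdiff]. The restriction
    to [0 < enorm z] disappears because the difference is 0 at [z = 0], and times outside (0,T)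
    contribute nothing. *)
Lemma seminormTE_restrict (mu : {sigma_finite_measure set RN -> \bar R}) f :
  measurable_fun setT f ->
  seminormTE mu T f = sqrte ((2^-1)%:E *
    \int[sf_product leb (sf_product lam mu)]_y (tdiff (restrict_QT f) y ^+ 2)%:E)%E.
Proof.
move=> mf; rewrite /seminormTE; congr sqrte.
have mr := measurable_restrict_QT mf; have mt := measurable_tdiff mr.
have mt2 : measurable_fun setT (fun y => (tdiff (restrict_QT f) y ^+ 2)%:E).
  by apply/measurable_EFinP; exact: measurable_funX.
have t0 y : (0 <= (tdiff (restrict_QT f) y ^+ 2)%:E)%E by rewrite lee_fin sqr_ge0.
pose h (t : mR) : \bar R := (\int[sf_product lam mu]_w (tdiff (restrict_QT f) (t, w) ^+ 2)%:E)%E.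
have -> : (\int[sf_product leb (sf_product lam mu)]_y (tdiff (restrict_QT f) y ^+ 2)%:E = \int[leb]_t h t)%E.
  exact: (@fubini_tonelli1 _ _ _ _ _ leb (sf_product lam mu) _ mt2 t0).
have h0 t : (0 <= h t)%E by exact: integral_ge0.
have mh : measurable_fun setT h.
  exact: (@measurable_fun_fubini_tonelli_F _ _ _ _ _ (sf_product lam mu) _ mt2 t0).
rewrite -ge0_integralZl//.
apply: etrans (integral_mkcond _ _) _; apply: eq_integral => t _; rewrite patchE.
case: ifPn => tT; last first.
  rewrite (_ : h t = 0%E) ?mule0// /h; under eq_integral => w _.
    rewrite /tdiff !restrict_QT_eq0 ?subrr ?expr0n /=; last 2 first.
    - by move: tT; rewrite notin_setE /= in_itv /= => /negP.
    - by move: tT; rewrite notin_setE /= in_itv /= => /negP.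
    over.
  by rewrite integral0.
have {}tT : 0 < t < T by move: tT; rewrite inE /= in_itv.
rewrite /seminormE_sqr -lamE; congr (_ * _)%E.
have mtt : measurable_fun setT (fun w : RN * RN => (tdiff (restrict_QT f) (t, w) ^+ 2)%:E).
  exact: (measurableT_comp mt2 (pair1_measurable (t : mR))).
have -> : h t = (\int[lam]_x \int[mu]_z (tdiff (restrict_QT f) (t, (x, z)) ^+ 2)%:E)%E.
  exact: (@fubini_tonelli1 _ _ _ _ _ lam mu _ mtt (fun w => t0 (t, w))).
apply: eq_integral => x _; rewrite integral_mkcond; apply: eq_integral => z _.
rewrite patchE /tdiff /= !restrict_QT_in//; case: ifPn => [_|].
  by rewrite real_normK// num_real.
rewrite notin_setE /= => /negP; rewrite -leNgt => z0.
suff -> : z = 0 by rewrite addr0 subrr expr0n.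
apply/eqP; rewrite -normr_le0; exact: le_trans (norm_le_enorm z) z0.
Qed.

End restriction_to_QT.

(** * Uniqueness *)

Section levy_measure.
Variables (R : realType) (N : nat).
Local Notation RN := 'rV[R]_N.
Variable mu : {measure set RN -> \bar R}.

Lemma levy_mtrunc_integrable : levy_condition mu -> mu.-integrable setT (EFin \o @mtrunc R N).
Proof.
move=> levy; have mA : measurable [set z : RN | enorm z <= 1] by exact: measurable_unit_ball.
have CA : ~` [set z : RN | enorm z <= 1] = [set z | 1 < enorm z].
  by apply/seteqP; split => z /=; rewrite ltNge => /negP.
have mB : measurable [set z : RN | 1 < enorm z] by rewrite -CA; exact: measurableC.
have mm : measurable_fun setT (EFin \o @mtrunc R N) by apply/measurable_EFinP; exact: measurable_mtrunc.
have mabs : measurable_fun setT (fun z : RN => `|mtrunc z|%:E).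
  by apply/measurable_EFinP; apply: measurableT_comp => //; exact: measurable_mtrunc.
apply/integrableP; split => //; apply: le_lt_trans levy.
rewrite -(setUv [set z : RN | enorm z <= 1]) CA ge0_integral_setU//=; last 2 first.
- by rewrite -CA setUv.
- by apply/disj_set2P; rewrite -CA setICr.
apply: leeD; apply: ge0_le_integral => //.
- exact: measurable_funTS.
- apply: measurable_funTS; apply/measurable_EFinP; under eq_fun do rewrite enorm_sqr.
  by apply: measurable_sum => i; apply: measurable_funX; exact: measurable_coord.
- by move=> z _; rewrite lee_fin ger0_norm ?mtrunc_ge0// ge_min lexx.
- exact: measurable_funTS.
- by move=> z _; rewrite lee_fin ger0_norm ?mtrunc_ge0// ge_min lexx orbT.
Qed.

Lemma mtrunc_eq0 (z : RN) : mtrunc z = 0 -> z = 0.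
Proof.
move=> m0; apply/eqP; rewrite -normr_le0; apply: le_trans (norm_le_enorm z) _.
rewrite leNgt; apply/negP => z0; move: m0; rewrite /mtrunc minEle; case: ifP => _.
  by move/eqP; rewrite sqrf_eq0 gt_eqF.
by move/eqP; rewrite oner_eq0.
Qed.

(** By Chebyshev, the set where [mtrunc] is at least the inverse of [k + 1] has finite measure.
    These sets exhaust everything except the origin, which is null and is added to each of them. *)
Lemma levy_sigma_finite : mu [set 0] = 0%E -> levy_condition mu -> sigma_finite setT mu.
Proof.
move=> mu0 /levy_mtrunc_integrable/integrableP[mm moo].
pose A k := [set z : RN | k.+1%:R^-1 <= mtrunc z].
have mA k : measurable (A k).
  rewrite -[A k]setTI; apply: (@measurable_fun_le _ _ _ setT (cst k.+1%:R^-1) (@mtrunc R N)) => //.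
  exact/measurable_EFinP.
have m0 : measurable [set (0 : RN)].
  rewrite (_ : [set 0] = \bigcap_(i in [set: 'I_N]) ((fun v : RN => v ord0 i) @^-1` [set 0])).
    apply: fin_bigcap_measurable => // i _; rewrite -[X in measurable X]setTI.
    exact: measurable_coord.
  apply/seteqP; split => [z -> i _ /=|z H /=]; first by rewrite mxE.
  by apply/rowP => i; rewrite mxE; exact: H.
exists (fun k => [set 0] `|` A k).
  apply/seteqP; split => // z _; have [->|z0] := eqVneq z 0; first by exists 0%N => //; left.
  have mz : 0 < mtrunc z.
    by rewrite lt_def mtrunc_ge0 andbT; apply: contra z0 => /eqP/mtrunc_eq0 ->.
  exists (Num.truncn (mtrunc z)^-1) => //; right.
  by rewrite /A /= invf_ple ?posrE// ltW// truncnS_gt.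
move=> k; split; first exact: measurableU.
rewrite setUC measureU0//.
have k0 : 0 < k.+1%:R^-1 :> R by rewrite invr_gt0.
have : (k.+1%:R^-1%:E * mu (A k) < +oo)%E.
  apply: le_lt_trans moo; rewrite -integral_cst//.
  apply: (@le_trans _ _ (\int[mu]_(z in A k) `|(mtrunc z)%:E|)%E).
    apply: ge0_le_integral => //.
    - by move=> z _; rewrite lee_fin ltW.
    - by apply: measurable_funTS; exact: measurableT_comp.
    - by move=> z /= Az; rewrite lee_fin ger0_norm ?mtrunc_ge0.
  by apply: ge0_subset_integral => //; exact: measurableT_comp.
move=> h; rewrite ltNge leye_eq; apply/negP => /eqP E.
by move: h; rewrite E mulry gtr0_sg// mul1e ltxx.
Qed.

Lemma even_preserves : even_measure mu -> preserves mu (fun z : RN => - z).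
Proof.
move=> ev; split.
  apply: measurable_fun_rV => i; under eq_fun do rewrite mxE.
  by apply: measurableT_comp => //; exact: measurable_coord.
move=> A mA; rewrite (ev _ mA); congr (mu _); apply/seteqP; split => [z Az|z [y Ay <-]] /=.
  by exists (- z); rewrite ?opprK.
by rewrite opprK.
Qed.

End levy_measure.

Lemma ae_conj d (Y : measurableType d) (R : realType) (m : {measure set Y -> \bar R}) (P Q : Y -> Prop) :
  {ae m, forall y, P y} -> {ae m, forall y, Q y} -> {ae m, forall y, P y /\ Q y}.
Proof. by move=> hP hQ; apply: filterS2 hP hQ. Qed.

Lemma L2_mul_cvg0 d (Y : measurableType d) (R : realType) (m : {measure set Y -> \bar R})
    (w : Y -> R) (D : nat -> Y -> R) : L2f m w -> (forall n, L2f m (D n)) ->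
  sqn m (D n) @[n --> \oo] --> (0 : R) ->
  \int[m]_y (w y * D n y) @[n --> \oo] --> (0 : R).
Proof.
move=> Lw Ld D0; apply/cvgrPdist_lt => e e0.
have w1 : 0 < sqn m w + 1 by rewrite ltr_wpDl// sqn_ge0.
pose k := e / 2 / (sqn m w + 1); have k0 : 0 < k by rewrite !divr_gt0.
have ke : 0 < k * (e / 2) by rewrite mulr_gt0// divr_gt0.
move/cvgrPdist_lt : D0 => /(_ _ ke); apply: filterS => n.
rewrite !sub0r !normrN (ger0_norm (sqn_ge0 _ _)) => Dn.
apply: (le_lt_trans (L2_mul_le k0 Lw (Ld n))).
have kE : k * (sqn m w + 1) = e / 2 by rewrite /k divfK// gt_eqF.
have h2 : k^-1 * sqn m (D n) < e / 2 by rewrite mulrC ltr_pdivrMr// mulrC.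
by move: kE; rewrite mulrDr mulr1; lra.
Qed.

Lemma ae_impl d (Y : measurableType d) (R : realType) (m : {measure set Y -> \bar R}) (P Q : Y -> Prop) :
  (forall y, P y -> Q y) -> {ae m, forall y, P y} -> {ae m, forall y, Q y}.
Proof. by move=> PQ; apply: filterS. Qed.

Section uniqueness.
Variables (R : realType) (N : nat) (T : R).
Hypothesis T_gt0 : 0 < T.
Local Notation RN := 'rV[R]_N.
Local Notation mR := (measurableTypeR R).
Local Notation V := (RN * mR)%type.
Local Notation leb := (@lebesgue_measure R).
Variables lam mu : {sigma_finite_measure set RN -> \bar R}.
Hypothesis lamE : lam = lebesgue_rV R N :> {measure set RN -> \bar R}.
Hypothesis lam_shift : forall a, preserves lam (fun x => x + a).
Hypothesis lam_cube : forall n, (lam (cube n) < +oo)%E.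
Hypothesis mu_even : preserves mu (fun z => - z).
Hypothesis mu_int : mu.-integrable setT (EFin \o @mtrunc R N).
Local Notation lamV := (sf_product lam leb).
Local Notation lebQ := (@lebesgue_QT R N T).
Local Notation M := (sf_product leb (sf_product lam mu)).
Variable phi : R -> R.
Hypothesis phi_cont : continuous phi.
Hypothesis phi_nd : {homo phi : x y / x <= y}.
Implicit Types (u v w : V -> R).

Lemma measurable_Lfun w p : w \in Lfun lebQ p -> measurable_fun setT w.
Proof. by rewrite inE => /andP[]; rewrite inE. Qed.

Lemma measurable_phi w : measurable_fun setT w -> measurable_fun setT (phi \o w).
Proof. by move=> mw; apply: measurableT_comp => //; exact: continuous_measurable_fun. Qed.

Lemma phi_bounded (C s : R) : `|s| <= C -> `|phi s| <= `|phi C| + `|phi (- C)|.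
Proof.
rewrite ler_norml => /andP[/phi_nd h1 /phi_nd h2].
have := ler_norm (phi C); have := ler_norm (- phi (- C)); rewrite normrN.
have := normr_ge0 (phi C); have := normr_ge0 (phi (- C)).
by rewrite ler_norml; lra.
Qed.

Lemma energy_L2 w : measurable_fun setT w -> L2E mu T (phi \o w) ->
  L2f M (tdiff (restrict_QT T (phi \o w))).
Proof.
move=> mw [_]; have mp := measurable_phi mw.
rewrite (seminormTE_restrict T lamE mu mp) => h.
split; first exact: measurable_tdiff (measurable_restrict_QT T mp).
rewrite ltNge leye_eq; apply/negP => /eqP E; move: h.
by rewrite E mulry gtr0_sg ?invr_gt0// mul1e /= ltxx.
Qed.

Lemma restrict_QTB f g : restrict_QT T (fun p : V => f p - g p) =
  (fun p => restrict_QT T f p - restrict_QT T g p).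
Proof. by apply/funext => p; rewrite /restrict_QT mulrBr. Qed.

Lemma tdiffB (f g : V -> R) : tdiff (fun p => f p - g p) = (fun y => tdiff f y - tdiff g y).
Proof. by apply/funext => y; rewrite /tdiff; ring. Qed.

(** Both equations are tested with the time primitive of [rho], whose time derivative is [- rho] on
    Q_T. The initial terms are the same number for the two solutions and cancel. *)
Lemma weak_difference (u0 : RN -> R) u v rho :
  u \in Lfun lebQ 1%E -> v \in Lfun lebQ 1%E ->
  distributional_solution mu T phi u0 u -> distributional_solution mu T phi u0 v ->
  test_function T rho ->
  let L p := levy_op mu (fun x => time_primitive T rho (x, p.2)) p.1 in
  let U := restrict_QT T (fun p => u p - v p) in
  let F := restrict_QT T (fun p => phi (u p) - phi (v p)) in
  lamV.-integrable setT (fun p => (F p * L p)%:E) /\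
  \int[lamV]_p (U p * rho p) = \int[lamV]_p (F p * L p).
Proof.
move=> u1 v1 [_ su] [_ sv] trho L U F; have [srho [crho _]] := trho; have cc : smooth_cc rho by [].
have tpsi := test_function_time_primitive trho.
have [giu eu] := su _ tpsi; have [giv ev] := sv _ tpsi.
set gu := fun p => u p * _ + _ in giu eu; set gv := fun p => v p * _ + _ in giv ev.
have iu := integrable_restrict_QT lamE giu; have iv := integrable_restrict_QT lamE giv.
have Ui : lamV.-integrable setT (EFin \o U).
  apply: (integrable_restrict_QT lamE).
  have := integrableB measurableT ((Lfun1_integrable _ _).1 u1) ((Lfun1_integrable _ _).1 v1).
  by apply: eq_integrable.
have [C C0 HC] := smooth_cc_bounded cc.
have mrho : measurable_fun setT (rho : V -> R).
  exact: continuous_measurable_spacetime (smooth_continuous srho).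
have Uri : lamV.-integrable setT (fun p => (U p * rho p)%:E).
  have rC : {ae lamV, forall p, `|rho p| <= C} by exact: aeW.
  have := ae_bounded_mul_integrable mrho rC Ui.
  by apply: eq_integrable => // p _; rewrite mulrC.
have E p : F p * L p = (restrict_QT T gu p - restrict_QT T gv p) + U p * rho p.
  have [pT|pT] := boolP (0 < p.2 < T); last by rewrite /F /U !restrict_QT_eq0// !mul0r subr0 addr0.
  rewrite /F /U !restrict_QT_in// /gu /gv time_primitive_derive//; last by case/andP: pT => /ltW.
  by rewrite /L; ring.
have ii := integrableB measurableT iu iv.
have eqi : lamV.-integrable setT (fun p => (F p * L p)%:E).
  by have := integrableD measurableT ii Uri; apply: eq_integrable => // p _; rewrite E.
split => //; under [RHS]eq_Rintegral => p _ do rewrite E.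
rewrite (RintegralD measurableT ii Uri) (RintegralB measurableT iu iv).
rewrite -!(Rintegral_QT lamE)//; move: eu ev => /eqP; rewrite addr_eq0 => /eqP eu /eqP.
by rewrite addr_eq0 => /eqP ev; rewrite [X in X - _]eu [X in _ - X]ev subrr add0r.
Qed.

(** * Comparison of two solutions *)

Section two_solutions.
Variables (u0 : RN -> R) (u v : V -> R).
Hypotheses (u1 : u \in Lfun lebQ 1%E) (v1 : v \in Lfun lebQ 1%E).
Hypotheses (uoo : u \in Lfun lebQ +oo%E) (voo : v \in Lfun lebQ +oo%E).
Hypotheses (su : distributional_solution mu T phi u0 u) (sv : distributional_solution mu T phi u0 v).
Hypotheses (eu : L2E mu T (phi \o u)) (ev : L2E mu T (phi \o v)).

Let U := restrict_QT T (fun p => u p - v p).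
Let F := restrict_QT T (fun p => phi (u p) - phi (v p)).
Let W := volterra T (tdiff F).

Let measurable_u : measurable_fun setT u. Proof. exact: measurable_Lfun u1. Qed.
Let measurable_v : measurable_fun setT v. Proof. exact: measurable_Lfun v1. Qed.

Let mF : measurable_fun setT F.
Proof.
by apply: measurable_restrict_QT; apply: measurable_funB; exact: measurable_phi.
Qed.

Let Ui : lamV.-integrable setT (EFin \o U).
Proof.
apply: (integrable_restrict_QT lamE).
have := integrableB measurableT ((Lfun1_integrable _ _).1 u1) ((Lfun1_integrable _ _).1 v1).
by apply: eq_integrable.
Qed.

Let mU : measurable_fun setT U.
Proof. by apply/measurable_EFinP; have := measurable_int _ Ui; apply. Qed.

Let F_supp (p : V) : ~~ (0 < p.2 < T) -> F p = 0. Proof. exact: restrict_QT_eq0. Qed.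

Lemma ae_bounded_pair : exists C : R, [/\ 0 <= C, {ae lamV, forall p, `|U p| <= C} &
  {ae lamV, forall p, `|F p| <= C}].
Proof.
have [A A0 /(ae_restrict_QT lamE) HA] := Lfun_oo_ae uoo.
have [B B0 /(ae_restrict_QT lamE) HB] := Lfun_oo_ae voo.
pose K c := `|phi c| + `|phi (- c)|; have K0 c : 0 <= K c by rewrite addr_ge0.
exists (A + B + (K A + K B)); split; first by rewrite !addr_ge0.
- apply: filterS (ae_conj HA HB) => p [hA hB]; have [pT|pT] := boolP (0 < p.2 < T); last first.
    by rewrite /U restrict_QT_eq0// normr0 !addr_ge0.
  rewrite /U restrict_QT_in// (le_trans (ler_normB _ _))// (@le_trans _ _ (A + B))//.
    by rewrite lerD ?hA ?hB.
  by rewrite lerDl addr_ge0.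
apply: filterS (ae_conj HA HB) => p [hA hB]; have [pT|pT] := boolP (0 < p.2 < T); last first.
  by rewrite /F restrict_QT_eq0// normr0 !addr_ge0.
rewrite /F restrict_QT_in// (le_trans (ler_normB _ _))// (@le_trans _ _ (K A + K B))//.
  by rewrite lerD// phi_bounded ?hA ?hB.
by rewrite lerDr addr_ge0.
Qed.

Let LD : L2f M (tdiff F).
Proof.
rewrite /F restrict_QTB tdiffB.
by apply: L2B; apply: energy_L2.
Qed.

Let LW : L2f M W. Proof. exact: L2_volterra. Qed.

Let LU : L2f lamV U.
Proof.
have [C [C0 UC _]] := ae_bounded_pair.
apply: integrable_L2 => //.
by have := ae_bounded_mul_integrable mU UC Ui; apply: eq_integrable => // p _; rewrite expr2.
Qed.

Lemma weak_volterra rho : test_function T rho ->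
  \int[lamV]_p (U p * rho p) = - 2^-1 * \int[M]_y (W y * tdiff rho y).
Proof.
move=> trho; have [_ ->] := weak_difference u1 v1 su sv trho.
have [C [_ _ FC]] := ae_bounded_pair.
exact: (energy_identity lam_shift lam_cube mu_even mu_int mF FC F_supp LD trho).
Qed.

Lemma pairing_uniqueness :
  \int[lamV]_p (U p * F p) = - 2^-1 * \int[M]_y (W y * tdiff F y) ->
  {ae lebQ, forall p, u p = v p}.
Proof.
move=> E; have E0 : \int[lamV]_p (U p * F p) <= 0.
  rewrite E mulNr oppr_le0 mulr_ge0// /W.
  exact: (energy_pairing_ge0 T_gt0 F_supp LD).
have UF0 p : 0 <= U p * F p.
  have [pT|pT] := boolP (0 < p.2 < T); last by rewrite F_supp// mulr0.
  rewrite /U /F !restrict_QT_in//; have [uv|vu] := leP (u p) (v p).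
    by rewrite mulr_le0// subr_le0// phi_nd.
  by rewrite mulr_ge0// subr_ge0 ?phi_nd// ltW.
have [C [C0 UC FC]] := ae_bounded_pair.
have UFi : lamV.-integrable setT (fun p => (U p * F p)%:E).
  by have := ae_bounded_mul_integrable mF FC Ui; apply: eq_integrable => // p _; rewrite mulrC.
have mUF := measurable_int _ UFi.
have : (\int[lamV]_p `|(U p * F p)%:E| = 0)%E.
  under eq_integral => p _ do rewrite gee0_abs ?lee_fin//.
  rewrite -[LHS]fineK; last exact: integrable_fin_num UFi.
  congr (_%:E); apply/eqP; rewrite eq_le E0.
  by apply: Rintegral_ge0 => p _; exact: UF0.
move=> /(ae_eq_integral_abs _ measurableT mUF) UFae.
have Fae : {ae lamV, forall p, F p = 0}.
  (* Where [U] vanishes the two solutions agree, hence so do their images under [phi], and [F] is 0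
     in either case. The converse fails where [phi] is constant, so [U = 0] still has to come from
     the equation. *)
  apply: filterS UFae => p /(_ I) [] /eqP; rewrite mulf_eq0 => /orP[/eqP U0|/eqP//].
  have [pT|/F_supp//] := boolP (0 < p.2 < T).
  by move: U0; rewrite /U /F !restrict_QT_in// => /subr0_eq ->; rewrite subrr.
have Uae : {ae lamV, forall p, U p = 0}.
  apply: (weak_zero lamE lam_shift lam_cube LU (@restrict_QT_neq0 _ _ _ _)) => rho trho.
  have [FLi ->] := weak_difference u1 v1 su sv trho.
  rewrite (@ae_eq_Rintegral _ _ _ _ _ (fun=> 0)); first by rewrite Rintegral_cst// mul0r.
  - by apply/measurable_EFinP; have := measurable_int _ FLi.
  - exact: measurable_cst.
  - by apply: filterS Fae => p F0 _; rewrite [X in X * _]F0 mul0r.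
apply: (ae_QT lamE); apply: filterS Uae => p U0 pT.
by move: U0; rewrite /U restrict_QT_in// => /subr0_eq.
Qed.

Lemma uniqueness_L2 : L2f lamV F -> {ae lebQ, forall p, u p = v p}.
Proof.
move=> LF; apply: pairing_uniqueness.
apply: (weak_identity_L2 lamE lam_shift lam_cube mu_int LU LW weak_volterra LF) => //.
by move=> p; exact: restrict_QT_neq0.
Qed.

Let W_supp (y : mR * (RN * RN)) : ~~ (0 < y.1 < T) -> W y = 0.
Proof.
move=> yT; rewrite /W /volterra /kernel_integral; under eq_Rintegral => s _.
  rewrite /ordered (_ : [&& _, _ & _] = false) ?mul0r; first over.
  apply: contraNF yT => /and3P[s0 st ->]; rewrite andbT; exact: lt_trans st.
by rewrite Rintegral_cst// mul0r.
Qed.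

(** The two convergences in the definition of X match the two sides: [u - v] is integrable, so weak
    convergence against L^1 handles the left one, and convergence in energy handles the pairing with
    [W], which is in L2. *)
Lemma pairing_X f : measurable_fun setT f -> L2f M (tdiff (restrict_QT T f)) -> spaceX mu T f ->
  \int[lamV]_p (U p * restrict_QT T f p) = - 2^-1 * \int[M]_y (W y * tdiff (restrict_QT T f) y).
Proof.
move=> mf Lf [foo _ [psi [tpsi Epsi wpsi]]].
have uvi : lebQ.-integrable setT (EFin \o (fun p => u p - v p)).
  have := integrableB measurableT ((Lfun1_integrable _ _).1 u1) ((Lfun1_integrable _ _).1 v1).
  by apply: eq_integrable.
have uv1 : (fun p => u p - v p) \in Lfun lebQ 1%E by apply/Lfun1_integrable.
have cc n : smooth_cc (psi n) by have [? []] := tpsi n.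
have mpsi n : measurable_fun setT (psi n : V -> R).
  exact: continuous_measurable_spacetime (smooth_continuous (cc n).1).
have conv (g : V -> R) (C : R) : measurable_fun setT g -> {ae lebQ, forall p, `|g p| <= C} ->
    \int[lebQ]_p (g p * (u p - v p)) = \int[lamV]_p (U p * restrict_QT T g p).
  move=> mg gC; rewrite (Rintegral_QT lamE); last exact: (ae_bounded_mul_integrable mg gC uvi).
  apply: eq_Rintegral => p _; have [pT|pT] := boolP (0 < p.2 < T).
    by rewrite /U !restrict_QT_in// mulrC.
  by rewrite /U !restrict_QT_eq0// mul0r.
have [C _ fC] := Lfun_oo_ae foo.
have h1 := wpsi _ uv1; rewrite (conv f C mf fC) in h1.
have Upsi n : \int[lebQ]_p (psi n p * (u p - v p)) = - 2^-1 * \int[M]_y (W y * tdiff (psi n) y).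
  rewrite -(weak_volterra (tpsi n)); have [B _ HB] := smooth_cc_bounded (cc n).
  rewrite (conv _ B (mpsi n)); last exact: aeW.
  apply: eq_Rintegral => p _; have [pT|pT] := boolP (0 < p.2 < T); first by rewrite restrict_QT_in.
  by rewrite /U restrict_QT_eq0// !mul0r.
pose D n := tdiff (restrict_QT T (fun p => psi n p - f p)).
have LDn n : L2f M (D n).
  rewrite /D restrict_QTB tdiffB; apply: L2B => //.
  apply: (L2_le _ (tdiff_L2 lam_shift lam_cube mu_int (cc n))).
    exact: measurable_tdiff (measurable_restrict_QT T (mpsi n)).
  move=> y; have [yT|yT] := boolP (0 < y.1 < T); first by rewrite /tdiff !restrict_QT_in.
  by rewrite {1}/tdiff !restrict_QT_eq0// subrr normr0.
have sqnD n : seminormTE mu T (psi n \- f) = (Num.sqrt (2^-1 * sqn M (D n)))%:E.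
  rewrite (seminormTE_restrict T lamE mu (measurable_funB (mpsi n) mf)).
  have -> : (\int[M]_y (D n y ^+ 2)%:E = (sqn M (D n))%:E)%E.
    by rewrite /sqn /Rintegral fineK//; exact: integrable_fin_num (L2_sqr_integrable (LDn n)).
  by [].
have D0 : sqn M (D n) @[n --> \oo] --> (0 : R).
  have s0 : Num.sqrt (2^-1 * sqn M (D n)) @[n --> \oo] --> (0 : R).
    have E0 : (Num.sqrt (2^-1 * sqn M (D n)))%:E @[n --> \oo] --> (0 : R)%:E.
      by move: Epsi; rewrite (_ : (fun n => _) = (fun n => (Num.sqrt (2^-1 * sqn M (D n)))%:E))//; exact/funext.
    exact: (fine_cvg E0).
  (* The squared norm is recovered from the seminorm by squaring; the factor 2 undoes the [2^-1] in
     its definition. *)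
  rewrite (_ : (fun n => _) = (fun n => 2 * (Num.sqrt (2^-1 * sqn M (D n)) * Num.sqrt (2^-1 * sqn M (D n))))).
    rewrite -[0](mulr0 (2 : R)) -[X in 2 * X](mulr0 (0 : R)).
    by apply: cvgM; [exact: cvg_cst|apply: cvgM].
  by apply/funext => n; rewrite -expr2 sqr_sqrtr ?mulr_ge0 ?sqn_ge0// mulrA mulfV// mul1r.
have h2 : \int[lebQ]_p (psi n p * (u p - v p)) @[n --> \oo] -->
    - 2^-1 * \int[M]_y (W y * tdiff (restrict_QT T f) y).
  rewrite (_ : (fun n => _) = (fun n => - 2^-1 *
      (\int[M]_y (W y * D n y) + \int[M]_y (W y * tdiff (restrict_QT T f) y)))).
    apply: cvgM; first exact: cvg_cst.
    rewrite -[X in _ --> X]add0r; apply: cvgD; last exact: cvg_cst.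
    exact: L2_mul_cvg0.
  apply/funext => n; rewrite Upsi; congr (_ * _).
  rewrite -(RintegralD measurableT (L2_mul_integrable LW (LDn n)) (L2_mul_integrable LW Lf)).
  apply: eq_Rintegral => y _; rewrite -mulrDr /D restrict_QTB tdiffB subrK.
  (* The functions [psi n] need not vanish at negative times, but [W] does, so restricting them to
     (0,T) leaves the pairing unchanged. *)
  have [yT|yT] := boolP (0 < y.1 < T); first by rewrite /tdiff !restrict_QT_in.
  by rewrite W_supp// !mul0r.
by apply: (cvg_unique _ h1 h2).
Qed.

(** The identity of [pairing_X] is linear in the function, so those for [phi \o u] and [phi \o v]
    are subtracted to give the one for their difference. *)
Lemma uniqueness_X : spaceX mu T (phi \o u) -> spaceX mu T (phi \o v) ->
  {ae lebQ, forall p, u p = v p}.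
Proof.
move=> Xu Xv; apply: pairing_uniqueness.
have mpu := measurable_phi measurable_u; have mpv := measurable_phi measurable_v.
have Lu := energy_L2 measurable_u eu; have Lv := energy_L2 measurable_v ev.
have pu := pairing_X mpu Lu Xu; have pv := pairing_X mpv Lv Xv.
have Uf f : measurable_fun setT f -> f \in Lfun lebQ +oo%E ->
    lamV.-integrable setT (fun p => (U p * restrict_QT T f p)%:E).
  move=> mf foo; have [C C0 /(ae_restrict_QT lamE) fC] := Lfun_oo_ae foo.
  have fC' : {ae lamV, forall p, `|restrict_QT T f p| <= C}.
    apply: (ae_impl _ fC) => p fp; have [pT|pT] := boolP (0 < p.2 < T); first by rewrite restrict_QT_in// fp.
    by rewrite restrict_QT_eq0// normr0.
  have := ae_bounded_mul_integrable (measurable_restrict_QT T mf) fC' Ui.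
  by apply: eq_integrable => // p _; rewrite mulrC.
have FE : F = (fun p => restrict_QT T (phi \o u) p - restrict_QT T (phi \o v) p).
  exact: restrict_QTB (phi \o u) (phi \o v).
have [uX _ _] := Xu; have [vX _ _] := Xv.
have tE : tdiff F = (fun y => tdiff (restrict_QT T (phi \o u)) y - tdiff (restrict_QT T (phi \o v)) y).
  by rewrite FE tdiffB.
transitivity (\int[lamV]_p (U p * restrict_QT T (phi \o u) p - U p * restrict_QT T (phi \o v) p)).
  by apply: eq_Rintegral => p _; rewrite FE mulrBr.
rewrite (RintegralB measurableT (Uf _ mpu uX) (Uf _ mpv vX)) pu pv -mulrBr; congr (_ * _).
rewrite -(RintegralB measurableT (L2_mul_integrable LW Lu) (L2_mul_integrable LW Lv)).
by apply: eq_Rintegral => y _; rewrite -mulrBr; congr (_ * _); exact: (esym (congr1 (@^~ y) tE)).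
Qed.

End two_solutions.

(** For [a <= 1] the lower bound on [beta] gives exponent [2 * beta >= 1], so the square is at most
    [a]; for [a > 1] the upper bound gives at most [a ^+ 2], hence at most [C * a]. *)
Lemma sqr_powR_le (C beta a : R) : 2^-1 <= beta <= 1 -> 0 < a <= C -> (a `^ beta) ^+ 2 <= (1 + C) * a.
Proof.
move=> /andP[b1 b2] /andP[a0 aC]; have p0 := powR_ge0 a beta.
have [a1|/ltW a1] := leP a 1.
  rewrite expr2 -powRD; last by rewrite (gt_eqF a0) implybT.
  apply: (@le_trans _ _ (a `^ 1)); last by rewrite (powRr1 (ltW a0)); nra.
  by apply: ger_powR; rewrite ?a0//; lra.
have : a `^ beta <= a by rewrite -[leRHS](powRr1 (ltW a0)); exact: ler_powR.
by nra.
Qed.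

(** The growth condition bounds the square of [phi (w p) - phi 0] by a constant times [|w p|] on the
    bounded range of [w], so integrability of [w] suffices. *)
Lemma growth_L2 w beta : 2^-1 <= beta <= 1 ->
  (forall r : R, 0 < r ->
     (ereal_sup [set (`|phi s - phi 0| / `|s| `^ beta)%:E
        | s in [set s : R | (s != 0)%R /\ (`|s| < r)%R]] < +oo)%E) ->
  w \in Lfun lebQ 1%E -> w \in Lfun lebQ +oo%E ->
  L2f lamV (restrict_QT T (fun p => phi (w p) - phi 0)).
Proof.
move=> b12 growth w1 woo; have mw := measurable_Lfun w1.
have [C C0 /(ae_restrict_QT lamE) wC] := Lfun_oo_ae woo.
(* The growth condition concerns [|s| < r]; the radius [C + 1] covers all values with [|s| <= C]. *)
have /growth : 0 < C + 1 by rewrite ltr_wpDl.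
set S := ereal_sup _ => Soo.
have [K K0 HK] : exists2 K : R, 0 <= K & forall s, `|s| <= C -> `|phi s - phi 0| <= K * `|s| `^ beta.
  exists (fine (maxe 0%E S)); first by rewrite fine_ge0// le_max lexx.
  move=> s sC; have [->|s0] := eqVneq s 0.
    by rewrite subrr normr0 mulr_ge0 ?powR_ge0// fine_ge0// le_max lexx.
  have s1 : 0 < `|s| `^ beta by rewrite powR_gt0// normr_gt0.
  rewrite -ler_pdivrMr// -lee_fin fineK; last first.
    by rewrite ge0_fin_numE ?gt_max ?Soo ?ltry// le_max lexx.
  rewrite le_max; apply/orP; right; apply: ereal_sup_ubound; exists s => //; split => //.
  by rewrite (le_lt_trans sC)// ltrDl.
have mp : measurable_fun setT (fun p => phi (w p) - phi 0).
  by apply: measurable_funB => //; exact: measurable_phi.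
have mr := measurable_restrict_QT T mp; split => //.
pose D := K ^+ 2 * (1 + C).
have D0 : 0 <= D by rewrite mulr_ge0 ?sqr_ge0// addr_ge0.
have wi := integrable_restrict_QT lamE ((Lfun1_integrable _ _).1 w1).
have Dwi := integrableZl measurableT D (integrable_abse wi).
apply: (@le_lt_trans _ _ (\int[lamV]_p (D * `|restrict_QT T w p|)%:E)%E); last first.
  have /integrableP[_] := Dwi; apply: le_lt_trans; rewrite le_eqVlt; apply/orP; left; apply/eqP.
  by apply: eq_integral => p _; rewrite [RHS]gee0_abs; [|apply: mule_ge0; [rewrite lee_fin|exact: abse_ge0]].
apply: ae_ge0_le_integral => //.
- by move=> p _; rewrite lee_fin sqr_ge0.
- by apply/measurable_EFinP; exact: measurable_funX.
- by move=> p _; rewrite lee_fin mulr_ge0.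
- by have := measurable_int _ Dwi; apply: eq_measurable_fun => p _.
apply: (ae_impl _ wC) => p wp _; rewrite lee_fin.
have [pT|pT] := boolP (0 < p.2 < T); last first.
  by rewrite restrict_QT_eq0// expr0n mulr_ge0.
rewrite !restrict_QT_in//; have {}wp := wp pT; have h := HK _ wp.
have [w0|w0] := eqVneq (w p) 0; first by rewrite w0 subrr expr0n mulr_ge0.
have h2 : (`|w p| `^ beta) ^+ 2 <= (1 + C) * `|w p| by apply: sqr_powR_le => //; rewrite normr_gt0 w0.
rewrite -real_normK ?num_real//; apply: (@le_trans _ _ ((K * `|w p| `^ beta) ^+ 2)).
  by rewrite lerXn2r// nnegrE// mulr_ge0// powR_ge0.
by rewrite exprMn /D -mulrA ler_wpM2l// sqr_ge0.
Qed.

End uniqueness.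

Theorem corollary2p14 (R : realType) (N : nat) (hN : (0 < N)%N)
    (T : R) (hT : 0 < T)
    (varphi : R -> R) (varphi_cont : continuous varphi)
    (varphi_nd : {homo varphi : x y / x <= y})
    (mu : {measure set 'rV[R]_N -> \bar R})
    (mu_radon : radon_punctured mu) (mu_even : even_measure mu)
    (mu_levy : levy_condition mu)
    (u0 : 'rV[R]_N -> R)
    (u0_L1 : u0 \in Lfun (lebesgue_rV R N) 1%E)
    (u0_Loo : u0 \in Lfun (lebesgue_rV R N) +oo%E) :
  [/\ at_most_one_ae T (fun u =>
        distributional_solution mu T varphi u0 u /\ class_UC mu T varphi u),
      at_most_one_ae T (fun u =>
        [/\ distributional_solution mu T varphi u0 u,
            class_EC mu T varphi u &
            varphi \o u \in Lfun (lebesgue_QT T) 2%:E]) &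
      (exists2 beta : R, 2^-1 <= beta <= 1 &
         forall r : R, 0 < r ->
           (ereal_sup [set (`|varphi s - varphi 0| / `|s| `^ beta)%:E
                        | s in [set s : R | (s != 0)%R /\ (`|s| < r)%R]] < +oo)%E) ->
      at_most_one_ae T (fun u =>
        distributional_solution mu T varphi u0 u /\ class_EC mu T varphi u)].
Proof.
(* Lebesgue measure, and below [mu], are replaced by equal measures bundled as sigma-finite; for
   [mu] this comes from the Lévy condition and the null origin. *)
have [lam lamE] := sigma_finite_pack (@sigma_finite_lebesgue_rV R N).
have lam_shift a : preserves lam (fun x => x + a) by rewrite lamE; exact: preserves_lebesgue_rV.
have lam_cube n : (lam (cube n) < +oo)%E.
  have := lebesgue_cube_fin R N n.
  by move: lamE => /(congr1 (fun m : {measure set 'rV[R]_N -> \bar R} => m (cube n))) <-.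
have [mu0 _ _] := mu_radon.
have [mu' muE] := sigma_finite_pack (levy_sigma_finite mu0 mu_levy).
have := even_preserves mu_even; have := levy_mtrunc_integrable mu_levy.
rewrite -muE => mu'_int mu'_even.
(* Common to (b) and (c), which differ only in how the difference of the two images under [varphi]
   is shown to be square-integrable. *)
have uniq2 u v : distributional_solution mu' T varphi u0 u -> class_EC mu' T varphi u ->
    distributional_solution mu' T varphi u0 v -> class_EC mu' T varphi v ->
    L2f (sf_product lam lebesgue_measure) (restrict_QT T (fun p => varphi (u p) - varphi (v p))) ->
    {ae lebesgue_QT T, forall p, u p = v p}.
  move=> su [u1 uoo eu] sv [v1 voo ev].
  exact: (uniqueness_L2 hT lamE lam_shift lam_cube mu'_even mu'_int varphi_cont varphi_nd
    u1 v1 uoo voo su sv eu ev).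
split.
- move=> u v [su [u1 uoo Xu]] [sv [v1 voo Xv]]; have [_ eu _] := Xu; have [_ ev _] := Xv.
  exact: (uniqueness_X hT lamE lam_shift lam_cube mu'_even mu'_int varphi_cont varphi_nd
    u1 v1 uoo voo su sv eu ev Xu Xv).
- move=> u v [su cu u2] [sv cv v2]; apply: uniq2 => //.
  by rewrite restrict_QTB; apply: L2B; [exact: (Lfun2_L2 lamE u2)|exact: (Lfun2_L2 lamE v2)].
- move=> [beta b12 growth] u v [su cu] [sv cv]; apply: uniq2 => //.
  have [u1 uoo _] := cu; have [v1 voo _] := cv.
  have Lu := growth_L2 lamE varphi_cont b12 growth u1 uoo.
  have Lv := growth_L2 lamE varphi_cont b12 growth v1 voo.
  have := L2B Lu Lv; rewrite -restrict_QTB; congr L2f; apply/funext => p.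
  (* Each image alone is square-integrable only after subtracting [varphi 0]; the constant cancels
     in the difference. *)
  by congr (_ * _); ring.
Qed.
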